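(* Let $F|k$ be an extension of algebraically closed fields of characteristic zero of countably infinite transcendence degree, $G=G_{F|k}$, and let $v\in{\mathcal P}^r_F$ be a discrete valuation of $F$, trivial on $k$, of finite rank $r$. Then for any $W,W'\in{\mathcal S}m_G$ restriction to $W_v\subseteq W$ induces canonical isomorphisms $${\rm Hom}_G(W,W')\stackrel{\sim}{\longrightarrow}{\rm Hom}_{G_v}(W_v,W')={\rm Hom}_{G_v}(W_v,W'_v).$$ In particular, the functor $(-)_v:{\mathcal S}m_G\to{\mathcal S}m_{G_v}$, $W\mapsto W_v$, is fully faithful.
   Context: For a subfield $K\subseteq F$, $G_{F|K}$ is the group of field automorphisms of $F$ over $K$; $G=G_{F|k}$ carries the topology in which the stabilizers of finite subsets of $F$ form a base of open subgroups. ${\mathcal P}^r_F$ is the set of valuation rings ${\mathcal O}_v\supseteq k$ in $F$ that are discrete of rank $r$: the value group $\Gamma=F^{\times}/{\mathcal O}_v^{\times}$ has $\dim_{\mathbb Q}\Gamma=r<\infty$ and exactly $r+1$ isolated (convex) subgroups, and $F$ is algebraic over the subfield generated over $k$ by some lift to ${\mathcal O}_v$ of a transcendence base of the residue field over $k$ and a lift to $F^\times$ of a basis of $\Gamma$. $G_v=\{\sigma\in G\mid\sigma({\mathcal O}_v)={\mathcal O}_v\}$ with the subspace topology. For a topological group $U$, ${\mathcal S}m_U$ is the category of smooth representations of $U$ over ${\mathbb Q}$ (those in which the stabilizer of every vector is open). For $W\in{\mathcal S}m_G$, $W_v:=\sum_{F''}W^{G_{F|F''}}\subseteq W$, the sum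 over all subfields $k\subseteq F''\subset{\mathcal O}_v$; it is a $G_v$-submodule of $W$. *)

(* Defs.v *)
From HB Require Import structures.
From mathcomp Require Import all_boot all_order all_algebra.
From mathcomp Require Import generic_quotient ring_quotient.
From mathcomp Require Import boolp classical_sets functions cardinality.
From mathcomp Require Import topology_structure product_topology.
From mathcomp Require Import initial_topology subtype_topology.
(* The notations of mpoly clash with those of the analysis library. *)
From mathcomp Require Import -(notations) mpoly.

Set Implicit Arguments.
Unset Strict Implicit.
Unset Printing Implicit Defensive.

Import GRing.Theory Num.Theory.

Local Open Scope classical_set_scope.
Local Open Scope ring_scope.
Local Open Scope quotient_scope.

Section FieldNotions.
Variables (k L : fieldType) (j : k -> L).

(* As 0^-1 = 0 in a field, this includes closure under division by 0. *)
Definition subfield (K : set L) : Prop := GRing.divring_closed (mem K).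

Definition gen_subfield (A : set L) : set L := smallest subfield A.

Definition algebraic_over (K : set L) (x : L) : Prop :=
  exists p : {poly L}, [/\ p != 0, p \is a polyOver (mem K) & root p x].

(* [mpoly n k] is {mpoly k[n]}, and [mmap j x p] is the value at x of p, its
   coefficients being mapped by j. *)
Definition alg_independent (B : set L) : Prop :=
  forall (n : nat) (x : 'I_n -> L), injective x -> (forall i, B (x i)) ->
  forall p : mpoly n k, mmap j x p = 0 -> p = 0.

Definition transcendence_base (B : set L) : Prop :=
  alg_independent B /\
  forall x : L, algebraic_over (gen_subfield (range j `|` B)) x.

Definition countably_infinite_trdeg : Prop :=
  exists B : set L, transcendence_base B /\ (B #= [set: nat])%card.

End FieldNotions.

Record valuation_ring (k F : fieldType) (iota : {rmorphism k -> F}) :=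
  ValuationRing {
  vring : set F;
  vring_subring : subring_closed (mem vring);
  vring_const : range iota `<=` vring;
  vring_total : forall x : F, x != 0 -> vring x \/ vring x^-1 }.

Section ValuationRingTheory.
Variables (k F : fieldType) (iota : {rmorphism k -> F}).
Variable v : valuation_ring iota.
Local Notation Ov := (vring v).

Lemma vring1 : Ov 1.
Proof. by have [+ _ _] := vring_subring v; rewrite inE. Qed.

Lemma vringB x y : Ov x -> Ov y -> Ov (x - y).
Proof.
move=> vx vy; have [_ + _] := vring_subring v.
by move=> /(_ x y); rewrite !inE; apply.
Qed.

Lemma vringM x y : Ov x -> Ov y -> Ov (x * y).
Proof.
move=> vx vy; have [_ _] := vring_subring v.
by move=> /(_ x y); rewrite !inE; apply.
Qed.

Lemma vring0 : Ov 0.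
Proof. by rewrite -(subrr 1); apply: vringB; exact: vring1. Qed.

Lemma vringD x y : Ov x -> Ov y -> Ov (x + y).
Proof.
move=> vx vy; rewrite -[y]opprK -[- y]add0r; apply: vringB => //.
by apply: vringB => //; exact: vring0.
Qed.

Lemma vringX x n : Ov x -> Ov (x ^+ n).
Proof.
by move=> vx; elim: n => [|n IH]; rewrite ?exprS; [exact: vring1|exact: vringM].
Qed.

(* A valuation ring is integrally closed; only radicals are needed here. *)
Lemma vring_root x n : (0 < n)%N -> Ov (x ^+ n) -> Ov x.
Proof.
case: n => // n _ vxn; have [->|x0] := eqVneq x 0; first exact: vring0.
case: (vring_total v x0) => // vxV.
have -> : x = x ^+ n.+1 * x^-1 ^+ n.
  by rewrite exprS exprVn mulfK // expf_neq0.
by apply: vringM => //; exact: vringX.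
Qed.

End ValuationRingTheory.

Section ResidueField.
Variables (k F : fieldType) (iota : {rmorphism k -> F}).
Variable v : valuation_ring iota.
Local Notation Ov := (vring v).

Definition vpred : {pred F} := mem (vring v).

Lemma vpred_subring : subring_closed vpred.
Proof. exact: vring_subring. Qed.

HB.instance Definition _ := GRing.isSubringClosed.Build F vpred vpred_subring.

Definition vtype : Type := {x : F | x \in vpred}.

HB.instance Definition _ := SubChoice.on vtype.
HB.instance Definition _ := [SubChoice_isSubComNzRing of vtype by <:].

(* The nonunits; the case x = 0 is separate since 0^-1 = 0. *)
Definition max_ideal : {pred vtype} :=
  fun x => `[< val x != 0 -> ~ Ov (val x)^-1 >].

Lemma max_idealP (x : vtype) :
  reflect (val x != 0 -> ~ Ov (val x)^-1) (x \in max_ideal).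
Proof. exact: asboolP. Qed.

Lemma max_ideal_closed : idealr_closed max_ideal.
Proof.
have vP (x : vtype) : Ov (val x) by have := valP x; rewrite inE.
split.
- by apply/max_idealP; rewrite eqxx.
- apply/negP => /max_idealP; have -> : val (1 : vtype) = 1 by [].
  by rewrite oner_neq0 invr1 => /(_ isT); apply; exact: vring1.
- have absorb (a x : F) : Ov a -> Ov (a * x)^-1 -> a * x != 0 -> Ov x^-1.
    move=> va vax; rewrite mulf_eq0 negb_or => /andP[a0 x0].
    have -> : x^-1 = a * (a * x)^-1 by rewrite invfM mulrA divff // mul1r.
    exact: vringM.
  move=> a x y /max_idealP xI /max_idealP yI; apply/max_idealP.
  have -> : val (a * x + y) = val a * val x + val y by [].
  set s := _ + _ => s0 vs.
  have key (p q : F) : Ov (q / p) -> p + q = s -> p != 0 -> Ov p^-1.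
    move=> vqp pqs p0; have -> : p^-1 = (1 + q / p) * s^-1.
      rewrite -pqs; have -> : 1 + q / p = (p + q) / p by rewrite mulrDl divff.
      by rewrite mulrAC divff ?mul1r // pqs.
    by apply: vringM => //; apply: vringD => //; exact: vring1.
  have [ax0|ax0] := eqVneq (val a * val x) 0.
    by move: s0 vs; rewrite /s ax0 add0r => y0; exact: yI.
  have [y0|y0] := eqVneq (val y) 0.
    have x0 : val x != 0 by apply: contraNneq ax0 => ->; rewrite mulr0.
    apply: (xI x0); apply: (absorb (val a)) => //.
    by move: vs; rewrite /s y0 addr0.
  have q0 : val y / (val a * val x) != 0 by rewrite mulf_neq0 ?invr_eq0.
  have [vq|] := vring_total v q0.
    have x0 : val x != 0 by apply: contraNneq ax0 => ->; rewrite mulr0.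
    by apply: (xI x0); apply: (absorb (val a)) => //; exact: key vq _ ax0.
  rewrite invf_div => vq; apply: (yI y0); apply: key vq _ y0.
  by rewrite addrC.
Qed.

HB.instance Definition _ := isIdealr.Build vtype max_ideal max_ideal_closed.

Definition residue_field : Type := {ideal_quot max_ideal}.

HB.instance Definition _ := GRing.ComNzRing.on residue_field.

Definition residue (x : vtype) : residue_field := \pi_({ideal_quot max_ideal}) x.

Lemma residue_eq0 x : (residue x == 0) = (x \in max_ideal).
Proof.
rewrite -[x in RHS]subr0 Quotient.idealrBE /residue.
by have -> : \pi_({ideal_quot max_ideal}) 0 = 0 by rewrite !piE.
Qed.

Lemma residue_inv_ex (a : residue_field) : a != 0 -> exists b, b * a = 1.
Proof.
rewrite -[a]reprK -/(residue _) residue_eq0; set x := repr _ => xI.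
have [x0 vx] : val x != 0 /\ Ov (val x)^-1.
  apply: contrapT => H; move/negP: xI; apply; apply/max_idealP => x0 vx.
  by apply: H.
have vx' : (val x)^-1 \in vpred by rewrite inE.
exists (residue (Sub (val x)^-1 vx')); rewrite /residue.
have -> : 1 = \pi_({ideal_quot max_ideal}) 1 by rewrite !piE.
by rewrite -rmorphM; congr (\pi _); apply: val_inj; rewrite /= mulVf.
Qed.

Definition residue_inv (a : residue_field) : residue_field :=
  if a == 0 then 0 else xget 0 [set b | b * a = 1].

Lemma residue_mulVf (a : residue_field) : a != 0 -> residue_inv a * a = 1.
Proof.
move=> a0; rewrite /residue_inv (negPf a0).
by have [b ba] := residue_inv_ex a0; exact: (@xgetPex _ 0 [set b | b * a = 1] (ex_intro _ b ba)).
Qed.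

Lemma residue_invr0 : residue_inv 0 = 0.
Proof. by rewrite /residue_inv eqxx. Qed.

HB.instance Definition _ :=
  GRing.ComNzRing_isField.Build residue_field residue_mulVf residue_invr0.

Lemma const_vpred (c : k) : iota c \in vpred.
Proof. by rewrite inE; apply: (@vring_const _ _ _ v); exists c. Qed.

Definition residue_const (c : k) : residue_field :=
  residue (Sub (iota c) (const_vpred c)).

End ResidueField.

Section UniquelyDivisible.
Variable V : zmodType.

(* a x is the y such that (denominator of a) y = (numerator of a) x; it exists and
   is unique when V is divisible and torsion-free. *)
Definition ratscale (a : rat) (x : V) : V :=
  xget 0 [set y | y *~ denq a = x *~ numq a].

Hypothesis torsion_free : forall (x : V) (n : nat), x *+ n.+1 = 0 -> x = 0.
Hypothesis divisible : forall (x : V) (n : nat), exists y, y *+ n.+1 = x.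

Lemma mulrz_injV (x y : V) (n : int) : n != 0 -> x *~ n = y *~ n -> x = y.
Proof.
move=> n0 /eqP; rewrite -subr_eq0 -mulrzBl => /eqP e.
apply/eqP; rewrite -subr_eq0; apply/eqP; move: e n0.
case: n => [[|n]|n] //.
  by rewrite -pmulrn => /torsion_free.
by rewrite NegzE mulrNz => /eqP; rewrite oppr_eq0 -pmulrn => /eqP /torsion_free.
Qed.

Lemma ratscaleE a x : ratscale a x *~ denq a = x *~ numq a.
Proof.
rewrite /ratscale.
have : exists y, [set y | y *~ denq a = x *~ numq a] y.
  have [y ye] := divisible (x *~ numq a) `|denq a|.-1.
  exists y => /=; rewrite -ye pmulrn prednK ?absz_gt0 ?denq_neq0 //.
  by rewrite absz_denq.
exact: xgetPex.
Qed.

Lemma ratscaleP a x y (m n : int) :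
  n != 0 -> a = m%:~R / n%:~R -> y *~ n = x *~ m -> ratscale a x = y.
Proof.
move=> n0 ae ye; apply: (@mulrz_injV _ _ (denq a * n)).
  by rewrite mulf_neq0 ?denq_neq0.
rewrite mulrzA ratscaleE [denq a * n]mulrC mulrzA ye -!mulrzA; congr (_ *~ _).
apply: (@intr_inj rat); rewrite !rmorphM /= [RHS]mulrC.
have n0' : n%:~R != 0 :> rat by rewrite intr_eq0.
have -> : m%:~R = a * n%:~R by rewrite ae divfK.
by rewrite mulrA [_ * a]mulrC -{2}(divq_num_den a) divfK // intr_eq0 denq_neq0.
Qed.

Lemma rat_divE (a : rat) : a = (numq a)%:~R / (denq a)%:~R.
Proof. by rewrite divq_num_den. Qed.

Lemma ratscaleA a b x : ratscale a (ratscale b x) = ratscale (a * b) x.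
Proof.
apply/esym; apply: (@ratscaleP _ _ _ (numq a * numq b) (denq a * denq b)).
- by rewrite mulf_neq0 ?denq_neq0.
- rewrite !rmorphM /= {1}(rat_divE a) {1}(rat_divE b).
  by rewrite mulrACA -invfM.
- rewrite mulrzA (ratscaleE a) -mulrzA [numq a * denq b]mulrC
    (mulrzA (ratscale b x)) (ratscaleE b).
  by rewrite -mulrzA [numq b * _]mulrC.
Qed.

Lemma ratscale1 : left_id 1 ratscale.
Proof. by move=> x; apply: (@ratscaleP _ _ _ 1 1). Qed.

Lemma ratscaleDr : right_distributive ratscale +%R.
Proof.
move=> a x y; apply: (@ratscaleP _ _ _ (numq a) (denq a)).
- exact: denq_neq0.
- exact: rat_divE.
- by rewrite !mulrzDl !ratscaleE.
Qed.

Lemma ratscaleDl x : {morph ratscale^~ x : a b / a + b}.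
Proof.
move=> a b.
apply: (@ratscaleP _ _ _ (numq a * denq b + numq b * denq a) (denq a * denq b)).
- by rewrite mulf_neq0 ?denq_neq0.
- rewrite rmorphD !rmorphM /= {1}(rat_divE a) {1}(rat_divE b).
  by rewrite addf_div // intr_eq0 denq_neq0.
- rewrite mulrzDl mulrzA (ratscaleE a) [denq a * denq b]mulrC
    (mulrzA (ratscale b x)) (ratscaleE b).
  by rewrite -!mulrzA -mulrzDr.
Qed.

End UniquelyDivisible.

Definition Qbasis (V : lmodType rat) (I : finType) (e : I -> V) : Prop :=
  (forall c : I -> rat, \sum_i c i *: e i = 0 -> forall i, c i = 0) /\
  (forall x : V, exists c : I -> rat, x = \sum_i c i *: e i).

Definition Qdim (V : lmodType rat) (r : nat) : Prop :=
  exists e : 'I_r -> V, Qbasis e.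

(* The multiplicative group of F, written additively so that its quotient by
   O_v^* is a zmodType. *)
Definition mulgrp (F : fieldType) : Type := {x : F | x != 0}.

HB.instance Definition _ (F : fieldType) := SubChoice.on (mulgrp F).

Section MulGrp.
Variable F : fieldType.
Implicit Types x y z : mulgrp F.

Lemma mulgrp_neq0 x : val x != 0.
Proof. exact: (valP x). Qed.

Definition mulgrp0 : mulgrp F := Sub 1 (oner_neq0 F).

Lemma mulgrp_opp_subproof x : (val x)^-1 != 0.
Proof. by rewrite invr_eq0; exact: mulgrp_neq0. Qed.
Definition mulgrp_opp x : mulgrp F := Sub (val x)^-1 (mulgrp_opp_subproof x).

Lemma mulgrp_add_subproof x y : val x * val y != 0.
Proof. by rewrite mulf_neq0 //; exact: mulgrp_neq0. Qed.
Definition mulgrp_add x y : mulgrp F := Sub (val x * val y) (mulgrp_add_subproof x y).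

Lemma mulgrp_addA : associative mulgrp_add.
Proof. by move=> x y z; apply: val_inj; rewrite /= mulrA. Qed.
Lemma mulgrp_addC : commutative mulgrp_add.
Proof. by move=> x y; apply: val_inj; rewrite /= mulrC. Qed.
Lemma mulgrp_add0 : left_id mulgrp0 mulgrp_add.
Proof. by move=> x; apply: val_inj; rewrite /= mul1r. Qed.
Lemma mulgrp_addN : left_inverse mulgrp0 mulgrp_opp mulgrp_add.
Proof. by move=> x; apply: val_inj; rewrite /= mulVf //; exact: mulgrp_neq0. Qed.

HB.instance Definition _ := GRing.isZmodule.Build (mulgrp F)
  mulgrp_addA mulgrp_addC mulgrp_add0 mulgrp_addN.

Lemma mulgrp_valMn x n : val (x *+ n) = val x ^+ n.
Proof. by elim: n => [|n IH]; rewrite ?mulrS ?exprS //= IH. Qed.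

End MulGrp.

Section ValueGroup.
Variables (k : fieldType) (F : closedFieldType) (iota : {rmorphism k -> F}).
Variable v : valuation_ring iota.
Local Notation Ov := (vring v).

Definition vunits : {pred mulgrp F} := fun x => `[< Ov (val x) /\ Ov (val x)^-1 >].

Lemma vunitsP x : reflect (Ov (val x) /\ Ov (val x)^-1) (x \in vunits).
Proof. exact: asboolP. Qed.

Lemma vunits_zmod_closed : zmod_closed vunits.
Proof.
split; first by apply/vunitsP; rewrite /= invr1; split; exact: vring1.
move=> x y /vunitsP[vx vxV] /vunitsP[vy vyV]; apply/vunitsP => /=.
by rewrite invf_div; split; rewrite ?[_ / val x]mulrC; exact: vringM.
Qed.

HB.instance Definition _ := GRing.isZmodClosed.Build (mulgrp F) vunits vunits_zmod_closed.

Definition value_group : Type := @Quotient.quot (mulgrp F) vunits.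

HB.instance Definition _ := GRing.Zmodule.on value_group.

Definition value (x : mulgrp F) : value_group := \pi_(@Quotient.quot (mulgrp F) vunits) x.

Lemma value_eq0 x : (value x == 0) = (x \in vunits).
Proof.
rewrite -[x in RHS]subr0 Quotient.idealrBE /value.
by have -> : \pi_(@Quotient.quot (mulgrp F) vunits) 0 = 0 by rewrite !piE.
Qed.

Lemma valueMn x n : value x *+ n = value (x *+ n).
Proof. by rewrite /value raddfMn. Qed.

Lemma value_torsion_free (g : value_group) (n : nat) : g *+ n.+1 = 0 -> g = 0.
Proof.
rewrite -[g]reprK -/(value _) valueMn => /eqP; rewrite value_eq0.
move=> /vunitsP; rewrite mulgrp_valMn -exprVn => -[vx vxV].
by apply/eqP; rewrite value_eq0; apply/vunitsP; split; exact: (@vring_root _ _ _ v _ n.+1).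
Qed.

Lemma value_divisible (g : value_group) (n : nat) : exists h : value_group, h *+ n.+1 = g.
Proof.
rewrite -[g]reprK -/(value _); set x := repr _.
have [y] := @solve_monicpoly F n.+1 (fun i => if i == 0%N then val x else 0) isT.
rewrite big_ord_recl /= expr0 mulr1 big1 ?addr0 => [yx|i _]; last by rewrite mul0r.
have y0 : y != 0.
  by apply: contra_eq_neq yx => ->; rewrite expr0n eq_sym; exact: mulgrp_neq0.
exists (value (Sub y y0)); rewrite valueMn; congr value.
by apply: val_inj; rewrite mulgrp_valMn.
Qed.

HB.instance Definition _ := GRing.Zmodule_isLmodule.Build rat value_group
  (ratscaleA value_torsion_free value_divisible)
  (ratscale1 value_torsion_free value_divisible)
  (ratscaleDr value_torsion_free value_divisible)
  (ratscaleDl value_torsion_free value_divisible).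

Definition value_le (g h : value_group) : Prop :=
  exists x : mulgrp F, h - g = value x /\ Ov (val x).

Definition isolated_subgroup (H : set value_group) : Prop :=
  zmod_closed (mem H) /\
  forall g h, value_le 0 g -> value_le g h -> H h -> H g.

Definition discrete_of_rank (r : nat) : Prop :=
  [/\ Qdim value_group r,
      ([set H | isolated_subgroup H] #= `I_r.+1)%card
    & exists (T : set (vtype v)) (t : 'I_r -> mulgrp F),
      [/\ {in T &, injective (@residue _ _ _ v)},
          transcendence_base (@residue_const _ _ _ v) (@residue _ _ _ v @` T),
          Qbasis (fun i => value (t i))
        & forall x : F, algebraic_over
            (gen_subfield (range iota `|` [set val y | y in T]
                                      `|` range (fun i => val (t i)))) x]].

End ValueGroup.

HB.mixin Record isTopGroup U of Group U & Topological U := {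
  mulg_cts : continuous (fun p : U * U => (p.1 * p.2)%g);
  invg_cts : continuous (fun x : U => (x^-1)%g) }.

#[short(type="topGroupType")]
HB.structure Definition TopGroup := { U of isTopGroup U & Group U & Topological U }.

Record smooth_rep (U : topGroupType) := SmoothRep {
  rep_space :> lmodType rat;
  rep_act : U -> rep_space -> rep_space;
  rep_linear : forall g, linear (rep_act g);
  rep_act1 : forall w, rep_act 1%g w = w;
  rep_actM : forall g h w, rep_act (g * h)%g w = rep_act g (rep_act h w);
  rep_smooth : forall w, open [set g | rep_act g w = w] }.

Section Hom.
Variables (U : topGroupType) (W W' : smooth_rep U).

Definition rep_morphism : {pred W -> W'} := fun f =>
  `[< linear f /\ forall g w, f (rep_act g w) = rep_act g (f w) >].

Lemma rep_morphismP f :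
  reflect (linear f /\ forall g w, f (rep_act g w) = rep_act g (f w))
          (f \in rep_morphism).
Proof. exact: asboolP. Qed.

Lemma rep_morphism_submod : submod_closed rep_morphism.
Proof.
have act_lin (g : U) a (x y : W') :
    rep_act g (a *: x + y) = a *: rep_act g x + rep_act g y by apply: rep_linear.
split.
  apply/rep_morphismP; split=> [a x y|g w]; first by rewrite scaler0 addr0.
  change (0 = rep_act g (0 : W')).
  by have := act_lin g (-1) 0 0; rewrite scaler0 addr0 scaleN1r addNr.
move=> a f h /rep_morphismP[fl fe] /rep_morphismP[hl he].
apply/rep_morphismP; split=> [b x y|g w].
  change (a *: f (b *: x + y) + h (b *: x + y)
          = b *: (a *: f x + h x) + (a *: f y + h y)).
  rewrite fl hl !scalerDr !scalerA [b * a]mulrC -!addrA; congr (_ + _).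
  by rewrite addrCA.
change (a *: f (rep_act g w) + h (rep_act g w) = rep_act g (a *: f w + h w)).
by rewrite fe he act_lin.
Qed.

HB.instance Definition _ :=
  GRing.isSubmodClosed.Build rat (W -> W') rep_morphism rep_morphism_submod.

Definition Hom : Type := {f : W -> W' | f \in rep_morphism}.

HB.instance Definition _ := SubChoice.on Hom.
HB.instance Definition _ := [SubChoice_isSubLmodule of Hom by <:].

Definition hom_fun (f : Hom) : W -> W' := val f.

Definition hom_of (f : W -> W') (fl : linear f)
    (fe : forall g w, f (rep_act g w) = rep_act g (f w)) : Hom :=
  Sub f (introT (rep_morphismP f) (conj fl fe)).

Lemma hom_linear (f : Hom) : linear (hom_fun f).
Proof. by have /rep_morphismP[] := valP f. Qed.

Lemma hom_equiv (f : Hom) g w : hom_fun f (rep_act g w) = rep_act g (hom_fun f w).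
Proof. by have /rep_morphismP[_] := valP f; exact. Qed.

Lemma hom_ext (f h : Hom) : hom_fun f =1 hom_fun h -> f = h.
Proof. by move=> fh; apply: val_inj; apply: funext. Qed.

End Hom.

Coercion hom_fun : Hom >-> Funclass.

Definition Q_isomorphism (V V' : lmodType rat) (f : V -> V') : Prop :=
  linear f /\ bijective f.

Record category := Category {
  obj :> Type;
  mor : obj -> obj -> Type;
  idm : forall a, mor a a;
  cmp : forall a b c, mor b c -> mor a b -> mor a c;
  cmp1m : forall a b (f : mor a b), cmp (idm b) f = f;
  cmpm1 : forall a b (f : mor a b), cmp f (idm a) = f;
  cmpA : forall a b c d (f : mor c d) (g : mor b c) (h : mor a b),
    cmp f (cmp g h) = cmp (cmp f g) h }.

Record functor (C D : category) := Functor {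
  fobj :> C -> D;
  fmap : forall a b, mor a b -> mor (fobj a) (fobj b);
  fmap1 : forall a, fmap (idm a) = idm (fobj a);
  fmapM : forall a b c (f : mor b c) (g : mor a b),
    fmap (cmp f g) = cmp (fmap f) (fmap g) }.

Definition fully_faithful (C D : category) (Phi : functor C D) : Prop :=
  forall a b : C, bijective (@fmap C D Phi a b).

Section SmoothCategory.
Variable U : topGroupType.

Definition hom_id (W : smooth_rep U) : Hom W W :=
  @hom_of U W W id (fun _ _ _ => erefl) (fun _ _ => erefl).

Lemma hom_comp_linear (W1 W2 W3 : smooth_rep U) (f : Hom W2 W3) (g : Hom W1 W2) :
  linear (f \o g).
Proof. by move=> a x y; rewrite /= !hom_linear. Qed.

Lemma hom_comp_equiv (W1 W2 W3 : smooth_rep U) (f : Hom W2 W3) (g : Hom W1 W2) s w :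
  (f \o g) (rep_act s w) = rep_act s ((f \o g) w).
Proof. by rewrite /= !hom_equiv. Qed.

Definition hom_comp (W1 W2 W3 : smooth_rep U) (f : Hom W2 W3) (g : Hom W1 W2) :
    Hom W1 W3 :=
  hom_of (hom_comp_linear f g) (hom_comp_equiv f g).

Lemma hom_comp1f (W1 W2 : smooth_rep U) (f : Hom W1 W2) : hom_comp (hom_id W2) f = f.
Proof. exact: hom_ext. Qed.

Lemma hom_compf1 (W1 W2 : smooth_rep U) (f : Hom W1 W2) : hom_comp f (hom_id W1) = f.
Proof. exact: hom_ext. Qed.

Lemma hom_compA (W1 W2 W3 W4 : smooth_rep U)
    (f : Hom W3 W4) (g : Hom W2 W3) (h : Hom W1 W2) :
  hom_comp f (hom_comp g h) = hom_comp (hom_comp f g) h.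
Proof. exact: hom_ext. Qed.

Definition Sm : category := @Category (smooth_rep U) (@Hom U) hom_id hom_comp
  hom_comp1f hom_compf1 hom_compA.

End SmoothCategory.

Section AutomorphismGroup.
Variables (k F : fieldType) (iota : {rmorphism k -> F}).

Definition field_aut : {pred F -> F} := fun s => `[<
  [/\ {morph s : x y / x + y}, {morph s : x y / x * y}, bijective s
    & forall c, s (iota c) = iota c] >].

Lemma field_autP s : reflect
  [/\ {morph s : x y / x + y}, {morph s : x y / x * y}, bijective s
    & forall c, s (iota c) = iota c] (s \in field_aut).
Proof. exact: asboolP. Qed.

Definition Gal : Type := {s : F -> F | s \in field_aut}.

HB.instance Definition _ := SubChoice.on Gal.

Definition gal_fun (s : Gal) : F -> F := val s.

Local Coercion gal_fun : Gal >-> Funclass.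

Lemma galP (s : Gal) :
  [/\ {morph s : x y / x + y}, {morph s : x y / x * y}, bijective s
    & forall c, s (iota c) = iota c].
Proof. by apply/field_autP; exact: valP. Qed.

Lemma gal_ext (s t : Gal) : s =1 t -> s = t.
Proof. by move=> st; apply: val_inj; apply: funext. Qed.

Lemma gal_zmod_morphism (s : Gal) : zmod_morphism s.
Proof.
have [sD _ _ _] := galP s => x y.
by apply/eqP; rewrite eq_sym subr_eq -sD subrK.
Qed.

Lemma gal_monoid_morphism (s : Gal) : monoid_morphism s.
Proof. by have [_ sM _ sk] := galP s; split=> //; have := sk 1; rewrite rmorph1. Qed.

HB.instance Definition _ (s : Gal) :=
  GRing.isZmodMorphism.Build F F (gal_fun s) (gal_zmod_morphism s).
HB.instance Definition _ (s : Gal) :=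
  GRing.isMonoidMorphism.Build F F (gal_fun s) (gal_monoid_morphism s).

Lemma gal_one_subproof : id \in field_aut.
Proof. by apply/field_autP; split=> //; exists id. Qed.
Definition gal_one : Gal := Sub id gal_one_subproof.

Lemma gal_mul_subproof (s t : Gal) : (s \o t) \in field_aut.
Proof.
have [sD sM sB sk] := galP s; have [tD tM tB tk] := galP t.
apply/field_autP; split=> [x y|x y||c] /=; rewrite ?tD ?sD ?tM ?sM ?tk ?sk //.
exact: bij_comp.
Qed.
Definition gal_mul (s t : Gal) : Gal := Sub (s \o t) (gal_mul_subproof s t).

Lemma gal_inv_ex (s : Gal) : exists t : Gal, cancel s t /\ cancel t s.
Proof.
have [sD sM [t st ts] sk] := galP s.
have tP : t \in field_aut.
  apply/field_autP; split=> [x y|x y||c].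
  - by apply: (can_inj st); rewrite sD !ts.
  - by apply: (can_inj st); rewrite sM !ts.
  - by exists s.
  - by apply: (can_inj st); rewrite ts sk.
by exists (Sub t tP).
Qed.
Definition gal_inv (s : Gal) : Gal := sval (cid (gal_inv_ex s)).

Lemma gal_invK (s : Gal) : cancel s (gal_inv s) /\ cancel (gal_inv s) s.
Proof. exact: svalP (cid (gal_inv_ex s)). Qed.

Lemma gal_mulA : associative gal_mul.
Proof. by move=> s t u; exact: gal_ext. Qed.
Lemma gal_mul1 : left_id gal_one gal_mul.
Proof. by move=> s; exact: gal_ext. Qed.
Lemma gal_mulr1 : right_id gal_one gal_mul.
Proof. by move=> s; exact: gal_ext. Qed.
Lemma gal_mulV : left_inverse gal_one gal_inv gal_mul.
Proof. by move=> s; apply: gal_ext => x; exact: (gal_invK s).1. Qed.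
Lemma gal_mulrV : right_inverse gal_one gal_inv gal_mul.
Proof. by move=> s; apply: gal_ext => x; exact: (gal_invK s).2. Qed.

HB.instance Definition _ :=
  isGroup.Build Gal gal_mulA gal_mul1 gal_mulr1 gal_mulV gal_mulrV.

Lemma galM (s t : Gal) x : gal_fun (s * t)%g x = s (t x). Proof. by []. Qed.
Lemma gal1 x : gal_fun 1%g x = x. Proof. by []. Qed.
Lemma galKV (s : Gal) x : gal_fun (s^-1)%g (s x) = x.
Proof. exact: (gal_invK s).1. Qed.
Lemma galVK (s : Gal) x : s (gal_fun (s^-1)%g x) = x.
Proof. exact: (gal_invK s).2. Qed.

(* For a subfield K of F containing k, this is G_{F|K}; for a finite set it is
   the (pointwise) stabilizer. *)
Definition gal_fix (K : set F) : set Gal := [set s | forall x, K x -> s x = x].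

(* A is open iff it contains, with each s, a coset s H where H is the stabilizer
   of a finite subset of F. *)
Definition gal_open (A : set Gal) : Prop :=
  forall s, A s -> exists S : set F,
    finite_set S /\ forall t, gal_fix S t -> A (s * t)%g.

Lemma gal_openT : gal_open setT.
Proof. by move=> s _; exists set0. Qed.

Lemma gal_openI : setI_closed gal_open.
Proof.
move=> A B oA oB s [/oA[S [fS SA]] /oB[T [fT TB]]].
exists (S `|` T); split=> [|t ft]; first by rewrite finite_setU.
by split; [apply: SA|apply: TB] => x xS; apply: ft; [left|right].
Qed.

Lemma gal_open_bigU (I : Type) (f : I -> set Gal) :
  (forall i, gal_open (f i)) -> gal_open (\bigcup_i f i).
Proof.
move=> of_ s [i _ /of_[S [fS Sf]]]; exists S; split=> // t /Sf.
by exists i.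
Qed.

HB.instance Definition _ :=
  isOpenTopological.Build Gal gal_openT gal_openI gal_open_bigU.

Lemma gal_nbhsP (s : Gal) (A : set Gal) : nbhs s A <->
  exists S : set F, finite_set S /\ forall t, gal_fix S t -> A (s * t)%g.
Proof.
split=> [|[S [fS SA]]].
  by case=> B [oB Bs BA]; have [S [fS SB]] := oB s Bs;
    exists S; split=> // t /SB /BA.
exists [set u : Gal | forall x, S x -> u x = s x].
have sB : gal_open [set u : Gal | forall x, S x -> u x = s x].
  move=> u us; exists S; split=> // t tS x Sx.
  by rewrite galM tS // us.
split=> // u us; have -> : u = (s * (s^-1 * u))%g.
  by apply: gal_ext => x; rewrite !galM galVK.
by apply: SA => x Sx; rewrite galM us // galKV.
Qed.

Lemma gal_openE (A : set Gal) : open A <-> gal_open A.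
Proof.
rewrite openE; split=> oA s As; first exact/gal_nbhsP/oA.
exact/gal_nbhsP/oA.
Qed.

Lemma gal_mul_cts : continuous (fun p : Gal * Gal => (p.1 * p.2)%g).
Proof.
move=> [s t] A /= /gal_nbhsP[S [fS SA]].
exists ([set u : Gal | forall x, S x -> u (gal_fun t x) = gal_fun s (gal_fun t x)],
        [set u : Gal | forall x, S x -> u x = gal_fun t x]).
  split; apply/gal_nbhsP => /=.
    exists (gal_fun t @` S); split=> [|u uS x Sx]; first exact: finite_image.
    by rewrite galM uS //; exists x.
  by exists S; split=> // u uS x Sx; rewrite galM uS.
move=> [u w] /= [us wt]; have -> : (u * w)%g = (s * t * ((s * t)^-1 * (u * w)))%g.
  by rewrite mulVKg.
apply: SA => x Sx; rewrite !galM wt // us //.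
by rewrite -[gal_fun s (gal_fun t x)]galM galKV.
Qed.

Lemma gal_inv_cts : continuous (fun s : Gal => (s^-1)%g).
Proof.
move=> s A /= /gal_nbhsP[S [fS SA]]; apply/gal_nbhsP.
exists (gal_fun (s^-1)%g @` S); split=> [|t tS /=]; first exact: finite_image.
have -> : ((s * t)^-1 = s^-1 * (s * (s * t)^-1))%g.
  by rewrite mulKg.
apply: SA => x Sx; rewrite galM.
have e : gal_fun (s * t)%g (gal_fun (s^-1)%g x) = x by rewrite galM tS ?galVK //; exists x.
by rewrite -{1}e galKV galVK.
Qed.

HB.instance Definition _ := isTopGroup.Build Gal gal_mul_cts gal_inv_cts.

End AutomorphismGroup.

Coercion gal_fun : Gal >-> Funclass.

Section DecompositionGroup.
Variables (k F : fieldType) (iota : {rmorphism k -> F}).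
Variable v : valuation_ring iota.
Local Notation Ov := (vring v).

Definition stab_v : set (Gal iota) := [set s | s @` Ov = Ov].

Definition decomp_group : Type := {s : Gal iota | s \in stab_v}.

Lemma stab_v_group : group_closed (mem stab_v).
Proof.
split.
  rewrite inE /stab_v /=; apply/seteqP; split=> [_ [x vx <-]//|x vx].
  by exists x.
move=> s t; rewrite !inE /stab_v /= => sv tv.
rewrite -{2}sv -{1}tv; apply/seteqP; split=> [_ [_ [x vx <-] <-]|_ [x vx <-]].
  by exists x => //; rewrite galM galKV.
by exists (gal_fun t x); [exists x|rewrite galM galKV].
Qed.

HB.instance Definition _ := SubChoice.on decomp_group.
HB.instance Definition _ := SubChoice_isSubGroup.Build (Gal iota) (mem stab_v)
  decomp_group stab_v_group.
HB.instance Definition _ :=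
  Topological.copy decomp_group (initial_topology (val : decomp_group -> Gal iota)).

Lemma decomp_val_cts : continuous (val : decomp_group -> Gal iota).
Proof. exact: initial_continuous. Qed.

Lemma decomp_cts (T : topologicalType) (f : T -> decomp_group) :
  continuous (val \o f : T -> Gal iota) -> continuous f.
Proof. by move=> /continuousP cf; apply/continuousP => _ [B oB <-]; exact: cf. Qed.

Lemma decomp_mul_cts : continuous (fun p : decomp_group * decomp_group => (p.1 * p.2)%g).
Proof.
apply: decomp_cts => p; rewrite /comp.
apply: (@continuous2_cvg _ _ _ _ _ _ (fun q => val q.1) (fun q => val q.2)
  (fun x y : Gal iota => (x * y)%g)); first exact: mulg_cts (val p.1, val p.2).
  by apply: continuous_comp; [exact: cvg_fst|exact: decomp_val_cts].
by apply: continuous_comp; [exact: cvg_snd|exact: decomp_val_cts].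
Qed.

Lemma decomp_inv_cts : continuous (fun s : decomp_group => (s^-1)%g).
Proof.
apply: decomp_cts => s.
change (continuous_at s ((fun x : Gal iota => (x^-1)%g) \o val)).
apply: continuous_comp.
  exact: decomp_val_cts.
exact: invg_cts.
Qed.

HB.instance Definition _ := isTopGroup.Build decomp_group decomp_mul_cts decomp_inv_cts.

End DecompositionGroup.

Section WvConstruction.
Variables (k F : fieldType) (iota : {rmorphism k -> F}).
Variable v : valuation_ring iota.
Local Notation Ov := (vring v).
Notation G := (Gal iota).
Notation Gv := (decomp_group v).

Section OneRep.
Variable W : smooth_rep G.

Lemma res_smooth (w : W) : open [set g : Gv | rep_act (val g) w = w].
Proof.
by exists [set g : G | rep_act g w = w]; [exact: rep_smooth|].
Qed.

Definition res_rep : smooth_rep Gv :=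
  @SmoothRep Gv W (fun g => rep_act (val g)) (fun g => rep_linear (val g))
    (@rep_act1 _ W) (fun g h => rep_actM (val g) (val h)) res_smooth.

Definition invariants (H : set G) : set W :=
  [set w | forall g, H g -> rep_act g w = w].

Definition Wv_set : set W :=
  [set w | exists (n : nat) (u : 'I_n -> W),
    (forall i, exists K : set F,
       [/\ subfield K, range iota `<=` K, K `<=` Ov & invariants (gal_fix K) (u i)])
    /\ w = \sum_(i < n) u i].

Lemma rep_act0 (U : topGroupType) (V : smooth_rep U) (g : U) : rep_act g (0 : V) = 0.
Proof.
by have := @rep_linear _ V g (-1) 0 0; rewrite scaler0 addr0 scaleN1r addNr.
Qed.

Lemma rep_actD (U : topGroupType) (V : smooth_rep U) (g : U) (x y : V) :
  rep_act g (x + y) = rep_act g x + rep_act g y.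
Proof. by have := @rep_linear _ V g 1 x y; rewrite !scale1r. Qed.

Lemma rep_actZ (U : topGroupType) (V : smooth_rep U) (g : U) a (x : V) :
  rep_act g (a *: x) = a *: rep_act g x.
Proof. by have := @rep_linear _ V g a x 0; rewrite rep_act0 !addr0. Qed.

Definition Wv_pred : {pred W} := mem Wv_set.

Lemma Wv_submod : submod_closed Wv_pred.
Proof.
split; first by rewrite inE; exists 0%N, (fun=> 0); rewrite big_ord0; split=> // -[].
move=> a x y; rewrite !inE => -[n [u [uP ->]]] [m [w [wP ->]]].
exists (n + m)%N, (fun i => match fintype.split i with inl i => a *: u i | inr i => w i end).
split=> [i|].
  case: fintype.split => {}i; last exact: wP.
  have [K [Ksub kK KO uK]] := uP i; exists K; split=> // g gK.
  by rewrite rep_actZ uK.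
rewrite big_split_ord /= scaler_sumr; congr (_ + _); apply: eq_bigr => i _.
  by rewrite (unsplitK (inl i)).
by rewrite (unsplitK (inr i)).
Qed.

Lemma image_subfield (s : G) (K : set F) : subfield K -> subfield (gal_fun s @` K).
Proof.
move=> [K1 KB KD]; split=> [|x y|x y]; rewrite !inE in K1 *.
- by exists 1; rewrite ?rmorph1.
- move=> [a Ka <-] [b Kb <-]; exists (a - b); rewrite ?rmorphB //.
  by have := KB a b; rewrite !inE; exact.
- move=> [a Ka <-] [b Kb <-]; exists (a / b); rewrite ?fmorph_div //.
  by have := KD a b; rewrite !inE; exact.
Qed.

Lemma Wv_stable (g : Gv) (w : W) : Wv_set w -> Wv_set (rep_act (val g) w).
Proof.
have: stab_v v (val g) by have := valP g; rewrite inE.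
move: (val g) => s sO [n [u [uP ->]]].
exists n, (fun i => rep_act s (u i)); split=> [i|]; last first.
  by elim/big_ind2: _ => [|x1 x2 y1 y2 <- <-|//]; rewrite ?rep_act0 ?rep_actD.
have [K [Ksub kK KO uK]] := uP i; exists (gal_fun s @` K).
have [_ _ _ sk] := galP s.
split=> [|_ [c _ <-]|_ [x Kx <-]|h hK]; first exact: image_subfield.
- by exists (iota c); [apply: kK; exists c|exact: sk].
- by rewrite -[vring v]sO; exists x => //; exact: KO.
- rewrite -rep_actM -[(h * s)%g](mulVKg s) rep_actM uK // => x Kx.
  by rewrite !galM hK ?galKV //; exists x.
Qed.

Definition Wv_space : Type := {w : W | w \in Wv_pred}.

HB.instance Definition _ := SubChoice.on Wv_space.
HB.instance Definition _ :=
  GRing.SubChoice_isSubLmodule.Build rat W Wv_pred Wv_space Wv_submod.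

Lemma Wv_act_subproof (g : Gv) (w : Wv_space) : rep_act (val g) (val w) \in Wv_pred.
Proof. by rewrite inE; apply: Wv_stable; have := valP w; rewrite inE. Qed.

Definition Wv_act (g : Gv) (w : Wv_space) : Wv_space :=
  Sub (rep_act (val g) (val w)) (Wv_act_subproof g w).

Lemma Wv_linear g : linear (Wv_act g).
Proof. by move=> a x y; apply: val_inj; rewrite /= rep_linear. Qed.

Lemma Wv_act1 w : Wv_act 1%g w = w.
Proof. by apply: val_inj; rewrite /= rep_act1. Qed.

Lemma Wv_actM g h w : Wv_act (g * h)%g w = Wv_act g (Wv_act h w).
Proof. by apply: val_inj; rewrite /= rep_actM. Qed.

Lemma Wv_smooth w : open [set g : Gv | Wv_act g w = w].
Proof.
have -> : [set g : Gv | Wv_act g w = w] = [set g : Gv | rep_act (val g) (val w) = val w].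
  apply/seteqP; split=> g /= => [e|e]; last exact: val_inj.
  by rewrite -[in RHS]e.
exact: res_smooth.
Qed.

Definition Wv : smooth_rep Gv :=
  @SmoothRep Gv Wv_space Wv_act Wv_linear Wv_act1 Wv_actM Wv_smooth.

Definition Wv_incl (w : Wv) : W := val (w : Wv_space).

Lemma Wv_inclP (w : Wv) : Wv_set (Wv_incl w).
Proof. by have := valP (w : Wv_space); rewrite inE. Qed.

End OneRep.

Section Restriction.
Variables W W' : smooth_rep G.

Lemma hom0 (U : topGroupType) (V V' : smooth_rep U) (f : Hom V V') : f 0 = 0.
Proof.
by have := @hom_linear _ _ _ f (-1) 0 0; rewrite scaler0 addr0 scaleN1r addNr.
Qed.

Lemma homD (U : topGroupType) (V V' : smooth_rep U) (f : Hom V V') x y :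
  f (x + y) = f x + f y.
Proof. by have := @hom_linear _ _ _ f 1 x y; rewrite !scale1r. Qed.

Lemma hom_Wv (f : Hom W W') (w : W) : Wv_set w -> Wv_set (f w).
Proof.
move=> [n [u [uP ->]]]; exists n, (fun i => f (u i)); split=> [i|]; last first.
  by elim/big_ind2: _ => [|x1 x2 y1 y2 <- <-|//]; rewrite ?hom0 ?homD.
have [K [Ksub kK KO uK]] := uP i; exists K; split=> // g gK.
by rewrite -hom_equiv uK.
Qed.

Lemma restrict_linear (f : Hom W W') : linear (fun w : Wv W => f (Wv_incl w)).
Proof. by move=> a x y; rewrite -hom_linear. Qed.

Lemma restrict_equiv (f : Hom W W') (g : Gv) (w : Wv W) :
  f (Wv_incl (rep_act g w)) = @rep_act _ (res_rep W') g (f (Wv_incl w)).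
Proof. exact: (hom_equiv f (val g) (Wv_incl w)). Qed.

Definition restrict (f : Hom W W') : Hom (Wv W) (res_rep W') :=
  @hom_of _ (Wv W) (res_rep W') _ (restrict_linear f) (restrict_equiv f).

Lemma hom_incl_linear (f : Hom (Wv W) (Wv W')) : linear (fun w => Wv_incl (f w)).
Proof. by move=> a x y; rewrite hom_linear. Qed.

Lemma hom_incl_equiv (f : Hom (Wv W) (Wv W')) (g : Gv) (w : Wv W) :
  Wv_incl (f (rep_act g w)) = @rep_act _ (res_rep W') g (Wv_incl (f w)).
Proof. by rewrite hom_equiv. Qed.

(* Composition with the inclusion of W'_v in W', that is, the inclusion of
   Hom_{G_v}(W_v, W'_v) in Hom_{G_v}(W_v, W'). *)
Definition hom_incl (f : Hom (Wv W) (Wv W')) : Hom (Wv W) (res_rep W') :=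
  @hom_of _ (Wv W) (res_rep W') _ (hom_incl_linear f) (hom_incl_equiv f).

Definition Wv_fun (f : Hom W W') (w : Wv W) : Wv W' :=
  (Sub (f (Wv_incl w)) (mem_set (hom_Wv f (Wv_inclP w))) : Wv_space W').

Lemma Wv_fun_linear (f : Hom W W') : linear (Wv_fun f).
Proof. by move=> a x y; apply: val_inj; exact: restrict_linear. Qed.

Lemma Wv_fun_equiv (f : Hom W W') (g : Gv) (w : Wv W) :
  Wv_fun f (rep_act g w) = rep_act g (Wv_fun f w).
Proof. by apply: val_inj; exact: restrict_equiv. Qed.

Definition Wv_map (f : Hom W W') : Hom (Wv W) (Wv W') :=
  hom_of (Wv_fun_linear f) (Wv_fun_equiv f).

End Restriction.

Lemma Wv_map1 (W : smooth_rep G) : Wv_map (hom_id W) = hom_id (Wv W).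
Proof. by apply: hom_ext => w; apply: val_inj. Qed.

Lemma Wv_mapM (W1 W2 W3 : smooth_rep G) (f : Hom W2 W3) (g : Hom W1 W2) :
  Wv_map (hom_comp f g) = hom_comp (Wv_map f) (Wv_map g).
Proof. by apply: hom_ext => w; apply: val_inj. Qed.

Definition Wv_functor : functor (Sm G) (Sm Gv) :=
  @Functor (Sm G) (Sm Gv) Wv Wv_map Wv_map1 Wv_mapM.

End WvConstruction.

(* Main.v *)
(** Write acl A for the algebraic closure of k(A) in F, and G_A for the group of
    automorphisms of F over acl A. Let t_1, ..., t_r lift a basis of the value group.
    A coefficient field is an algebraically closed subfield C of O_v with
    acl (C, t) = F; as no finite set generates F up to algebraic closure, C always has
    elements transcendental over a given finite set.

    Any finite set S can be moved by some s in G to one with acl (s S) inside O_v: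
    exchange the t_i with fresh elements of C. This gives injectivity of the
    restriction, and the extension of f is forced to be w |-> s^-1 f(s w), where s
    moves a finite support of w into O_v. That it is well defined rests on two facts
    about a finite set B with acl B inside O_v.

    (1) If a smooth vector is fixed by the elements of G_v over acl B then it is fixed
    by G_B. Indeed, let B, z be a support of the vector, z independent over B. By Gauss'
    lemma and the conjugacy of the valuations extending a given one to an algebraic
    extension, multiplying z by fresh elements x of a coefficient field extends to an
    element of G_v, hence B, x z is a support too; and as z and x z are independent,
    linear disjointness over algebraically closed fields shows that the automorphisms
    over acl (B, z) and over acl (B, x z) generate G_B.

    (2) If s in G maps acl B into O_v then some element of G_v agrees with s on acl B:
    go through a fresh copy of B in a coefficient field, which is exchanged with B by an
    automorphism of another coefficient field, containing both.

    By (1), f maps W_v into W'_v, the support of a vector fixed over a subfield of O_v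
    being reduced to a finite one by the same method. Isomorphisms between subfields of F
    are represented by their graphs, subfields of F x F, to which Zorn's lemma applies. *)

Require Import Defs.
From HB Require Import structures.
From mathcomp Require Import all_boot all_order all_algebra.
From mathcomp Require Import boolp classical_sets functions cardinality.
From mathcomp Require Import generic_quotient ring_quotient.
From mathcomp Require Import -(notations) mpoly.

Set Implicit Arguments.
Unset Strict Implicit.
Unset Printing Implicit Defensive.

Import GRing.Theory.

Local Open Scope classical_set_scope.
Local Open Scope ring_scope.

(** * Algebraic closure in a field extension *)

(** Elements of G_v are hard to produce: permuting independent elements can destroy values, and if
    acl B and acl (s B) lie in O_v, acl (B, s B) need not. Two devices answer this. Multiplying
    coordinates by units of a coefficient field keeps all values and yet gives elements independent
    of the old ones. It prescribes a map on constants and monomials only, but by Gauss' lemma every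
    nonzero element of the field they generate is a constant times a monomial, up to a factor
    congruent to 1, so its value is controlled. The step up to F is the conjugacy theorem for
    infinite algebraic extensions: the integral closure is replaced by the intersection of the
    conjugates of both valuation rings, finitely many elements are treated at once, and one element
    is adjoined at a time under Zorn's lemma. Characteristic zero enters there, as an infinite
    supply of constants whose differences are units. The second device is a copy of B that is fresh
    over the coefficients and the t_i involved in B and s B: it fits into a coefficient field
    together with either of them, though perhaps not with both. *)

Lemma algebraic_overP (L : fieldType) (K : set L) x : K 0 -> algebraic_over K x <->
  exists p : {poly L}, [/\ p != 0, forall i, K p`_i & p.[x] = 0].
Proof.
move=> K0; split=> [[p [p0 Kp /rootP px]]|[p [p0 Kp px]]]; exists p; split=> //.
- move=> i; have [ip|ip] := ltnP i (size p); last by rewrite nth_default.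
  by have /allP/(_ _ (mem_nth 0 ip)) := Kp; rewrite inE.
- by apply/(all_nthP 0) => i _; rewrite inE.
- exact/rootP.
Qed.

Section SubfieldType.
Variables (L : fieldType) (K : set L) (hK : subfield K).

Lemma sf1 : K 1.
Proof. by have [+ _ _] := hK; rewrite inE. Qed.
Lemma sfB x y : K x -> K y -> K (x - y).
Proof. by have [_ + _] := hK => /(_ x y); rewrite !inE; exact. Qed.
Lemma sf_div x y : K x -> K y -> K (x / y).
Proof. by have [_ _] := hK => /(_ x y); rewrite !inE; exact. Qed.
Lemma sf0 : K 0.
Proof. by rewrite -(subrr 1); apply: sfB; exact: sf1. Qed.
Lemma sfN x : K x -> K (- x).
Proof. by move=> Kx; rewrite -sub0r; apply: sfB => //; exact: sf0. Qed.
Lemma sfD x y : K x -> K y -> K (x + y).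
Proof. by move=> Kx Ky; rewrite -[y]opprK; apply: sfB => //; exact: sfN. Qed.
Lemma sfV x : K x -> K x^-1.
Proof. by move=> Kx; rewrite -div1r; apply: sf_div => //; exact: sf1. Qed.
Lemma sfM x y : K x -> K y -> K (x * y).
Proof. by move=> Kx Ky; rewrite -[y]invrK; apply: sf_div => //; exact: sfV. Qed.
Lemma sfX x n : K x -> K (x ^+ n).
Proof.
by move=> Kx; elim: n => [|n IH]; rewrite ?exprS; [exact: sf1|exact: sfM].
Qed.
Lemma sf_sum (I : Type) (r : seq I) (P : pred I) (f : I -> L) :
  (forall i, P i -> K (f i)) -> K (\sum_(i <- r | P i) f i).
Proof. by move=> Kf; elim/big_ind: _ => //; [exact: sf0|exact: sfD]. Qed.

Lemma sf_horner (p : {poly L}) x : (forall i, K p`_i) -> K x -> K p.[x].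
Proof.
by move=> Kp Kx; rewrite horner_coef; apply: sf_sum => i _; apply/sfM/sfX.
Qed.

Definition sfpred of subfield K : {pred L} := mem K.
Lemma sfpred_divring : divring_closed (sfpred hK). Proof. exact: hK. Qed.
HB.instance Definition _ := GRing.isDivringClosed.Build L (sfpred hK) sfpred_divring.
Definition sftype : Type := {x : L | x \in sfpred hK}.
HB.instance Definition _ := SubChoice.on sftype.
HB.instance Definition _ := [SubChoice_isSubIntegralDomain of sftype by <:].
HB.instance Definition _ := [SubIntegralDomain_isSubField of sftype by <:].
Definition sfval : sftype -> L := val.
HB.instance Definition _ := GRing.RMorphism.copy sfval (val : sftype -> L).

Lemma sfvalP (x : sftype) : K (sfval x).
Proof. by have := valP x; rewrite inE. Qed.

Lemma sf_lift (p : {poly L}) : (forall i, K p`_i) ->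
  exists q : {poly sftype}, map_poly sfval q = p.
Proof.
move=> Kp; exists (\poly_(i < size p) insubd (0 : sftype) p`_i).
apply/polyP => i; rewrite coef_map coef_poly /=; case: ltnP => [_|ip].
  by rewrite /sfval insubdK // inE.
by rewrite rmorph0 nth_default.
Qed.

Lemma algP x : algebraic_over K x <-> algebraicOver sfval x.
Proof.
split=> [/(algebraic_overP _ sf0)[p [p0 Kp px]]|[q q0 qx]].
  have [q qp] := sf_lift Kp.
  exists q; last by rewrite qp; exact/rootP.
  by apply: contraNneq p0 => q0; rewrite -qp q0 rmorph0.
apply/(algebraic_overP _ sf0); exists (map_poly sfval q); split.
- by rewrite map_poly_eq0.
- by move=> i; rewrite coef_map; exact: sfvalP.
- exact/rootP.
Qed.

Lemma alg_sub x : K x -> algebraic_over K x.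
Proof.
move=> Kx; apply/algP.
have xK : x \in sfpred hK by rewrite inE.
by rewrite -[x]/(sfval (Sub x xK)); exact: algebraic_id.
Qed.

Lemma alg_subfield : subfield (algebraic_over K).
Proof.
split=> [|x y|x y]; rewrite !inE.
- exact/alg_sub/sf1.
- by move=> /algP ax /algP ay; apply/algP; exact: algebraic_sub.
- by move=> /algP ax /algP ay; apply/algP; exact: algebraic_div.
Qed.

(** Over a field algebraic and integral agree, so after division by the leading coefficient this is
    the transitivity of integrality. *)
Lemma alg_trans (A : set L) x : A 0 -> A `<=` algebraic_over K ->
  algebraic_over A x -> algebraic_over K x.
Proof.
move=> A0 AK /(algebraic_overP _ A0)[p [p0 Ap px]]; apply/algP/integral_algebraic.
have l0 : lead_coef p != 0 by rewrite lead_coef_eq0.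
apply: (@integral_root_monic _ _ _ _ ((lead_coef p)^-1 *: p)).
- by rewrite monicE lead_coefZ mulVf.
- by rewrite rootZ ?invr_eq0 //; exact/rootP.
- apply/integral_poly => i; apply/integral_algebraic; rewrite coefZ mulrC.
  by apply: algebraic_div; apply/algP/AK => //; exact: Ap.
Qed.

End SubfieldType.

Lemma algebraic_over_mono (L : fieldType) (K K' : set L) :
  K `<=` K' -> algebraic_over K `<=` algebraic_over K'.
Proof.
move=> KK x [p [p0 Kp px]]; exists p; split=> //.
apply/allP => y /(allP Kp); rewrite !inE; exact: KK.
Qed.

Lemma gen_subfieldP (L : fieldType) (A : set L) : subfield (gen_subfield A).
Proof.
have gen x : gen_subfield A x <-> forall K, subfield K -> A `<=` K -> K x.
  by split=> [Ax K Ks AK|Ax K [Ks AK]]; [exact: Ax|exact: Ax].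
split=> [|x y|x y]; rewrite !inE !gen.
- by move=> K Ks _; exact: sf1.
- by move=> Ax Ay K Ks AK; apply: (sfB Ks); [exact: Ax Ks AK|exact: Ay Ks AK].
- by move=> Ax Ay K Ks AK; apply: (sf_div Ks); [exact: Ax Ks AK|exact: Ay Ks AK].
Qed.

Section Acl.
Variables (k : fieldType) (F : fieldType) (iota : {rmorphism k -> F}).
Implicit Types (A B : set F) (x y : F) (s : seq F).

Definition acl A : set F := algebraic_over (gen_subfield (range iota `|` A)).

Lemma acl_subfield A : subfield (acl A).
Proof. exact/alg_subfield/gen_subfieldP. Qed.

Lemma gen_acl A : gen_subfield (range iota `|` A) `<=` acl A.
Proof. by move=> x Ax; apply: alg_sub => //; exact: gen_subfieldP. Qed.

Lemma sub_acl A : A `<=` acl A.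
Proof. by move=> x Ax; apply: gen_acl; apply: sub_gen_smallest; right. Qed.

Lemma acl_const A c : acl A (iota c).
Proof. by apply: gen_acl; apply: sub_gen_smallest; left; exists c. Qed.

Lemma acl_range A : range iota `<=` acl A.
Proof. by move=> _ [c _ <-]; exact: acl_const. Qed.

Lemma acl_alg A x : algebraic_over (acl A) x -> acl A x.
Proof.
apply: alg_trans => //; first exact: gen_subfieldP.
exact: (sf0 (acl_subfield _)).
Qed.

Lemma acl_le A B : A `<=` acl B -> acl A `<=` acl B.
Proof.
move=> AB x Ax; apply: acl_alg; apply: algebraic_over_mono Ax.
apply: smallest_sub; first exact: acl_subfield.
by move=> y [|/AB //]; exact: acl_range.
Qed.

Lemma acl_mono A B : A `<=` B -> acl A `<=` acl B.
Proof. by move=> AB; apply: acl_le => x /AB; exact: sub_acl. Qed.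

Lemma acl_acl A : acl (acl A) `<=` acl A.
Proof. exact: acl_le. Qed.

Lemma acl_minimal A K : subfield K -> range iota `<=` K -> A `<=` K ->
  (forall x, algebraic_over K x -> K x) -> acl A `<=` K.
Proof.
move=> Ks kK AK Kc x Ax; apply: Kc; apply: algebraic_over_mono Ax.
by apply: smallest_sub => // y [/kK|/AK].
Qed.

Lemma acl_sub_alg A K : subfield K -> range iota `<=` K -> A `<=` K ->
  acl A `<=` algebraic_over K.
Proof.
move=> Ks kK AK; apply: algebraic_over_mono.
by apply: smallest_sub => // y [/kK|/AK].
Qed.

(** The elements with a finite support form a subfield that is algebraically closed in F, because
    the supports of the finitely many coefficients of a polynomial can be joined; [acl_minimal] then
    applies. *)
Lemma acl_finite A x : acl A x -> exists s, [set` s] `<=` A /\ acl [set` s] x.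
Proof.
pose K := [set y | exists s, [set` s] `<=` A /\ acl [set` s] y].
have join s1 s2 : [set` s1] `<=` A -> [set` s2] `<=` A ->
    exists s, [/\ [set` s] `<=` A, acl [set` s1] `<=` acl [set` s]
             & acl [set` s2] `<=` acl [set` s]].
  move=> s1A s2A; exists (s1 ++ s2); split.
  - by move=> y /=; rewrite mem_cat => /orP[/s1A|/s2A].
  - by apply: acl_mono => y /= ys; rewrite mem_cat ys.
  - by apply: acl_mono => y /= ys; rewrite mem_cat ys orbT.
have Ks : subfield K.
  split=> [|a b|a b]; rewrite !inE.
  - by exists [::]; split=> //; exact: (sf1 (acl_subfield _)).
  - move=> [s1 [s1A s1a]] [s2 [s2A s2b]]; have [s [sA le1 le2]] := join _ _ s1A s2A.
    by exists s; split=> //; apply: (sfB (acl_subfield _)); [exact: le1|exact: le2].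
  - move=> [s1 [s1A s1a]] [s2 [s2A s2b]]; have [s [sA le1 le2]] := join _ _ s1A s2A.
    by exists s; split=> //; apply: (sf_div (acl_subfield _)); [exact: le1|exact: le2].
apply: (@acl_minimal A K) => // [y yk|y Ay|y /(algebraic_overP _ (sf0 Ks))[p [p0 Kp py]]].
- by exists [::]; split=> //; exact: acl_range.
- exists [:: y]; split=> [z|]; first by rewrite /= inE => /eqP ->.
  by apply: sub_acl; rewrite /= inE.
have [s [sA sp]] : exists s, [set` s] `<=` A /\ forall i, (i < size p)%N -> acl [set` s] p`_i.
  elim: (size p) => [|n [s1 [s1A s1p]]]; first by exists [::].
  have [s2 [s2A s2p]] := Kp n; have [s [sA le1 le2]] := join _ _ s1A s2A.
  exists s; split=> // i; rewrite ltnS leq_eqVlt => /orP[/eqP->|/s1p]; first exact: le2.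
  exact: le1.
exists s; split=> //; apply/acl_alg/algebraic_overP; first exact: (sf0 (acl_subfield _)).
exists p; split=> // i.
have [/sp //|le] := ltnP i (size p); rewrite nth_default //.
exact: (sf0 (acl_subfield _)).
Qed.

Lemma acl_finite_seq A s : [set` s] `<=` acl A ->
  exists s', [set` s'] `<=` A /\ [set` s] `<=` acl [set` s'].
Proof.
elim: s => [|x s IH] sA; first by exists [::].
have [|s1 [s1A ss1]] := IH; first by move=> y ys; apply: sA; rewrite /= inE ys orbT.
have [|s2 [s2A xs2]] := @acl_finite A x; first by apply: sA; rewrite /= inE eqxx.
exists (s1 ++ s2); split=> y /=; first by rewrite mem_cat => /orP[/s1A|/s2A].
rewrite inE => /predU1P[->|/ss1]; last first.
  by apply: acl_mono => z /= zs; rewrite mem_cat zs.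
by move: xs2; apply: acl_mono => z /= zs; rewrite mem_cat zs orbT.
Qed.

End Acl.

(** * The exchange property and independent sequences *)

Section Exchange.
Variables (k : fieldType) (F : fieldType) (iota : {rmorphism k -> F}).
Implicit Types (A B : set F) (x y : F) (s : seq F).
Local Notation acl := (acl iota).
Local Notation sfA A := (@acl_subfield _ _ iota A).

Lemma acl_root A (p : {poly F}) x :
  p != 0 -> (forall i, acl A p`_i) -> p.[x] = 0 -> acl A x.
Proof.
move=> p0 Ap px; apply/acl_alg/algebraic_overP; first exact: (sf0 (sfA A)).
by exists p.
Qed.

Lemma acl_poly_neq0 A (p : {poly F}) x : ~ acl A x -> (forall i, acl A p`_i) ->
  p != 0 -> p.[x] != 0.
Proof. by move=> Ax Ap p0; apply/eqP => px; apply: Ax; exact: acl_root px. Qed.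

(** The polynomials have coefficients in [acl A], not only in k(A), so that transcendence of y over
    [acl A] keeps every denominator from vanishing at y. *)
Lemma acl_frac A y x : ~ acl A y -> gen_subfield (range iota `|` (A `|` [set y])) x ->
  exists ab : {poly F} * {poly F}, [/\ forall i, acl A ab.1`_i,
    forall i, acl A ab.2`_i, ab.2 != 0 & x = ab.1.[y] / ab.2.[y]].
Proof.
move=> Ay; have KA := sfA A.
pose K := [set x | exists ab : {poly F} * {poly F}, [/\ forall i, acl A ab.1`_i,
    forall i, acl A ab.2`_i, ab.2 != 0 & x = ab.1.[y] / ab.2.[y]]].
have KM (p q : {poly F}) : (forall i, acl A p`_i) -> (forall i, acl A q`_i) ->
    forall i, acl A (p * q)`_i.
  by move=> Ap Aq i; rewrite coefM; apply: (sf_sum KA) => j _; apply: (sfM KA).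
have KB (p q : {poly F}) : (forall i, acl A p`_i) -> (forall i, acl A q`_i) ->
    forall i, acl A (p - q)`_i.
  by move=> Ap Aq i; rewrite coefB; apply: (sfB KA).
have KC c : acl A c -> forall i, acl A c%:P`_i.
  by move=> Ac i; rewrite coefC; case: ifP => // _; exact: (sf0 KA).
have KCc c : acl A c -> K c.
  move=> Ac; exists (c%:P, 1); split => //=; first exact: KC.
  - by rewrite -polyC1; apply: KC; exact: (sf1 KA).
  - exact: oner_neq0.
  - by rewrite hornerC hornerE divr1.
move: x; apply: smallest_sub.
  split=> [|a b|a b]; rewrite !inE.
  - exact/KCc/(sf1 KA).
  - move=> [[p q] /= [Ap Aq q0 ->]] [[p' q'] /= [Ap' Aq' q0' ->]].
    exists (p * q' - p' * q, q * q'); split=> /=.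
    + by apply: KB; apply: KM.
    + exact: KM.
    + exact: mulf_neq0.
    + by rewrite hornerD hornerN !hornerM -mulNr addf_div ?mulNr //; exact: (acl_poly_neq0 Ay).
  - move=> [[p q] /= [Ap Aq q0 ->]] [[p' q'] /= [Ap' Aq' q0' ->]].
    have [p'0|p'0] := eqVneq p' 0.
      rewrite p'0 horner0 mul0r invr0 mulr0; exact/KCc/(sf0 KA).
    exists (p * q', q * p'); split=> /=; try exact: KM.
    + exact: mulf_neq0.
    + by rewrite !hornerM invf_div mulf_div.
move=> a [|[Aa|->]].
- by move=> ak; apply: KCc; exact: acl_range.
- exact/KCc/sub_acl.
- exists ('X, 1); split=> /=.
  + by move=> i; rewrite coefX; case: eqP => _ /=; [exact: (sf1 KA)|exact: (sf0 KA)].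
  + by rewrite -polyC1; apply: KC; exact: (sf1 KA).
  + exact: oner_neq0.
  + by rewrite hornerX hornerE divr1.
Qed.

(** Clearing denominators in an equation of x over k(A, y) gives a relation polynomial in both x and
    y over [acl A]. Read as a polynomial [Q] in y it has coefficients in [acl (A, x)] and root y. If
    [Q] were zero, each of its coefficients would be a relation of x over [acl A], hence trivial,
    and the equation itself would be zero. *)
Lemma acl_exchange A x y : acl (A `|` [set y]) x -> ~ acl A x -> acl (A `|` [set x]) y.
Proof.
move=> Ayx Ax; have KA := sfA A.
have Ay : ~ acl A y.
  by move=> Ay; apply: Ax; apply: acl_le Ayx => z [/sub_acl //|->].
have [|p [p0 Kp px]] := (algebraic_overP _ _).1 Ayx.
  exact: (sf0 (gen_subfieldP _)).
have [ab abP] := choice (fun i => acl_frac Ay (Kp i)).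
pose n := size p.
pose c i := (ab i).1 * \prod_(j < n | j != i :> nat) (ab j).2.
pose d := \prod_(j < n) (ab j).2.
have KM (q r : {poly F}) : (forall i, acl A q`_i) -> (forall i, acl A r`_i) ->
    forall i, acl A (q * r)`_i.
  by move=> Aq Ar i; rewrite coefM; apply: (sf_sum KA) => j _; apply: (sfM KA).
have Ac i j : acl A (c i)`_j.
  apply: (KM) j; first by have [] := abP i.
  elim/big_ind: _ => [l|q r|l _]; last by have [] := abP l.
    by rewrite coef1; case: eqP => _; [exact: (sf1 KA)|exact: (sf0 KA)].
  by move=> Aq Ar; exact: KM.
have cy i : (i < n)%N -> (c i).[y] = d.[y] * p`_i.
  move=> ni; have [Ai Bi b0 ->] := abP i.
  have by0 := acl_poly_neq0 Ay Bi b0.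
  rewrite /d (bigD1 (Ordinal ni)) //= /c !hornerM.
  rewrite [RHS]mulrC -[RHS]mulrA [X in _ = _ * X]mulrA mulVf // mul1r.
  by congr (_ * _.[y]); apply: eq_bigl => l; rewrite -val_eqE.
have d0 : d.[y] != 0.
  rewrite horner_prod; apply/prodf_neq0 => i _.
  by have [_ Bi b0 _] := abP i; exact: (acl_poly_neq0 Ay).
pose Q := \sum_(i < n) c i * (x ^+ i)%:P.
have Qy : Q.[y] = 0.
  rewrite horner_sum; under eq_bigr => i _ do rewrite hornerM hornerC cy // -mulrA.
  by rewrite -mulr_sumr -horner_coef px mulr0.
have [Q0|Q0] := eqVneq Q 0; last first.
  apply: acl_root Q0 _ Qy => i; rewrite coef_sum; apply: (sf_sum (sfA _)) => j _.
  rewrite coefMC; apply: (sfM (sfA _)).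
    by apply: acl_mono (Ac j i) => z; left.
  by apply: (sfX (sfA _)); apply: sub_acl; right.
exfalso.
have cj j i : (i < n)%N -> (c i)`_j = 0.
  move=> ni; pose R := \poly_(l < n) (c l)`_j.
  have Rx : R.[x] = 0.
    rewrite horner_poly -[RHS](coef0 F j) -Q0 coef_sum.
    by apply: eq_bigr => l _; rewrite coefMC.
  have R0 : R = 0.
    apply/eqP/negP => /negP R0; apply: Ax; apply: acl_root R0 _ Rx => l.
    by rewrite coef_poly; case: ifP => // _; exact: (sf0 KA).
  by have := congr1 (fun q : {poly F} => q`_i) R0; rewrite /= coef_poly ni coef0.
move/negP: p0; apply; apply/eqP/polyP => i; rewrite coef0.
have [ni|/(nth_default 0)//] := ltnP i n.
have := cy i ni; rewrite (_ : c i = 0) ?horner0; last first.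
  by apply/polyP => j; rewrite cj // coef0.
by move/esym/eqP; rewrite mulf_eq0 (negPf d0) => /eqP.
Qed.

(** Each entry is transcendental over A and the entries before it. The recursive form suits
    induction; [indep_catC] recovers independence of the order. *)
Fixpoint indep A s : Prop :=
  if s is x :: s' then ~ acl A x /\ indep (A `|` [set x]) s' else True.

Lemma setU_cons A x s : A `|` [set` x :: s] = A `|` [set x] `|` [set` s].
Proof.
apply/seteqP; split=> y /=; rewrite inE.
  by case=> [Ay|/orP[/eqP->|ys]]; [left; left|left; right|right].
by move=> [[Ay|->]|ys]; [left|right; rewrite eqxx|right; rewrite ys orbT].
Qed.

Lemma setU_nil A : A `|` [set` [::] : seq F] = A.
Proof. by apply/seteqP; split=> y /=; [case|left]. Qed.

Lemma setU_cat A s1 s2 : A `|` [set` s1 ++ s2] = A `|` [set` s1] `|` [set` s2].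
Proof.
apply/seteqP; split=> y /=; rewrite mem_cat.
  by case=> [Ay|/orP[ys|ys]]; [left; left|left; right|right].
by move=> [[Ay|ys]|ys]; [left|right; rewrite ys|right; rewrite ys orbT].
Qed.

Lemma indep_cat A s1 s2 : indep A (s1 ++ s2) <-> indep A s1 /\ indep (A `|` [set` s1]) s2.
Proof.
elim: s1 A => [|x s1 IH] A /=; first by rewrite setU_nil; split=> // -[].
by rewrite IH -setU_cons; split=> [[? []]|[[]]].
Qed.

Lemma indep_acl A B s : acl A `<=` acl B -> indep B s -> indep A s.
Proof.
elim: s A B => //= x s IH A B AB [Bx Bs]; split; first by move/AB.
apply: IH Bs; apply: acl_le => y [Ay|->]; last by apply: sub_acl; right.
by apply: (@acl_mono _ _ _ B) => [z|]; [left|apply: AB; exact: sub_acl].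
Qed.

Lemma indep_sub A B s : A `<=` B -> indep B s -> indep A s.
Proof. by move=> AB; apply: indep_acl; exact: acl_mono. Qed.

Lemma indep_swap1 A x s : indep (A `|` [set` s]) [:: x] -> indep A s ->
  indep (A `|` [set x]) s.
Proof.
elim: s A => [|y s IH] A //= [sx _] [Ay As]; split.
  move=> xy; apply: sx; move: (acl_exchange xy Ay); apply: acl_mono.
  by move=> z [Az|->]; [left|right; rewrite /= inE eqxx].
have := IH (A `|` [set y]); rewrite -setU_cons /= -!setUA [[set y] `|` _]setUC.
by apply.
Qed.

Lemma indep_catC A s1 s2 : indep A (s1 ++ s2) -> indep A (s2 ++ s1).
Proof.
elim: s2 A s1 => [|y s2 IH] A s1; first by rewrite cats0.
move=> H; have : indep A ((s2 ++ s1) ++ [:: y]).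
  by rewrite -catA; apply: IH; rewrite -catA.
case/indep_cat=> H1 H2 /=; split; last exact: (indep_swap1 H2 H1).
by case: H2 => H2 _ Ay; apply: H2; apply: acl_mono Ay => z; left.
Qed.

(** By induction x lies in [acl (A, y)]; were it outside [acl A], exchange would put y into
    [acl (A, x)], hence into [acl B]. *)
Lemma indep_meet A B s x : A `<=` B -> indep B s -> acl B x -> acl (A `|` [set` s]) x -> acl A x.
Proof.
elim: s A B => [|y s IH] A B AB; first by rewrite setU_nil.
rewrite setU_cons /= => -[By Bs] Bx Ax.
have Ayx : acl (A `|` [set y]) x.
  apply: IH Bs _ Ax; first by move=> z [/AB|]; [left|right].
  by apply: acl_mono Bx => z; left.
apply: contrapT => nAx; apply: By.
move: (acl_exchange Ayx nAx); apply: acl_le => z [/AB|->] //.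
exact: sub_acl.
Qed.

Lemma indep_notin A B s x : indep A s -> B `<=` acl A -> x \in s -> ~ acl B x.
Proof.
elim: s A => //= y s IH A [Ay As] BA; rewrite inE => /predU1P[->|xs].
  by move=> Bx; apply: Ay; exact: acl_le Bx.
apply: (IH (A `|` [set y]) As) => // z Bz.
by apply: acl_mono (BA z Bz) => t; left.
Qed.

End Exchange.

(** * Partial isomorphisms *)

(** Zorn's lemma for unions also asks about the empty chain, which may fail for P. It is therefore
    applied to the predicate P (X0 [|] X), for which the empty chain yields X0. *)
Lemma Zorn_above (T : Type) (P : set T -> Prop) (X0 : set T) : P X0 ->
  (forall C : set (set T), C `<=` P -> C !=set0 -> total_on C subset ->
     P (\bigcup_(X in C) X)) ->
  exists X, [/\ X0 `<=` X, P X & forall Y, P Y -> X `<=` Y -> Y `<=` X].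
Proof.
move=> PX0 chain.
case: (@Zorn_bigcup T (fun X => P (X0 `|` X))) => [C CP totC|X [PX maxX]].
  have [->|/set0P[X1 CX1]] := eqVneq C set0.
    by rewrite bigcup_set0 setU0.
  have -> : X0 `|` \bigcup_(X in C) X = \bigcup_(X in [set X0 `|` Y | Y in C]) X.
    rewrite bigcup_image; apply/seteqP; split=> [x [X0x|[Y CY Yx]]|x [Y CY [X0x|Yx]]].
    - by exists X1 => //; left.
    - by exists Y => //; right.
    - by left.
    - by right; exists Y.
  apply: chain; first by move=> _ [Y CY <-]; exact: CP.
    by exists (X0 `|` X1); exists X1.
  move=> _ _ [Y CY <-] [Z CZ <-]; have [YZ|ZY] := totC _ _ CY CZ.
    by left; exact: setUS.
  by right; exact: setUS.
exists (X0 `|` X); split=> //.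
move=> Y PY XY y Yy.
apply: contrapT => nXy; apply: (maxX Y).
  split; first by move=> x Xx; apply: XY; right.
  by move=> YX; apply: nXy; right; exact: YX.
by rewrite (setUidr (_ : X0 `<=` Y)) // => x X0x; apply: XY; left.
Qed.

Section Graph.
Variables (k : fieldType) (F : fieldType) (iota : {rmorphism k -> F}).
Implicit Types (Phi R : set (F * F)) (A B : set F) (x y : F) (s : seq F).
Local Notation acl := (acl iota).
Local Notation sfA A := (@acl_subfield _ _ iota A).

(** The last clause, applied to differences, gives both single-valuedness and injectivity ([rg_fun],
    [rg_inj]), and it is symmetric under transposition. *)
Definition ring_graph R : Prop :=
  [/\ forall c, R (iota c, iota c),
      forall a b a' b', R (a, a') -> R (b, b') -> R (a - b, a' - b'),
      forall a b a' b', R (a, a') -> R (b, b') -> R (a * b, a' * b')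
    & forall a a', R (a, a') -> (a = 0 <-> a' = 0)].

(* The graph of an isomorphism over k between two subfields of F. *)
Definition graph Phi : Prop :=
  ring_graph Phi /\ forall a a', Phi (a, a') -> Phi (a^-1, a'^-1).

Definition dom Phi : set F := [set a | exists b, Phi (a, b)].
Definition cod Phi : set F := [set b | exists a, Phi (a, b)].
Definition trgraph Phi : set (F * F) := [set p | Phi (p.2, p.1)].

Lemma trgraphP Phi : graph Phi -> graph (trgraph Phi).
Proof.
move=> [[PC PB PM P0] PV]; split; last by move=> a a'; exact: PV.
by split=> [c|a b a' b'|a b a' b'|a a' /P0[]]; [exact: PC|exact: PB|exact: PM|].
Qed.

Section Closure.
Variables (R : set (F * F)) (hR : ring_graph R).
Lemma rgC c : R (iota c, iota c). Proof. by have [+ _ _ _] := hR; exact. Qed.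
Lemma rgB a b a' b' : R (a, a') -> R (b, b') -> R (a - b, a' - b').
Proof. by have [_ + _ _] := hR; exact. Qed.
Lemma rgM a b a' b' : R (a, a') -> R (b, b') -> R (a * b, a' * b').
Proof. by have [_ _ + _] := hR; exact. Qed.
Lemma rg_eq0 a a' : R (a, a') -> (a == 0) = (a' == 0).
Proof. by have [_ _ _ +] := hR => /[apply] -[H1 H2]; apply/eqP/eqP. Qed.
Lemma rg0 : R (0, 0). Proof. by rewrite -(rmorph0 iota); exact: rgC. Qed.
Lemma rg1 : R (1, 1). Proof. by rewrite -(rmorph1 iota); exact: rgC. Qed.
Lemma rgN a a' : R (a, a') -> R (- a, - a').
Proof. by move=> Ra; rewrite -sub0r -[- a']sub0r; apply: rgB => //; exact: rg0. Qed.
Lemma rgD a b a' b' : R (a, a') -> R (b, b') -> R (a + b, a' + b').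
Proof. by move=> Ra /rgN Rb; rewrite -[b]opprK -[b']opprK; exact: rgB. Qed.
Lemma rg_sum (I : Type) (r : seq I) (P : pred I) (f g : I -> F) :
  (forall i, P i -> R (f i, g i)) ->
  R (\sum_(i <- r | P i) f i, \sum_(i <- r | P i) g i).
Proof.
move=> Rfg; apply: (@big_ind2 _ _ (fun a b => R (a, b))) => //; first exact: rg0.
by move=> *; exact: rgD.
Qed.
Lemma rg_inj a a' b b' : R (a, a') -> R (b, b') -> (a == b) = (a' == b').
Proof.
by move=> Ra Rb; rewrite -subr_eq0 -[RHS]subr_eq0; apply: rg_eq0; exact: rgB.
Qed.
Lemma rg_fun a a' b' : R (a, a') -> R (a, b') -> a' = b'.
Proof. by move=> Ra /(rg_inj Ra); rewrite eqxx => /esym/eqP. Qed.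

Definition gfrac : set (F * F) := [set z | exists a a' b b',
  [/\ R (a, a'), R (b, b'), b != 0, z.1 = a / b & z.2 = a' / b']].

Lemma sub_frac : R `<=` gfrac.
Proof.
move=> [a a'] Ra; exists a, a', 1, 1; split=> //=; rewrite ?divr1 ?oner_neq0 //.
exact: rg1.
Qed.

Lemma frac_graph : graph gfrac.
Proof.
have nz b b' : R (b, b') -> b != 0 -> b' != 0 by move=> /rg_eq0 ->.
split; first split.
- by move=> c; apply: sub_frac; exact: rgC.
- move=> _ _ _ _ [a [a' [b [b' [/= Ra Rb b0 -> ->]]]]] [c [c' [d [d' [/= Rc Rd d0 -> ->]]]]].
  have [b0' d0'] := (nz _ _ Rb b0, nz _ _ Rd d0).
  exists (a * d - c * b), (a' * d' - c' * b'), (b * d), (b' * d'); split=> /=.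
  + by apply: rgB; exact: rgM.
  + exact: rgM.
  + exact: mulf_neq0.
  + by rewrite -mulNr addf_div // mulNr.
  + by rewrite -mulNr addf_div // mulNr.
- move=> _ _ _ _ [a [a' [b [b' [/= Ra Rb b0 -> ->]]]]] [c [c' [d [d' [/= Rc Rd d0 -> ->]]]]].
  exists (a * c), (a' * c'), (b * d), (b' * d'); split=> /=; rewrite ?mulf_div //.
  + exact: rgM.
  + exact: rgM.
  + exact: mulf_neq0.
- move=> _ _ [a [a' [b [b' [/= Ra Rb b0 -> ->]]]]]; have b0' := nz _ _ Rb b0.
  have := rg_eq0 Ra; have [->|a0] := eqVneq a 0 => /esym; rewrite ?mul0r.
    by move=> /eqP ->; rewrite mul0r.
  by move=> a0'; split=> /eqP; rewrite mulf_eq0 invr_eq0 ?(negPf a0) ?a0' ?(negPf b0) ?(negPf b0').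
- move=> _ _ [a [a' [b [b' [/= Ra Rb b0 -> ->]]]]]; have b0' := nz _ _ Rb b0.
  have := rg_eq0 Ra; have [->|a0] := eqVneq a 0 => /esym.
    by move=> /eqP ->; rewrite !mul0r !invr0; apply: sub_frac; exact: rg0.
  by move=> a0'; exists b, b', a, a'; split; rewrite //= invf_div.
Qed.

End Closure.

Section Field.
Variables (Phi : set (F * F)) (hP : graph Phi).
Local Notation rP := hP.1.
Lemma gV a a' : Phi (a, a') -> Phi (a^-1, a'^-1). Proof. exact: hP.2. Qed.
Lemma g_div a b a' b' : Phi (a, a') -> Phi (b, b') -> Phi (a / b, a' / b').
Proof. by move=> Pa /gV; exact: (rgM rP). Qed.

Lemma dom_subfield : subfield (dom Phi).
Proof.
split=> [|x y|x y]; rewrite !inE.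
- by exists 1; exact: (rg1 rP).
- by move=> [x' Px] [y' Py]; exists (x' - y'); exact: (rgB rP).
- by move=> [x' Px] [y' Py]; exists (x' / y'); exact: g_div.
Qed.

Lemma dom_const : range iota `<=` dom Phi.
Proof. by move=> _ [c _ <-]; exists (iota c); exact: (rgC rP). Qed.

Lemma dom_acl A : A `<=` dom Phi -> acl A `<=` algebraic_over (dom Phi).
Proof. by move=> AP; apply: acl_sub_alg => //; [exact: dom_subfield|exact: dom_const]. Qed.

Lemma acl_dom x : acl (dom Phi) x -> algebraic_over (dom Phi) x.
Proof. exact: dom_acl. Qed.

Definition gpoly (p q : {poly F}) : Prop := forall i, Phi (p`_i, q`_i).

Lemma gpolyB p q p' q' : gpoly p q -> gpoly p' q' -> gpoly (p - p') (q - q').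
Proof. by move=> pq pq' i; rewrite !coefB; exact: (rgB rP). Qed.
Lemma gpolyD p q p' q' : gpoly p q -> gpoly p' q' -> gpoly (p + p') (q + q').
Proof. by move=> pq pq' i; rewrite !coefD; exact: (rgD rP). Qed.
Lemma gpolyM p q p' q' : gpoly p q -> gpoly p' q' -> gpoly (p * p') (q * q').
Proof. by move=> pq pq' i; rewrite !coefM; apply: (rg_sum rP) => // j _; exact: (rgM rP). Qed.
Lemma gpolyC a a' : Phi (a, a') -> gpoly a%:P a'%:P.
Proof. by move=> Pa i; rewrite !coefC; case: ifP => // _; exact: (rg0 rP). Qed.
Lemma gpolyXn n : gpoly 'X^n 'X^n.
Proof. by move=> i; rewrite !coefXn; case: eqP => _; [exact: (rg1 rP)|exact: (rg0 rP)]. Qed.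
Lemma gpolyX : gpoly 'X 'X. Proof. by rewrite -['X]expr1; exact: gpolyXn. Qed.

Lemma gpoly_size p q : gpoly p q -> size p = size q.
Proof.
move=> pq; apply/eqP; rewrite eqn_leq; apply/andP; split; apply/leq_sizeP => j.
  by move=> /(nth_default 0) q0; apply/eqP; rewrite (rg_eq0 rP (pq j)) q0.
by move=> /(nth_default 0) q0; apply/eqP; rewrite -(rg_eq0 rP (pq j)) q0.
Qed.

Lemma gpoly_eq0 p q : gpoly p q -> (p == 0) = (q == 0).
Proof. by move/gpoly_size => e; rewrite -!size_poly_eq0 e. Qed.

Lemma gpoly_lead p q : gpoly p q -> Phi (lead_coef p, lead_coef q).
Proof. by move=> pq; rewrite /lead_coef (gpoly_size pq); exact: pq. Qed.

Lemma gpoly_lift (p : {poly F}) : (forall i, dom Phi p`_i) -> exists q, gpoly p q.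
Proof.
move=> /choice[f fP]; exists (\poly_(i < size p) f i) => i; rewrite coef_poly.
by case: ltnP => [_ //|/(nth_default 0) ->]; exact: (rg0 rP).
Qed.

(** The leading terms of p and of its image are cancelled in parallel, so that quotients and
    remainders correspond by construction. *)
Lemma gpoly_div p q b b' : gpoly p q -> gpoly b b' -> b != 0 ->
  exists c c' d d', [/\ gpoly c c', gpoly d d', p = c * b + d, q = c' * b' + d'
    & (size d < size b)%N].
Proof.
move=> + Pb b0; move: {2}(size p) (leqnn (size p)) => n.
elim: n p q => [|n IH] p q pn pq.
  exists 0, 0, p, q; rewrite !mul0r !add0r; split=> //.
    by move=> i; rewrite coef0; exact: (rg0 rP).
  by rewrite (leq_ltn_trans pn) // lt0n size_poly_eq0.
have [lt|le] := ltnP (size p) (size b).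
  exists 0, 0, p, q; rewrite !mul0r !add0r; split=> //.
  by move=> i; rewrite coef0; exact: (rg0 rP).
pose e := (size p - size b)%N.
pose m := (lead_coef p / lead_coef b)%:P * 'X^e.
pose m' := (lead_coef q / lead_coef b')%:P * 'X^e.
have Pm : gpoly m m'.
  apply: gpolyM; last exact: gpolyXn.
  by apply: gpolyC; apply: g_div; exact: gpoly_lead.
have [||c [c' [d [d' [Pc Pd ep eq sd]]]]] := IH (p - m * b) (q - m' * b').
- have p0 : p != 0 by rewrite -size_poly_gt0 (leq_trans _ le) ?size_poly_gt0.
  have lb : lead_coef b != 0 by rewrite lead_coef_eq0.
  have mc : m = (lead_coef p / lead_coef b) *: 'X^e by rewrite /m mul_polyC.
  have sm : size (m * b) = size p.
    rewrite mc -scalerAl size_scale ?mulf_neq0 ?invr_eq0 ?lead_coef_eq0 //.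
    by rewrite mulrC size_mulXn // /e subnK.
  have lm : lead_coef (m * b) = lead_coef p.
    by rewrite mc -scalerAl lead_coefZ mulrC lead_coefM lead_coefXn mul1r mulrC divfK.
  apply/leq_sizeP => j; rewrite leq_eqVlt => /orP[/eqP<-|nj].
    have [ps|ps] := ltnP n (size p).
      have en : n = (size p).-1 by apply/eqP; rewrite -eqSS prednK ?size_poly_gt0 // eqn_leq ps pn.
      by rewrite coefB en -lead_coefE -lm lead_coefE sm subrr.
    by rewrite coefB !nth_default ?sm // subrr.
  by rewrite coefB !nth_default ?sm ?(leq_trans pn) // subrr.
- by apply: gpolyB => //; exact: gpolyM.
exists (m + c), (m' + c'), d, d'; split=> //; first exact: gpolyD.
  by rewrite mulrDl -addrA -ep addrC subrK.
by rewrite mulrDl -addrA -eq addrC subrK.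
Qed.

(** Evaluation at x and evaluation at y have corresponding kernels: this is what makes [adjoin] well
    defined and injective. *)
Definition compat x y : Prop :=
  forall p q, gpoly p q -> (p.[x] = 0 <-> q.[y] = 0).

Definition adj_ring x y : set (F * F) :=
  [set z | exists p q, [/\ gpoly p q, z.1 = p.[x] & z.2 = q.[y]]].
Definition adjoin x y := gfrac (adj_ring x y).

Lemma adj_ringP x y : compat x y -> ring_graph (adj_ring x y).
Proof.
move=> xy; split.
- move=> c; exists (iota c)%:P, (iota c)%:P; split; rewrite /= ?hornerC //.
  by apply: gpolyC; exact: (rgC rP).
- move=> _ _ _ _ [p [q [/= pq -> ->]]] [p' [q' [/= pq' -> ->]]].
  exists (p - p'), (q - q'); split; rewrite /= ?hornerD ?hornerN //; exact: gpolyB.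
- move=> _ _ _ _ [p [q [/= pq -> ->]]] [p' [q' [/= pq' -> ->]]].
  exists (p * p'), (q * q'); split; rewrite /= ?hornerM //; exact: gpolyM.
- by move=> _ _ [p [q [/= pq -> ->]]]; exact: xy.
Qed.

Lemma adjoin_graph x y : compat x y -> graph (adjoin x y).
Proof. by move=> /adj_ringP; exact: (frac_graph). Qed.

Lemma sub_adjoin x y : compat x y -> Phi `<=` adjoin x y.
Proof.
move=> xy [a a'] Pa; apply: sub_frac; first exact: adj_ringP.
by exists a%:P, a'%:P; split; rewrite /= ?hornerC //; exact: gpolyC.
Qed.

Lemma adjoin_gen x y : compat x y -> adjoin x y (x, y).
Proof.
move=> xy; apply: sub_frac; first exact: adj_ringP.
by exists 'X, 'X; split; rewrite /= ?hornerX //; exact: gpolyX.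
Qed.

Lemma dom_adjoin x y : dom (adjoin x y) `<=` acl (dom Phi `|` [set x]).
Proof.
have pS p q : gpoly p q -> acl (dom Phi `|` [set x]) p.[x].
  move=> pq; apply: (sf_horner (sfA _)) => [i|]; last by apply: sub_acl; right.
  by apply: sub_acl; left; exists q`_i; exact: pq.
move=> a [b [p1 [p1' [p2 [p2' [[p [q [/= pq -> _]]] [r [s [/= rs -> _]]] _ /= -> _]]]]]].
by apply: (sf_div (sfA _)); apply: pS; eassumption.
Qed.

Lemma cod_adjoin x y : cod (adjoin x y) `<=` acl (cod Phi `|` [set y]).
Proof.
have pS p q : gpoly p q -> acl (cod Phi `|` [set y]) q.[y].
  move=> pq; apply: (sf_horner (sfA _)) => [i|]; last by apply: sub_acl; right.
  by apply: sub_acl; left; exists p`_i; exact: pq.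
move=> a [b [p1 [p1' [p2 [p2' [[p [q [/= pq _ ->]]] [r [s [/= rs _ ->]]] _ /= _ ->]]]]]].
by apply: (sf_div (sfA _)); apply: pS; eassumption.
Qed.

Lemma compat_transc x y : ~ acl (dom Phi) x -> ~ acl (cod Phi) y -> compat x y.
Proof.
move=> Px Py p q pq; split=> e.
  have [p0|p0] := eqVneq p 0.
    by have := gpoly_eq0 pq; rewrite p0 eqxx => /esym/eqP ->; rewrite horner0.
  exfalso; apply: Px; apply: acl_root p0 _ e => i.
  by apply: sub_acl; exists q`_i; exact: pq.
have [q0|q0] := eqVneq q 0.
  by have := gpoly_eq0 pq; rewrite q0 eqxx => /eqP ->; rewrite horner0.
exfalso; apply: Py; apply: acl_root q0 _ e => i.
by apply: sub_acl; exists p`_i; exact: pq.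
Qed.

Definition minimal x (p q : {poly F}) : Prop :=
  [/\ gpoly p q, p != 0, p.[x] = 0
    & forall p' q', gpoly p' q' -> p' != 0 -> p'.[x] = 0 -> (size p <= size p')%N].

Lemma minimal_ex x : algebraic_over (dom Phi) x -> exists p q, minimal x p q.
Proof.
move=> /(algebraic_overP _ (sf0 dom_subfield))[p [p0 Pp px]].
have [q pq] := gpoly_lift Pp.
pose P n := `[< exists p q, [/\ gpoly p q, p != 0, p.[x] = 0 & size p = n] >].
have exP : exists n, P n by exists (size p); apply/asboolP; exists p, q.
case: (ex_minnP exP) => _ /asboolP[p1 [q1 [pq1 p10 p1x <-]]] minn.
exists p1, q1; split=> // p2 q2 pq2 p20 p2x; apply: minn.
by apply/asboolP; exists p2, q2.
Qed.

(** Irreducibility is never mentioned. The point is that a nonzero r of smaller size than p has an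
    image not vanishing at y: division of p by a counterexample leaves a smaller counterexample, or
    else r divides p and the cofactor is a smaller equation of x. *)
Lemma minimal_compat x y p q : minimal x p q -> q.[y] = 0 -> compat x y.
Proof.
move=> [pq p0 px pmin] qy.
have nz (r s : {poly F}) : gpoly r s -> r != 0 -> (size r < size p)%N -> s.[y] != 0.
  move: {2}(size r) (leqnn (size r)) => n.
  elim: n r s => [|n IH] r s rn rs r0 rp.
    by move: r0; rewrite -size_poly_gt0 ltnNge rn.
  apply/eqP => sy; have s1 : (1 < size s)%N.
    have s0 : s != 0 by rewrite -(gpoly_eq0 rs).
    rewrite ltnNge; apply/negP => /size1_polyC es.
    by move: sy s0; rewrite es hornerC => ->; rewrite polyC0 eqxx.
  have [c [c' [d [d' [Pc Pd ep eq sd]]]]] := gpoly_div pq rs r0.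
  have d'y : d'.[y] = 0 by move: qy; rewrite eq hornerD hornerM sy mulr0 add0r.
  have [d0|d0] := eqVneq d 0; last first.
    have := IH d d' _ Pd d0 (ltn_trans sd rp).
    by rewrite d'y eqxx => /(_ (leq_trans sd rn)).
  have c0 : c != 0 by apply: contraNneq p0 => c0; rewrite ep c0 d0 mul0r addr0.
  have epc : p = c * r by rewrite ep d0 addr0.
  have rx : r.[x] != 0.
    by apply/eqP => rx; have := pmin _ _ rs r0 rx; rewrite leqNgt rp.
  have cx : c.[x] = 0.
    by move/eqP: px; rewrite epc hornerM mulf_eq0 (negPf rx) orbF => /eqP.
  have := pmin _ _ Pc c0 cx; rewrite epc size_mul // leqNgt.
  have -> // : (size c < (size c + size r).-1)%N.
  by rewrite (gpoly_size rs) -(prednK (ltnW s1)) addnS /= -[X in (X < _)%N]addn0 ltn_add2l -ltnS prednK // ltnW.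
move=> r s rs; have [c [c' [d [d' [Pc Pd -> -> sd]]]]] := gpoly_div rs pq p0.
rewrite !hornerD !hornerM px qy !mulr0 !add0r.
have [d0|d0] := eqVneq d 0.
  by have := gpoly_eq0 Pd; rewrite d0 eqxx => /esym/eqP ->; rewrite !horner0.
have d'y := nz _ _ Pd d0 sd; split=> [dx|/eqP]; last by rewrite (negPf d'y).
by have := pmin _ _ Pd d0 dx; rewrite leqNgt sd.
Qed.

End Field.
End Graph.

Lemma chain_pick2 (T : Type) (C : set (set T)) x y : total_on C subset ->
  (\bigcup_(X in C) X) x -> (\bigcup_(X in C) X) y -> exists2 X, C X & X x /\ X y.
Proof.
move=> totC [X CX Xx] [Y CY Yy].
have [XY|YX] := totC _ _ CX CY.
  by exists Y => //; split=> //; exact: (XY x Xx).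
by exists X => //; split=> //; exact: (YX y Yy).
Qed.

(** * Extending partial isomorphisms to automorphisms *)

Section Extension.
Variables (k : fieldType) (F : closedFieldType) (iota : {rmorphism k -> F}).
Implicit Types (Phi R : set (F * F)) (A B C K : set F) (x y : F) (s : seq F).
Local Notation acl := (acl iota).
Local Notation sfA A := (@acl_subfield _ _ iota A).
Local Notation graph := (graph iota).

Lemma graph_chain (D : set (set (F * F))) : D `<=` graph -> D !=set0 ->
  total_on D subset -> graph (\bigcup_(X in D) X).
Proof.
move=> Dg [X0 DX0] totD; split; first split.
- by move=> c; exists X0 => //; apply: rgC; exact: (Dg _ DX0).1.
- move=> a b a' b' Da Db; have [X DX [Xa Xb]] := chain_pick2 totD Da Db.
  by exists X => //; exact: (rgB (Dg _ DX).1 Xa Xb).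
- move=> a b a' b' Da Db; have [X DX [Xa Xb]] := chain_pick2 totD Da Db.
  by exists X => //; exact: (rgM (Dg _ DX).1 Xa Xb).
- move=> a a' [X DX Xa]; have e := rg_eq0 (Dg _ DX).1 Xa.
  by split=> /eqP; [rewrite e|rewrite -e] => /eqP.
- by move=> a a' [X DX Xa]; exists X => //; exact: (gV (Dg _ DX) Xa).
Qed.

(* Equality of the closures of domain and codomain makes every element that is
   transcendental over one transcendental over the other. *)
Definition balanced C Phi : Prop :=
  [/\ graph Phi, dom Phi `<=` C, cod Phi `<=` C, dom Phi `<=` acl (cod Phi)
    & cod Phi `<=` acl (dom Phi)].

Lemma balanced_tr C Phi : balanced C Phi -> balanced C (trgraph Phi).
Proof. by move=> [g dC cC dc cd]; split=> //; exact: trgraphP. Qed.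

Lemma sub_dom Phi R : Phi `<=` R -> dom Phi `<=` dom R.
Proof. by move=> PR a [b ab]; exists b; exact: PR. Qed.
Lemma sub_cod Phi R : Phi `<=` R -> cod Phi `<=` cod R.
Proof. by move=> PR a [b ab]; exists b; exact: PR. Qed.

Lemma alg_conj Phi x : graph Phi -> acl (dom Phi) x ->
  exists y, compat Phi x y /\ acl (cod Phi) y.
Proof.
move=> gP /(acl_dom gP) ax; have [p [q pqm]] := minimal_ex gP ax.
have [pq p0 px _] := pqm.
have /closed_rootP[y /rootP qy] : size q != 1%N.
  rewrite -(gpoly_size gP pq); apply/negP => /size_poly1P[c c0 pc].
  by move: px; rewrite pc hornerC => e; rewrite e eqxx in c0.
exists y; split; first exact: (minimal_compat gP pqm qy).
apply: acl_root (_ : q != 0) _ qy; first by rewrite -(gpoly_eq0 gP pq).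
by move=> i; apply: sub_acl; exists p`_i; exact: pq.
Qed.

(** An algebraic x goes to a root of the image of its minimal equation. A transcendental x can be
    sent to itself: since domain and codomain have the same closure, it is transcendental over the
    codomain too. *)
Lemma balanced_dom C Phi x : acl C `<=` C -> balanced C Phi -> C x ->
  exists R, [/\ balanced C R, Phi `<=` R & dom R x].
Proof.
move=> CC [gP dC cC dc cd] Cx.
suff [y [xy Cy xc yd]] : exists y, [/\ compat Phi x y, C y,
    acl (cod Phi `|` [set y]) x & acl (dom Phi `|` [set x]) y].
  have sub := sub_adjoin gP xy; have xyR := adjoin_gen gP xy.
  exists (adjoin Phi x y); split=> //; last by exists y.
  have xdR : dom (adjoin Phi x y) x by exists y.
  have ycR : cod (adjoin Phi x y) y by exists x.
  split.
  - exact: (adjoin_graph gP xy).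
  - move=> a /(@dom_adjoin _ _ iota _ _ _ _) aP; apply: CC; apply: acl_mono aP.
    by move=> z [/dC|->].
  - move=> a /(@cod_adjoin _ _ iota _ _ _ _) aP; apply: CC; apply: acl_mono aP.
    by move=> z [/cC|->].
  - move=> a /(@dom_adjoin _ _ iota _ _ _ _); apply: acl_le => z [/dc|->].
      exact/acl_mono/sub_cod.
    by apply: acl_mono xc => t [/(sub_cod sub)|->].
  - move=> a /(@cod_adjoin _ _ iota _ _ _ _); apply: acl_le => z [/cd|->].
      exact/acl_mono/sub_dom.
    by apply: acl_mono yd => t [/(sub_dom sub)|->].
have [dx|dx] := pselect (acl (dom Phi) x).
  have [y [xy cy]] := alg_conj gP dx; exists y; split=> //.
  - by apply: CC; apply: acl_mono cy.
  - by apply: acl_le dx => z /dc; apply: acl_mono => t; left.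
  - by apply: acl_le cy => z /cd; apply: acl_mono => t; left.
exists x; split=> //; try by apply: sub_acl; right.
by apply: (compat_transc gP) => // cx; apply: dx; exact: acl_le cx.
Qed.

(** A maximal balanced graph has full domain by [balanced_dom], and full codomain by the same lemma
    for the transposed graph. *)
Lemma balanced_total C Phi : acl C `<=` C -> balanced C Phi ->
  exists R, [/\ graph R, Phi `<=` R, dom R = C & cod R = C].
Proof.
move=> CC bP.
have [D Db D0 totD|R [PR bR maxR]] := Zorn_above bP.
  have lift X : D X -> X `<=` \bigcup_(Y in D) Y by move=> DX z Xz; exists X.
  split.
  - by apply: graph_chain => // X /Db[].
  - by move=> a [b [X DX ab]]; have [_ + _ _ _] := Db _ DX; apply; exists b.
  - by move=> a [b [X DX ab]]; have [_ _ + _ _] := Db _ DX; apply; exists b.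
  - move=> a [b [X DX ab]]; have [_ _ _ + _] := Db _ DX => /(_ a).
    by move=> h; apply: acl_mono (h _); [exact: (sub_cod (lift X DX))|exists b].
  - move=> a [b [X DX ab]]; have [_ _ _ _ +] := Db _ DX => /(_ a).
    by move=> h; apply: acl_mono (h _); [exact: (sub_dom (lift X DX))|exists b].
have [gR dC cC _ _] := bR.
exists R; split=> //; apply/seteqP; split=> // x Cx.
  have [R' [bR' RR' [y xy]]] := balanced_dom CC bR Cx.
  by exists y; exact: (maxR R' bR' RR' _ xy).
have [R' [bR' RR' [y xy]]] := balanced_dom CC (balanced_tr bR) Cx.
exists y; apply: (maxR (trgraph R') (balanced_tr bR') _ (y, x) xy).
by move=> [a b] Rab; exact: (RR' (b, a) Rab).
Qed.

Lemma gal_of_graph R : graph R -> dom R = setT -> cod R = setT ->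
  exists g : Gal iota, forall x y, R (x, y) <-> g x = y.
Proof.
move=> gR dR cR.
have /choice[f fP] : forall x, exists y, R (x, y).
  by move=> x; have : dom R x by rewrite dR.
have /choice[h hP] : forall y, exists x, R (x, y).
  by move=> y; have : cod R y by rewrite cR.
have uniqf x y : R (x, y) -> f x = y by move=> xy; exact: (rg_fun gR.1 (fP x)).
have fA : f \in field_aut iota.
  apply/field_autP; split.
  - by move=> x y; apply: uniqf; exact: (rgD gR.1).
  - by move=> x y; apply: uniqf; exact: (rgM gR.1).
  - exists h => [x|y]; last exact: uniqf.
    by apply/eqP; rewrite (rg_inj gR.1 (hP (f x)) (fP x)).
  - by move=> c; apply: uniqf; exact: (rgC gR.1).
exists (Sub f fA) => x y; split=> [/uniqf //|<-]; exact: fP.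
Qed.

Definition gres (g : Gal iota) K : set (F * F) := [set z | K z.1 /\ g z.1 = z.2].

Lemma gres_graph g K : subfield K -> range iota `<=` K -> graph (gres g K).
Proof.
move=> Ks kK; have [_ _ _ gk] := galP g; split; first split.
- by move=> c; split; rewrite /= ?gk //; apply: kK; exists c.
- by move=> a b _ _ [/= Ka <-] [/= Kb <-]; split; rewrite /= ?rmorphB //; exact: (sfB Ks).
- by move=> a b _ _ [/= Ka <-] [/= Kb <-]; split; rewrite /= ?rmorphM //; exact: (sfM Ks).
- by move=> a _ [/= Ka <-]; split=> /eqP; rewrite ?fmorph_eq0 => /eqP // ->; rewrite rmorph0.
- by move=> a _ [/= Ka <-]; split; rewrite /= ?fmorphV //; exact: (sfV Ks).
Qed.

Lemma dom_gres g K : dom (gres g K) = K.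
Proof. by apply/seteqP; split=> [x [y []]//|x Kx]; exists (g x). Qed.
Lemma cod_gres g K : cod (gres g K) = g @` K.
Proof.
by apply/seteqP; split=> [y [x [/= Kx <-]]|_ [x Kx <-]]; [exists x|exists x].
Qed.

Lemma graph_seq Phi s1 s2 : graph Phi -> size s1 = size s2 ->
  indep iota (dom Phi) s1 -> indep iota (cod Phi) s2 ->
  exists R, [/\ graph R, Phi `<=` R, [set` zip s1 s2] `<=` R,
    dom R `<=` acl (dom Phi `|` [set` s1]) & cod R `<=` acl (cod Phi `|` [set` s2])].
Proof.
elim: s1 s2 Phi => [|x s1 IH] [|y s2] // Phi gP /=.
  by exists Phi; split=> //; rewrite setU_nil; exact: sub_acl.
move=> [es] [Px Ps1] [Py Ps2].
have xy := compat_transc gP Px Py.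
have [||R [gR PR zR dR cR]] := IH s2 (adjoin Phi x y) (adjoin_graph gP xy) es.
- by apply: indep_acl Ps1; exact/acl_le/dom_adjoin.
- by apply: indep_acl Ps2; exact/acl_le/cod_adjoin.
exists R; split=> //.
- by move=> z /(sub_adjoin gP xy); exact: PR.
- move=> z /=; rewrite inE => /predU1P[->|/zR //]; apply: PR.
  exact: (adjoin_gen gP xy).
- move=> a /dR; rewrite setU_cons; apply: acl_le => z [/(@dom_adjoin _ _ iota _ _ _ _)|zs].
    by apply: acl_mono => t; left.
  by apply: sub_acl; right.
- move=> a /cR; rewrite setU_cons; apply: acl_le => z [/(@cod_adjoin _ _ iota _ _ _ _)|zs].
    by apply: acl_mono => t; left.
  by apply: sub_acl; right.
Qed.

(** Independence allows s1 to be sent to s2; the last two hypotheses make the resulting graph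
    balanced, so that it extends to an automorphism of C. *)
Lemma graph_extend C Phi s1 s2 : acl C `<=` C -> graph Phi -> size s1 = size s2 ->
  indep iota (dom Phi) s1 -> indep iota (cod Phi) s2 ->
  dom Phi `|` [set` s1] `<=` C -> cod Phi `|` [set` s2] `<=` C ->
  dom Phi `|` [set` s1] `<=` acl (cod Phi `|` [set` s2]) ->
  cod Phi `|` [set` s2] `<=` acl (dom Phi `|` [set` s1]) ->
  exists R, [/\ graph R, Phi `<=` R, [set` zip s1 s2] `<=` R, dom R = C & cod R = C].
Proof.
move=> CC gP es i1 i2 dC cC dc cd.
have [R0 [g0 P0 z0 d0 c0]] := graph_seq gP es i1 i2.
have sd : dom Phi `|` [set` s1] `<=` dom R0.
  move=> x [/(sub_dom P0) //|/= xs].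
  exists (nth 0 s2 (index x s1)); apply: z0 => /=.
  rewrite -{1}(nth_index 0 xs) -nth_zip //; apply: mem_nth.
  by rewrite size_zip -es minnn index_mem.
have sc : cod Phi `|` [set` s2] `<=` cod R0.
  move=> x [/(sub_cod P0) //|/= xs].
  exists (nth 0 s1 (index x s2)); apply: z0 => /=.
  rewrite -{2}(nth_index 0 xs) -nth_zip //; apply: mem_nth.
  by rewrite size_zip es minnn index_mem.
have bR0 : balanced C R0.
  split=> //.
  - by move=> x /d0 xd; apply: CC; apply: acl_mono xd.
  - by move=> x /c0 xd; apply: CC; apply: acl_mono xd.
  - by move=> x /d0; apply: acl_le => z /dc; exact: acl_mono.
  - by move=> x /c0; apply: acl_le => z /cd; exact: acl_mono.
have [R [gR R0R dR cR]] := balanced_total CC bR0.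
by exists R; split=> // z; [move/P0|move/z0]; exact: R0R.
Qed.

Lemma gal_extend Phi s1 s2 : graph Phi -> size s1 = size s2 ->
  indep iota (dom Phi) s1 -> indep iota (cod Phi) s2 ->
  dom Phi `|` [set` s1] `<=` acl (cod Phi `|` [set` s2]) ->
  cod Phi `|` [set` s2] `<=` acl (dom Phi `|` [set` s1]) ->
  exists g : Gal iota, (forall x y, Phi (x, y) -> g x = y) /\ map g s1 = s2.
Proof.
move=> gP es i1 i2 dc cd.
have T1 A : A `<=` setT by [].
have [R [gR PR zR dR cR]] :=
  graph_extend (T1 _) gP es i1 i2 (T1 _) (T1 _) dc cd.
have [g gP'] := gal_of_graph gR dR cR.
exists g; split=> [x y /PR /gP' //|].
apply: (@eq_from_nth _ 0); rewrite size_map // => i is1.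
rewrite (nth_map 0) //; apply/gP'/zR => /=.
by rewrite -nth_zip //; apply: mem_nth; rewrite size_zip -es minnn.
Qed.

Lemma gal_extend_id K s1 s2 : subfield K -> range iota `<=` K ->
  size s1 = size s2 -> indep iota K s1 -> indep iota K s2 ->
  [set` s1] `<=` acl (K `|` [set` s2]) -> [set` s2] `<=` acl (K `|` [set` s1]) ->
  exists2 g : Gal iota, gal_fix K g & map g s1 = s2.
Proof.
move=> Ks kK es i1 i2 s12 s21.
have cod1 : cod (gres 1%g K) = K.
  by rewrite cod_gres; apply/seteqP; split=> [_ [x Kx <-]//|x Kx]; exists x.
have [||||g [gP gs]] := @gal_extend (gres 1%g K) s1 s2 (gres_graph 1%g Ks kK) es;
  rewrite ?dom_gres ?cod1 //.
- by move=> x [Kx|/s12 //]; apply: sub_acl; left.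
- by move=> x [Kx|/s21 //]; apply: sub_acl; left.
by exists g => // x Kx; apply: gP; split.
Qed.

Lemma gal_alg (g : Gal iota) A x : acl A x -> acl (g @` A) (g x).
Proof.
have [_ _ _ gk] := galP g.
move=> Ax; apply: (@acl_minimal _ _ iota A [set x | acl (g @` A) (g x)]) Ax.
- split=> [|a b|a b]; rewrite !inE /= ?rmorph1 ?rmorphB ?fmorph_div.
  + exact: (sf1 (sfA _)).
  + exact: (sfB (sfA _)).
  + exact: (sf_div (sfA _)).
- by move=> _ [c _ <-] /=; rewrite gk; exact: acl_const.
- by move=> a Aa; apply: sub_acl; exists a.
- move=> y /(algebraic_overP _)[|p [p0 Kp py]].
    by rewrite /= rmorph0; exact: (sf0 (sfA _)).
  apply: (@acl_root _ _ _ _ (map_poly g p)).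
  + by rewrite map_poly_eq0.
  + by move=> i; rewrite coef_map; exact: Kp.
  + by rewrite horner_map py rmorph0.
Qed.

Lemma gal_acl (g : Gal iota) A : g @` acl A = acl (g @` A).
Proof.
apply/seteqP; split=> [_ [x Ax <-]|y Ay]; first exact: gal_alg.
exists (gal_fun (g^-1)%g y); last by rewrite galVK.
have := gal_alg (g^-1)%g Ay; apply: acl_mono => _ [_ [x Ax <-] <-].
by rewrite galKV.
Qed.

End Extension.

(** * Conjugacy of valuations *)

Section Valuation.
Variables (k F : fieldType) (iota : {rmorphism k -> F}).
Variable v : valuation_ring iota.
Local Notation Ov := (vring v).

(** The maximal ideal as a subset of F. Zero is listed apart because its inverse is 0, which lies in
    the ring. *)
Definition vmax : set F := [set x | x = 0 \/ ~ Ov x^-1].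

Lemma vringN x : Ov x -> Ov (- x).
Proof. by move=> vx; rewrite -sub0r; apply: vringB => //; exact: vring0. Qed.

Lemma vring_iota c : Ov (iota c).
Proof. by apply: (@vring_const _ _ _ v); exists c. Qed.

Lemma vring_sum (I : Type) (r : seq I) (P : pred I) (f : I -> F) :
  (forall i, P i -> Ov (f i)) -> Ov (\sum_(i <- r | P i) f i).
Proof. by move=> Kf; elim/big_ind: _ => //; [exact: vring0|exact: vringD]. Qed.

Lemma vring_prod (I : Type) (r : seq I) (P : pred I) (f : I -> F) :
  (forall i, P i -> Ov (f i)) -> Ov (\prod_(i <- r | P i) f i).
Proof. by move=> Kf; elim/big_ind: _ => //; [exact: vring1|exact: vringM]. Qed.

Lemma vring_horner (p : {poly F}) x : (forall i, Ov p`_i) -> Ov x -> Ov p.[x].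
Proof.
by move=> vp vx; rewrite horner_coef; apply: vring_sum => i _; apply/vringM/vringX.
Qed.

Lemma vmax_ring x : vmax x -> Ov x.
Proof.
have [->|x0] := eqVneq x 0; first by move=> _; exact: vring0.
by case=> [/eqP|]; [rewrite (negPf x0)|case: (vring_total v x0)].
Qed.

Lemma nvring x : ~ Ov x -> x != 0 /\ vmax x^-1.
Proof.
move=> nx; split; last by right; rewrite invrK.
by apply/eqP => x0; apply: nx; rewrite x0; exact: vring0.
Qed.

Lemma nvmax x : ~ vmax x -> x != 0 /\ Ov x^-1.
Proof.
move=> nx; split; first by apply/eqP => x0; apply: nx; left.
by apply: contrapT => nO; apply: nx; right.
Qed.

Lemma vmax_linear a x y : Ov a -> vmax x -> vmax y -> vmax (a * x + y).
Proof.
move=> va mx my.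
have mem z : Ov z -> z \in vpred v by rewrite inE.
have maxE (z : F) (zO : z \in vpred v) :
    vmax z <-> (Sub z zO : vtype v) \in @max_ideal _ _ _ v.
  split=> [[z0|nz]|/max_idealP /= zP].
  - by apply/max_idealP; rewrite /= z0 eqxx.
  - by apply/max_idealP.
  - by have [->|/zP] := eqVneq z 0; [left|right].
have [_ _ cl] := max_ideal_closed v.
have xO := mem _ (vmax_ring mx); have yO := mem _ (vmax_ring my).
have := cl (Sub a (mem _ va)) _ _ ((maxE _ xO).1 mx) ((maxE _ yO).1 my).
set w := (_ + _) => wI; have vw : a * x + y = val w by [].
rewrite vw; apply/(maxE _ (valP w)).
by rewrite (_ : Sub _ _ = w) //; exact: val_inj.
Qed.

Lemma vmax0 : vmax 0. Proof. by left. Qed.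
Lemma vmaxD x y : vmax x -> vmax y -> vmax (x + y).
Proof. by move=> mx my; rewrite -[x]mul1r; apply: vmax_linear => //; exact: vring1. Qed.
Lemma vmaxM a x : Ov a -> vmax x -> vmax (a * x).
Proof. by move=> va mx; rewrite -[_ * _]addr0; apply: vmax_linear => //; exact: vmax0. Qed.
Lemma vmaxMr a x : Ov a -> vmax x -> vmax (x * a).
Proof. by rewrite mulrC; exact: vmaxM. Qed.
Lemma vmaxN x : vmax x -> vmax (- x).
Proof. by move=> mx; rewrite -mulN1r; apply: vmaxM => //; apply: vringN; exact: vring1. Qed.
Lemma vmaxB x y : vmax x -> vmax y -> vmax (x - y).
Proof. by move=> mx /vmaxN; exact: vmaxD. Qed.
Lemma vmax_sum (I : Type) (r : seq I) (P : pred I) (f : I -> F) :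
  (forall i, P i -> vmax (f i)) -> vmax (\sum_(i <- r | P i) f i).
Proof. by move=> Kf; elim/big_ind: _ => //; [exact: vmax0|exact: vmaxD]. Qed.

Lemma vmaxNunit x : x != 0 -> Ov x^-1 -> ~ vmax x.
Proof. by move=> x0 vx [/eqP|//]; rewrite (negPf x0). Qed.

Lemma vmax1 : ~ vmax 1.
Proof. by apply: vmaxNunit; rewrite ?oner_neq0 // invr1; exact: vring1. Qed.

Lemma vmax_mul x y : vmax (x * y) -> Ov y -> vmax x \/ vmax y.
Proof.
move=> mxy vy; apply: contrapT => /not_orP[/nvmax[x0 vx] /nvmax[y0 vyV]].
by apply: (vmaxNunit _ _ mxy); rewrite ?mulf_neq0 // invfM; exact: vringM.
Qed.

Lemma vmax_cancel x y : vmax (x * y) -> ~ vmax x -> vmax y.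
Proof.
move=> mxy /nvmax[x0 vx]; rewrite -[y](mulKf x0); exact: vmaxM.
Qed.

Lemma vmax_prod (s : seq F) : vmax (\prod_(x <- s) x) -> (forall x, x \in s -> Ov x) ->
  exists2 x, x \in s & vmax x.
Proof.
elim: s => [|y s IH]; first by rewrite big_nil => /vmax1.
rewrite big_cons => m vs; have [my|my] := pselect (vmax y).
  by exists y; rewrite ?inE ?eqxx.
have [|x xs mx] := IH (vmax_cancel m my).
  by move=> x xs; apply: vs; rewrite inE xs orbT.
by exists x; rewrite ?inE ?xs ?orbT.
Qed.

Lemma vmax_iota c : c != 0 -> ~ vmax (iota c).
Proof.
by move=> c0; apply: vmaxNunit; rewrite ?fmorph_eq0 // -fmorphV; exact: vring_iota.
Qed.

Lemma vmax_exp x n : Ov x -> vmax (x ^+ n) -> vmax x.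
Proof.
move=> vx; elim: n => [/vmax1 //|n IH]; rewrite exprS => m.
by have [//|/IH] := vmax_mul m (vringX _ vx).
Qed.

Lemma vring_monic_coef (s : seq F) : (forall x, x \in s -> Ov x) ->
  forall i, Ov (\prod_(x <- s) ('X - x%:P))`_i.
Proof.
elim: s => [|y s IH] vs i.
  by rewrite big_nil coef1; case: eqP => _; [exact: vring1|exact: vring0].
have {}IH : forall i, Ov (\prod_(x <- s) ('X - x%:P))`_i.
  by apply: IH => x xs; apply: vs; rewrite inE xs orbT.
rewrite big_cons mulrBl coefB coefXM coefCM; apply: vringB.
  by case: ifP => _; [exact: vring0|exact: IH].
by apply: vringM; [apply: vs; rewrite inE eqxx|exact: IH].
Qed.

(** The index is that of a coefficient of least value: division by it makes p integral with one
    coefficient equal to 1. *)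
Lemma vring_normalize (p : {poly F}) : p != 0 ->
  exists i, p`_i != 0 /\ forall j, Ov (p`_j / p`_i).
Proof.
move=> p0.
suff [i [pi0 iP]] : exists i, p`_i != 0 /\
    forall j, (j < size p)%N -> Ov (p`_j / p`_i).
  exists i; split=> // j; have [/iP //|/(nth_default 0) ->] := ltnP j (size p).
  by rewrite mul0r; exact: vring0.
elim: {1 3}(size p) (leqnn (size p)) => [_|n IH np].
  by exists (size p).-1; rewrite -lead_coefE lead_coef_eq0.
have [i [pi0 iP]] := IH (ltnW np).
have [vi|/nvring[ni0 /vmax_ring vi]] := pselect (Ov (p`_n / p`_i)).
  by exists i; split=> // j; rewrite ltnS leq_eqVlt => /predU1P[->|/iP].
have pn0 : p`_n != 0 by apply: contraNneq ni0 => ->; rewrite mul0r.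
exists n; split=> // j; rewrite ltnS leq_eqVlt => /predU1P[->|/iP vj].
  by rewrite divff //; exact: vring1.
have -> : p`_j / p`_n = p`_j / p`_i * (p`_n / p`_i)^-1 by rewrite invf_div mulrA divfK.
exact: vringM.
Qed.

Lemma vmax_max (p : {poly F}) i : ~ vmax p`_i ->
  exists j, ~ vmax p`_j /\ forall l, (j < l)%N -> vmax p`_l.
Proof.
move=> ni.
pose P j := `[< ~ vmax p`_j >].
have exP : exists j, P j by exists i; apply/asboolP.
have bd j : P j -> (j <= size p)%N.
  move=> /asboolP pj; rewrite leqNgt; apply/negP => jp; apply: pj.
  by rewrite nth_default 1?ltnW //; exact: vmax0.
case: (ex_maxnP exP bd) => j /asboolP jP jmax; exists j; split=> // l jl.
by apply: contrapT => nl; have := jmax l (asboolT nl); rewrite leqNgt jl.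
Qed.

(** Divided differences: the quotient of p - p(c) by X - c again has values in the maximal ideal at
    the other constants d, since d - c is a nonzero constant and hence a unit. *)
Lemma vmax_vandermonde (p : {poly F}) (s : seq k) : uniq s -> (size p <= size s)%N ->
  (forall c, c \in s -> vmax p.[iota c]) -> forall i, vmax p`_i.
Proof.
elim: s p => [|c s IH] p /=.
  rewrite leqn0 size_poly_eq0 => _ /eqP -> _ i; rewrite coef0; exact: vmax0.
move=> /andP[cs us] ps mp.
have /factor_theorem[q qE] : root (p - p.[iota c]%:P) (iota c).
  by apply/rootP; rewrite !hornerE subrr.
have pE : p = q * ('X - (iota c)%:P) + p.[iota c]%:P by rewrite -qE subrK.
have mq : forall i, vmax q`_i.
  apply: (IH _ us) => [|d ds].
    have [->|q0] := eqVneq q 0; first by rewrite size_poly0.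
    have := congr1 (fun r : {poly F} => size r) qE.
    rewrite size_Mmonic ?monicXsubC // size_XsubC addn2 /= => sq.
    rewrite -ltnS -sq (leq_trans (size_polyD _ _)) // geq_max ps size_polyN /=.
    by rewrite (leq_trans (size_polyC_leq1 _)).
  have dc : d - c != 0 by rewrite subr_eq0; apply: contraNneq cs => <-.
  have : vmax ((iota (d - c)) * q.[iota d]).
    have -> : iota (d - c) * q.[iota d] = p.[iota d] - p.[iota c].
      by rewrite {1}pE !hornerE rmorphB addrK mulrC.
    by apply: vmaxB; apply: mp; rewrite inE ?eqxx ?ds ?orbT.
  by move/vmax_cancel; apply; exact: vmax_iota.
move=> i; rewrite pE coefD; apply: vmaxD.
  rewrite mulrBr coefB coefMX coefMC; apply: vmaxB.
    by case: ifP => // _; exact: vmax0.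
  by apply: vmaxMr => //; exact: vring_iota.
rewrite coefC; case: ifP => _; last exact: vmax0.
by apply: mp; rewrite inE eqxx.
Qed.

Lemma vpull_subring (g : Gal iota) : subring_closed (mem [set x | Ov (g x)]).
Proof.
split=> [|x y|x y]; rewrite !inE /= ?rmorph1 ?rmorphB ?rmorphM.
- exact: vring1.
- exact: vringB.
- exact: vringM.
Qed.
Lemma vpull_const (g : Gal iota) : range iota `<=` [set x | Ov (g x)].
Proof. by move=> _ [c _ <-] /=; have [_ _ _ ->] := galP g; exact: vring_iota. Qed.
Lemma vpull_total (g : Gal iota) x : x != 0 -> [set x | Ov (g x)] x \/ [set x | Ov (g x)] x^-1.
Proof. by move=> x0 /=; rewrite fmorphV; apply: vring_total; rewrite fmorph_eq0. Qed.

Definition vpull g := ValuationRing (vpull_subring g) (vpull_const g) (@vpull_total g).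

End Valuation.

Lemma large_fiber (T : finType) (f : nat -> T) M :
  exists t, exists s : seq nat, [/\ uniq s, (M <= size s)%N & {in s, forall m, f m = t}].
Proof.
pose N := (#|T| * M).+1.
apply: contrapT => no; have small t : (#|[pred i : 'I_N | f i == t]| <= M)%N.
  rewrite leqNgt; apply/negP => big; apply: no; exists t.
  exists [seq val i | i <- enum [pred i : 'I_N | f i == t]]; split.
  - by rewrite map_inj_uniq ?enum_uniq //; exact: val_inj.
  - by rewrite size_map -cardE ltnW.
  - by move=> _ /mapP[i + ->]; rewrite mem_enum inE => /eqP.
have : (N <= #|T| * M)%N; last by rewrite ltnn.
rewrite -{1}[N]card_ord -sum1_card (partition_big (fun i : 'I_N => f i) xpredT) //=.
rewrite -sum_nat_const leq_sum // => t _; rewrite sum1_card.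
exact: small.
Qed.

Section Conjugates.
Variables (k : fieldType) (F : closedFieldType) (iota : {rmorphism k -> F}).
Local Notation acl := (acl iota).
Variable A : set F.
Hypotheses (sA : subfield A) (kA : range iota `<=` A).
Hypothesis algA : forall x, acl A x.

Let idA : graph iota (gres (1%g : Gal iota) A).
Proof. exact: gres_graph. Qed.

Let cod_idA : cod (gres (1%g : Gal iota) A) = A.
Proof.
by rewrite cod_gres; apply/seteqP; split=> [_ [x Kx <-]//|x Kx]; exists x.
Qed.

Lemma gal_conj x p q y : minimal (gres (1%g : Gal iota) A) x p q -> q.[y] = 0 ->
  exists2 g : Gal iota, gal_fix A g & g x = y.
Proof.
move=> pqm qy; have xy := minimal_compat idA pqm qy.
have sub := sub_adjoin idA xy; have gR := adjoin_graph idA xy.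
have T1 (B : set F) : B `<=` setT by [].
have aclT (B : set F) : A `<=` B -> forall x, acl B x.
  by move=> AB z; apply: acl_mono (algA z).
have bR : balanced iota setT (adjoin (gres (1%g : Gal iota) A) x y).
  split=> // z _; apply: aclT.
    by move=> a Aa; rewrite -cod_idA in Aa; exact: (sub_cod sub Aa).
  by move=> a Aa; rewrite -(dom_gres (1%g : Gal iota) A) in Aa; exact: (sub_dom sub Aa).
have [R [gR' sR dR cR]] := balanced_total (T1 _) bR.
have [g gP] := gal_of_graph gR' dR cR.
exists g; last by apply/gP/sR; exact: (adjoin_gen idA xy).
by move=> a Aa; apply/gP/sR/sub; split.
Qed.

(** The list consists of the roots of a minimal polynomial of z over A, which are conjugate by
    [gal_conj]. Finiteness of the set of conjugates is used as much as the membership of their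
    symmetric functions in A. *)
Lemma conj_seq z : exists s : seq F, [/\ forall i, A (\prod_(y <- s) ('X - y%:P))`_i,
  z \in s & forall y, y \in s <-> exists2 g : Gal iota, gal_fix A g & g z = y].
Proof.
have [|p [q pqm]] := minimal_ex idA (x := z).
  rewrite dom_gres; apply: (acl_sub_alg sA kA _ (algA z)) => //.
have [pq p0 pz _] := pqm.
have pqE : p = q by apply/polyP => i; have [_ /= e] := pq i; rewrite -e.
have Ap i : A p`_i by have [] := pq i.
have l0 : lead_coef p != 0 by rewrite lead_coef_eq0.
have [s sE] := closed_field_poly_normal p.
have rootE y : (y \in s) = (p.[y] == 0).
  rewrite sE hornerZ mulf_eq0 (negPf l0) /=.
  by have := root_prod_XsubC s y; rewrite rootE => ->.
exists s; split.
- have -> : \prod_(y <- s) ('X - y%:P) = (lead_coef p)^-1 *: p.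
    by rewrite {2}sE scalerA mulVf // scale1r.
  by move=> i; rewrite coefZ; apply: (sfM sA) => //; apply: (sfV sA); exact: Ap.
- by rewrite rootE pz.
- move=> y; rewrite rootE; split=> [/eqP py|[g gA <-]].
    by apply: gal_conj pqm _; rewrite -pqE.
  have -> : p = map_poly g p by apply/polyP => i; rewrite coef_map /= gA.
  by rewrite horner_map pz rmorph0.
Qed.

Section TwoValuations.
Variables (v v' : valuation_ring iota).
Hypothesis agree : forall a, A a -> (vring v a <-> vring v' a).
Hypothesis k_inj : injective (fun n : nat => n%:R : k).
Local Notation O := (vring v).
Local Notation O' := (vring v').

(** It takes the place of the integral closure in F of the common valuation ring of A. Conjugates of
    both valuations are included so that its elements and all their conjugates are integral for v
    and for v'. *)
Definition conj_ring : set F := [set x | forall g : Gal iota, gal_fix A g ->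
  vring (vpull v g) x /\ vring (vpull v' g) x].

Let R := conj_ring.

Lemma gal_fix1 : gal_fix A (1%g : Gal iota). Proof. by []. Qed.

Lemma conj_ring_base a : A a -> O' a -> R a.
Proof. by move=> Aa va g gA; rewrite /= gA //; split=> //; apply/agree. Qed.

Lemma conj_ring_sub a : R a -> O' a.
Proof. by move=> /(_ _ gal_fix1)[]. Qed.

Lemma conj_ringM a b : R a -> R b -> R (a * b).
Proof.
by move=> Ra Rb g gA; have [[? ?] [? ?]] := (Ra g gA, Rb g gA); split; exact: vringM.
Qed.
Lemma conj_ringB a b : R a -> R b -> R (a - b).
Proof.
by move=> Ra Rb g gA; have [[? ?] [? ?]] := (Ra g gA, Rb g gA); split; exact: vringB.
Qed.
Lemma conj_ring_horner (p : {poly F}) x : (forall i, R p`_i) -> R x -> R p.[x].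
Proof.
by move=> Rp Rx g gA; split; apply: vring_horner => [i|]; first [by have [] := Rp i g gA|by have [] := Rx g gA].
Qed.

Lemma vmax_agree a : A a -> vmax v' a -> vmax v a.
Proof.
by move=> Aa [->|na]; [left|right => /agree h; apply: na; apply: h; exact: (sfV sA)].
Qed.

Lemma vmax_horner (w : valuation_ring iota) (p : {poly F}) x :
  (forall i, vmax w p`_i) -> vring w x -> vmax w p.[x].
Proof.
move=> mp wx; rewrite horner_coef; apply: vmax_sum => i _.
by apply: vmaxMr => //; exact: vringX.
Qed.

(* Splitting a relation [p.[x] = 0] at its last unit coefficient, of index i:
   b is p divided by 'X^i (evaluated at x), and bx is minus the lower part
   divided by x^(i-1), so one of the two descriptions is integral. *)
Lemma conj_ring_frac x : O' x ->
  exists b, [/\ R b, R (b * x) & ~ vmax v' b].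
Proof.
move=> vx; have : algebraic_over A x by apply: (acl_sub_alg sA kA _ (algA x)).
move=> /(algebraic_overP _ (sf0 sA))[p0 [p00 Ap0 p0x]].
have [i0 [pi0 i0P]] := vring_normalize v' p00.
pose p := (p0`_i0)^-1 *: p0.
have Ap i : A p`_i by rewrite coefZ; apply: (sfM sA) => //; exact: (sfV sA).
have Op i : O' p`_i by rewrite coefZ mulrC.
have px : p.[x] = 0 by rewrite hornerZ p0x mulr0.
have [|i [iu imax]] := @vmax_max _ _ _ v' p i0.
  by rewrite coefZ mulVf //; exact: vmax1.
pose b := (drop_poly i p).[x].
have key (w : valuation_ring iota) : (forall j, vring w p`_j) -> vring w b /\ vring w (b * x).
  move=> wp; have wd : forall j, vring w (drop_poly i p)`_j.
    by move=> j; rewrite coef_drop_poly.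
  have [wx|/nvring[x0 /vmax_ring wxV]] := pselect (vring w x).
    have wb : vring w b by exact: vring_horner.
    by split=> //; exact: vringM.
  have bE : b * x ^+ i = - \sum_(j < i) p`_j * x ^+ j.
    have e : (take_poly i p).[x] + b * x ^+ i = 0.
      by rewrite -px -[in RHS](poly_take_drop i p) hornerD hornerM hornerXn.
    by move/eqP: e; rewrite addrC addr_eq0 /take_poly horner_poly => /eqP.
  have wbx : vring w (b * x).
    case: i @b {wd imax} iu bE => [|i] b iu bE.
      by move: bE; rewrite expr0 mulr1 big_ord0 oppr0 => ->; rewrite mul0r; exact: vring0.
    have -> : b * x = - \sum_(j < i.+1) p`_j * x^-1 ^+ (i - j).
      apply: (mulIf (expf_neq0 i x0)); rewrite -mulrA -exprS bE mulNr mulr_suml.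
      congr (- _); apply: eq_bigr => j _; rewrite -mulrA; congr (_ * _).
      have ji : (j <= i)%N by rewrite -ltnS.
      have -> : x ^+ i = x ^+ (i - j) * x ^+ j by rewrite -exprD subnK.
      by rewrite mulrA exprVn mulVf ?mul1r // expf_neq0.
    apply: vringN; apply: vring_sum => j _; apply: vringM => //; exact: vringX.
  by split=> //; rewrite -[b](mulfK x0); exact: vringM.
have Rb : R b /\ R (b * x).
  have h g : gal_fix A g -> forall j, vring (vpull v g) p`_j /\ vring (vpull v' g) p`_j.
    by move=> gA j; rewrite /= gA //; split=> //; apply/agree.
  have key1 g (gA : gal_fix A g) := key (vpull v g) (fun j => (h g gA j).1).
  have key2 g (gA : gal_fix A g) := key (vpull v' g) (fun j => (h g gA j).2).
  by split=> g gA; have [? ?] := key1 g gA; have [? ?] := key2 g gA.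
have [Rb1 Rb2] := Rb; exists b; split=> // mb; apply: iu.
have -> : p`_i = b - (drop_poly i p - (p`_i)%:P).[x].
  by rewrite hornerD hornerN hornerC opprB addrC subrK.
apply: vmaxB => //; apply: vmax_horner => // j.
rewrite coefB coefC coef_drop_poly; case: j => [|j].
  by rewrite add0n subrr; exact: vmax0.
by rewrite subr0; apply: imax; rewrite addSn ltnS leq_addl.
Qed.

(** The product of the negated conjugates of z is an element of A in the maximal ideal of v', hence
    in that of v, and a maximal ideal containing a product of integral elements contains a
    factor. *)
Lemma conj_ring_norm z : R z -> vmax v' z ->
  exists2 g : Gal iota, gal_fix A g & vmax v (g z).
Proof.
move=> Rz mz; have [s [As zs sP]] := conj_seq z.
have O's y : y \in s -> O y /\ O' y.
  by move=> /sP[g gA <-]; have [] := Rz g gA.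
have AN : A (\prod_(y <- s) (- y)).
  have := As 0%N; rewrite -horner_coef0 horner_prod; congr A.
  by apply: eq_bigr => y _; rewrite !hornerE ?sub0r ?add0r.
have m'N : vmax v' (\prod_(y <- s) (- y)).
  rewrite (big_rem z) //=; apply: vmaxMr; last exact: vmaxN.
  by rewrite big_seq; apply: vring_prod => y /mem_rem ys; apply: vringN; have [] := O's y ys.
have := vmax_agree AN m'N; rewrite -(big_map (fun y => - y) xpredT id) => /vmax_prod[].
  by move=> _ /mapP[y ys ->]; apply: vringN; have [] := O's y ys.
move=> _ /mapP[y /sP[g gA <-] ->] my; exists g => //.
by rewrite -[gal_fun g z]opprK; exact: vmaxN.
Qed.

(** The elements of [R] in the maximal ideal of v' form a maximal ideal of [R]. In the monic
    equation of u, with coefficients in A, let i be the first index of a unit coefficient; modulo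
    the ideal a power of u splits off, leaving d u + q_i = 0, which inverts u. *)
Lemma conj_ring_inv u : R u -> ~ vmax v' u ->
  exists2 w, R w & vmax v' (u * w - 1).
Proof.
move=> Ru nu; have [s [As us sP]] := conj_seq u.
pose q := \prod_(y <- s) ('X - y%:P).
have Oq i : O' q`_i.
  by apply: vring_monic_coef => y /sP[g gA <-]; have [] := Ru g gA.
have Rq i : R q`_i by apply: conj_ring_base.
have vu := conj_ring_sub Ru.
have qu : q.[u] = 0.
  by apply/rootP; rewrite root_prod_XsubC.
pose P i := `[< ~ vmax v' q`_i >].
have exP : exists i, P i.
  exists (size q).-1; apply/asboolP; rewrite -lead_coefE (monicP _) ?monic_prod_XsubC //.
  exact: vmax1.
case: (ex_minnP exP) => i /asboolP ni imin.
pose d := (drop_poly i.+1 q).[u].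
have dE : (drop_poly i q).[u] = d * u + q`_i.
  have -> : drop_poly i q = drop_poly i.+1 q * 'X + (q`_i)%:P.
    apply/polyP => j; rewrite coefD coefMX coefC !coef_drop_poly.
    by case: j => [|j] /=; rewrite ?add0r ?addr0 // addSnnS.
  by rewrite hornerD hornerM hornerX hornerC.
have md : vmax v' (d * u + q`_i).
  rewrite -dE; apply: (@vmax_cancel _ _ _ _ (u ^+ i)); last by move/(vmax_exp vu).
  have -> : u ^+ i * (drop_poly i q).[u] = - (take_poly i q).[u].
    have e : (take_poly i q).[u] + u ^+ i * (drop_poly i q).[u] = 0.
      by rewrite -qu -[in RHS](poly_take_drop i q) hornerD hornerM hornerXn [_ * u ^+ i]mulrC.
    by move/eqP: e; rewrite addrC addr_eq0 => /eqP.
  apply: vmaxN; apply: vmax_horner => // j; rewrite coef_take_poly.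
  case: ifP => [ji|_]; last exact: vmax0.
  by apply: contrapT => nj; have := imin j (asboolT nj); rewrite leqNgt ji.
have [q0 qV] := nvmax ni.
exists (- (d / q`_i)).
  rewrite -sub0r; apply: conj_ringB; first by apply: conj_ring_base; [exact: (sf0 sA)|exact: vring0].
  apply: conj_ringM; last by apply: conj_ring_base => //; exact: (sfV sA).
  by apply: conj_ring_horner => // j; rewrite coef_drop_poly.
have -> : u * - (d / q`_i) - 1 = - ((d * u + q`_i) / q`_i).
  by rewrite mulrDl divff // opprD mulrN mulrCA mulrA.
by apply: vmaxN; apply: vmaxMr.
Qed.

(* Prime avoidance for finitely many elements: the combinations of z_0, z_1, ...
   with coefficients the powers of n run through infinitely many n but only
   finitely many conjugates. *)
Lemma conj_avoid (Z : seq F) : (forall z, z \in Z -> R z /\ vmax v' z) ->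
  exists2 g : Gal iota, gal_fix A g & forall z, z \in Z -> vmax v (g z).
Proof.
move=> ZP.
have ZP' i : R (Poly Z)`_i /\ vmax v' (Poly Z)`_i.
  rewrite coef_Poly; have [iz|iz] := ltnP i (size Z); first exact/ZP/mem_nth.
  rewrite nth_default //; split; last exact: vmax0.
  by apply: conj_ring_base; [exact: (sf0 sA)|exact: vring0].
have /choice[gs gsP] : forall m : nat, exists g : Gal iota,
    gal_fix A g /\ vmax v (g (Poly Z).[iota m%:R]).
  move=> m; have [||g gA mg] := @conj_ring_norm ((Poly Z).[iota m%:R]); last by exists g.
    apply: conj_ring_horner => [i|]; first by have [] := ZP' i.
    by apply: conj_ring_base; [apply: kA; exists m%:R|exact: vring_iota].
  apply: vmax_horner => [i|]; first by have [] := ZP' i.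
  exact: vring_iota.
have [L LP] : exists L : seq F, forall z (g : Gal iota), z \in Z -> gal_fix A g -> g z \in L.
  elim: Z {ZP ZP' gsP} => [|z Z [L LP]]; first by exists [::].
  have [s [_ _ sP]] := conj_seq z; exists (s ++ L) => y g; rewrite inE mem_cat.
  move=> /predU1P[->|yZ] gA; last by rewrite LP ?orbT.
  by apply/orP; left; apply/sP; exists g.
(* [f m] records which conjugate [gs m] assigns to each entry of Z; the successor in the target type
   is what [inord] requires. On a large fibre all [gs m] act on Z like a single g, and the
   Vandermonde argument applies. *)
pose f m := [ffun i : 'I_(size Z) => inord (index (gs m Z`_i) L) : 'I_(size L).+1].
have [t [s [us sZ sP]]] := large_fiber f (size Z).+1.
have [m0 m0s] : exists m0, m0 \in s.
  by case: s us sZ sP => // m0 s _ _ _; exists m0; rewrite inE eqxx.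
exists (gs m0); first by have [] := gsP m0.
have same m i : m \in s -> (i < size Z)%N -> gs m Z`_i = gs m0 Z`_i.
  move=> ms iZ.
  have := congr1 (fun c : {ffun _ -> _} => val (c (Ordinal iZ))) (etrans (sP _ ms) (esym (sP _ m0s))).
  rewrite !ffunE /= !inordK ?ltnS ?index_size // => e.
  have mL m' : gs m' Z`_i \in L by apply: LP; [exact: mem_nth|exact: (gsP m').1].
  by rewrite -(nth_index 0 (mL m)) e nth_index.
pose p := map_poly (gs m0) (Poly Z).
have mp : forall i, vmax v p`_i.
  apply: (@vmax_vandermonde _ _ _ v p [seq m%:R | m <- s]).
  - by rewrite map_inj_uniq.
  - by rewrite size_map_poly size_map (leq_trans (size_Poly _)) // ltnW.
  - move=> _ /mapP[m ms ->]; have [gA] := gsP m.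
    have [_ _ _ gk] := galP (gs m); rewrite -horner_map /= gk.
    congr (vmax v _.[_]); apply/polyP => i; rewrite !coef_map coef_Poly /=.
    have [iz|iz] := ltnP i (size Z); first by rewrite same.
    by rewrite nth_default // !rmorph0.
move=> z zZ; have := mp (index z Z).
by rewrite coef_map coef_Poly /= nth_index.
Qed.

(** Each condition on s becomes membership of g z in the maximal ideal of v for one or two z in [R],
    which [conj_avoid] provides. With b as in [conj_ring_frac] and w inverse to b modulo the ideal,
    z = b w - 1 forces g b to be a unit, so g s is integral when b s is in [R]; if s is not integral
    for v', the same is done for its inverse, with b / s as second element. *)
Lemma conj_finite (S : seq F) :
  exists2 g : Gal iota, gal_fix A g & forall s, s \in S -> (O' s <-> O (g s)).
Proof.
have unit (g : Gal iota) b w : gal_fix A g -> R b -> R w -> vmax v (g (b * w - 1)) -> ~ vmax v (g b).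
  move=> gA Rb Rw; rewrite rmorphB rmorph1 rmorphM => m1 mb.
  apply: (@vmax1 _ _ _ v); rewrite -[1](subKr (gal_fun g b * gal_fun g w)).
  by apply: vmaxB => //; apply: vmaxMr => //; have [] := Rw g gA.
have [Z [ZP gP]] : exists Z : seq F, (forall z, z \in Z -> R z /\ vmax v' z) /\
    forall g : Gal iota, gal_fix A g -> (forall z, z \in Z -> vmax v (g z)) ->
    forall s, s \in S -> (O' s <-> O (g s)).
  elim: S => [|s S [Z [ZP gP]]]; first by exists [::].
  suff [Z' [ZP' gP']] : exists Z' : seq F, (forall z, z \in Z' -> R z /\ vmax v' z) /\
      forall g : Gal iota, gal_fix A g -> (forall z, z \in Z' -> vmax v (g z)) ->
      (O' s <-> O (g s)).
    exists (Z' ++ Z); split=> [z|g gA gz s']; first by rewrite mem_cat => /orP[/ZP'|/ZP].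
    rewrite inE => /predU1P[->|s'S].
      by apply: gP' => // z zZ; apply: gz; rewrite mem_cat zZ.
    by apply: gP => // z zZ; apply: gz; rewrite mem_cat zZ orbT.
  have R1 : R 1 by apply: conj_ring_base; [exact: (sf1 sA)|exact: vring1].
  have [vs|/nvring[s0 ms]] := pselect (O' s).
    have [b [Rb Rbs nb]] := conj_ring_frac vs; have [w Rw mw] := conj_ring_inv Rb nb.
    exists [:: b * w - 1]; split=> [z|g gA gz].
      by rewrite inE => /eqP ->; split=> //; apply: conj_ringB => //; exact: conj_ringM.
    split=> // _; have [b0 vb] := nvmax (unit g b w gA Rb Rw (gz _ (mem_head _ _))).
    rewrite -[gal_fun g s](mulKf b0) -rmorphM; apply: vringM => //.
    by have [] := Rbs g gA.
  have [b [Rb Rbs nb]] := conj_ring_frac (vmax_ring ms).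
  have [w Rw mw] := conj_ring_inv Rb nb.
  exists [:: b * w - 1; b * s^-1]; split=> [z|g gA gz].
    rewrite !inE => /orP[/eqP ->|/eqP ->].
      by split=> //; apply: conj_ringB => //; exact: conj_ringM.
    by split=> //; apply: vmaxM => //; exact: conj_ring_sub.
  split=> [vs|vgs].
    by exfalso; move: ms => [/eqP|]; rewrite ?invr_eq0 ?(negPf s0) ?invrK.
  have nb' := unit g b w gA Rb Rw (gz _ (mem_head _ _)).
  have := gz (b * s^-1); rewrite !inE eqxx orbT => /(_ isT).
  rewrite rmorphM => /vmax_cancel/(_ nb') m; exfalso.
  apply: (@vmax1 _ _ _ v); rewrite -(@divff _ (gal_fun g s)) ?fmorph_eq0 //.
  by rewrite -fmorphV; exact: vmaxM.
by have [g gA gZ] := conj_avoid ZP; exists g => //; exact: gP.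
Qed.

End TwoValuations.
End Conjugates.

(** * Extending isomorphisms that respect the valuation *)

Section ValuedExtension.
Variables (k : fieldType) (F : closedFieldType) (iota : {rmorphism k -> F}).
Variable v : valuation_ring iota.
Hypothesis k_inj : injective (fun n : nat => n%:R : k).
Local Notation acl := (acl iota).
Local Notation O := (vring v).

Definition valued (Phi : set (F * F)) : Prop :=
  graph iota Phi /\ forall a b, Phi (a, b) -> (O a <-> O b).

Lemma valued_tr Phi : valued Phi -> valued (trgraph Phi).
Proof.
by move=> [gP vP]; split; [exact: trgraphP|move=> a b ab; rewrite (vP b a ab)].
Qed.

(** Extend Phi to an automorphism [rho] regardless of v. The valuation v transported by [rho] agrees
    with v on the codomain A, so [rho] has to be corrected by some g over A. *)
Lemma valued_dom Phi x : valued Phi -> (forall x, acl (dom Phi) x) ->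
  (forall x, acl (cod Phi) x) ->
  exists R, [/\ valued R, Phi `<=` R & dom R x].
Proof.
move=> [gP vP] dT cT.
have T1 (B : set F) : B `<=` setT by [].
have bP : balanced iota setT Phi by split=> // y _.
have [R0 [gR0 PR0 dR0 cR0]] := balanced_total (T1 _) bP.
have [rho rhoP] := gal_of_graph gR0 dR0 cR0.
have rhoE a b : Phi (a, b) -> rho a = b by move/PR0/rhoP.
pose A := cod Phi.
have sA : subfield A := dom_subfield (trgraphP gP).
have kA : range iota `<=` A := dom_const (trgraphP gP).
pose v' := vpull v (rho^-1)%g.
have agree a : A a -> (O a <-> vring v' a).
  by move=> [x0 xa]; rewrite /= -(rhoE _ _ xa) galKV (rhoE _ _ xa) (vP _ _ xa).
pose y := rho x.
have [s [_ _ sP]] := conj_seq sA kA cT y.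
pose Ay := gen_subfield (A `|` [set y]).
(* On A(y) the map g depends only on g y, which runs through a finite list. If every g failed, one
   witness of failure per conjugate of y would suffice, and [conj_finite] handles these finitely
   many witnesses together. *)
have [g gA gP'] : exists2 g : Gal iota, gal_fix A g &
    forall z, Ay z -> (vring v' z <-> O (g z)).
  apply: contrapT => no.
  have bad (g : Gal iota) : gal_fix A g ->
      exists z, Ay z /\ ~ (vring v' z <-> O (g z)).
    move=> gA; apply: contrapT => nz; apply: no; exists g => // z Az.
    by apply: contrapT => nv; apply: nz; exists z.
  have same (g g' : Gal iota) z : gal_fix A g -> gal_fix A g' -> g y = g' y ->
      Ay z -> g z = g' z.
    move=> gA gA' gy; apply: (@smallest_sub _ _ (A `|` [set y]) [set z | g z = g' z]).
      split=> [|a b|a b]; rewrite !inE /= ?rmorph1 ?rmorphB ?fmorph_div //.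
        by move=> ea eb; congr (_ - _).
      by move=> ea eb; congr (_ / _).
    by move=> a [Aa|->] /=; [exact: etrans (gA _ Aa) (esym (gA' _ Aa))|exact: gy].
  have /choice[zf zfP] : forall y', exists z, forall g : Gal iota,
      gal_fix A g -> g y = y' -> Ay z /\ ~ (vring v' z <-> O (g z)).
    move=> y'; have [[g0 [g0A g0y]]|none] := pselect (exists g : Gal iota, gal_fix A g /\ g y = y').
      have [z [Az bz]] := bad g0 g0A; exists z => g gA gy; split=> //.
      by rewrite (same g g0) // gy g0y.
    by exists 0 => g gA gy; exfalso; apply: none; exists g.
  have [g gA gS] := @conj_finite _ _ _ _ sA kA cT v v' agree k_inj (map zf s).
  have ys : g y \in s by apply/sP; exists g.
  have [_] := zfP _ g gA erefl; apply; apply: gS.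
  exact: map_f.
pose R := gres (g * rho)%g (gen_subfield (dom Phi `|` [set x])).
have kdx : range iota `<=` gen_subfield (dom Phi `|` [set x]).
  by move=> c ck; apply: sub_gen_smallest; left; exact: (dom_const gP).
have rhoA a : gen_subfield (dom Phi `|` [set x]) a -> Ay (rho a).
  have AyS := gen_subfieldP (A `|` [set y]).
  apply: (@smallest_sub _ _ (dom Phi `|` [set x]) [set a | Ay (rho a)]).
    split=> [|b c|b c]; rewrite !inE /= ?rmorph1 ?rmorphB ?fmorph_div.
    - exact: (sf1 AyS).
    - exact: (sfB AyS).
    - exact: (sf_div AyS).
  move=> b [[b' bb]|->] /=; last by apply: sub_gen_smallest; right.
  by rewrite (rhoE _ _ bb); apply: sub_gen_smallest; left; exists b.
exists R; split.
- split; first by apply: gres_graph => //; exact: gen_subfieldP.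
  move=> a _ [/= xa <-]; rewrite galM -gP' /=; last exact: rhoA.
  by rewrite galKV.
- move=> [a b] ab; split=> /=; first by apply: sub_gen_smallest; left; exists b.
  by rewrite galM (rhoE _ _ ab) gA //; exists a.
- by exists (gal_fun (g * rho)%g x); split=> //=; apply: sub_gen_smallest; right.
Qed.

Lemma valued_extend Phi : valued Phi -> (forall x, acl (dom Phi) x) ->
  (forall x, acl (cod Phi) x) ->
  exists2 g : Gal iota, stab_v v g & forall a b, Phi (a, b) -> g a = b.
Proof.
move=> vP dT cT.
have [D Db D0 totD|R [PR bR maxR]] := Zorn_above vP.
  split; first by apply: graph_chain => // X /Db[].
  by move=> a b [X DX ab]; have [_] := Db _ DX; apply.
have [gR vR] := bR.
have dRT x : acl (dom R) x by apply: acl_mono (dT x); exact: sub_dom.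
have cRT x : acl (cod R) x by apply: acl_mono (cT x); exact: sub_cod.
have dR : dom R = setT.
  apply/seteqP; split=> // x _; have [R' [bR' RR' [y xy]]] := valued_dom x bR dRT cRT.
  by exists y; exact: (maxR R' bR' RR' _ xy).
have cR : cod R = setT.
  apply/seteqP; split=> // x _.
  have [R' [bR' RR' [y xy]]] := valued_dom x (valued_tr bR) cRT dRT.
  exists y; apply: (maxR (trgraph R') (valued_tr bR') _ (y, x) xy).
  by move=> [a b] Rab; exact: (RR' (b, a) Rab).
have [g gP] := gal_of_graph gR dR cR.
exists g; last by move=> a b /PR/gP.
apply/seteqP; split=> [_ [x vx <-]|y vy].
  by apply/(vR x (g x)) => //; apply/gP.
exists (gal_fun (g^-1)%g y); last by rewrite galVK.
by apply/(vR _ y) => //; apply/gP; rewrite galVK.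
Qed.

End ValuedExtension.

(** * Gauss' lemma for value-independent elements *)

Section Similar.
Variables (k : fieldType) (F : closedFieldType) (iota : {rmorphism k -> F}).
Variable v : valuation_ring iota.
Local Notation O := (vring v).
Local Notation m := (vmax v).

(** Both are nonzero with quotient in 1 + m: they have the same leading term, not only the same
    value as in [unit_ratio]. *)
Definition vsim (a b : F) : Prop := b != 0 /\ m (a / b - 1).

Lemma vsim_refl a : a != 0 -> vsim a a.
Proof. by move=> a0; split; rewrite // divff // subrr; exact: vmax0. Qed.

Lemma vsim_neq0 a b : vsim a b -> a != 0.
Proof.
move=> [b0 ab]; apply/eqP => a0; apply: (@vmax1 _ _ _ v).
by move: ab; rewrite a0 mul0r sub0r => /vmaxN; rewrite opprK.
Qed.

Lemma vsimP a b : vsim a b -> [/\ O (a / b), ~ m (a / b) & O (b / a)].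
Proof.
move=> ab; have a0 := vsim_neq0 ab; have [b0 mab] := ab.
have nab : ~ m (a / b).
  move=> m1; apply: (@vmax1 _ _ _ v).
  by rewrite -[1](subKr (a / b)); exact: vmaxB.
split=> //; last by have [_] := nvmax nab; rewrite invf_div.
rewrite -[a / b](subrK 1); apply: vringD; [exact: vmax_ring|exact: vring1].
Qed.

Lemma vsimM a b c d : vsim a b -> vsim c d -> vsim (a * c) (b * d).
Proof.
move=> ab cd; have [Oab _ _] := vsimP ab; have [[b0 mab] [d0 mcd]] := (ab, cd).
split; first exact: mulf_neq0.
rewrite -mulf_div; have -> : a / b * (c / d) - 1 = a / b * (c / d - 1) + (a / b - 1).
  by rewrite mulrBr mulr1 addrA subrK.
by apply: vmaxD => //; apply: vmaxM.
Qed.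

Lemma vsimV a b : vsim a b -> vsim a^-1 b^-1.
Proof.
move=> ab; have a0 := vsim_neq0 ab; have [_ _ Oba] := vsimP ab.
have [b0 mab] := ab; split; first by rewrite invr_eq0.
have -> : a^-1 / b^-1 - 1 = - (b / a * (a / b - 1)).
  by rewrite mulrBr mulr1 mulf_div [b * a]mulrC divff ?mulf_neq0 // opprB invrK [_ * b]mulrC.
by apply/vmaxN/vmaxM.
Qed.

Lemma vsimD a b c : vsim a b -> m (c / b) -> vsim (a + c) b.
Proof.
move=> [b0 ab] mc; split=> //; rewrite mulrDl addrAC; exact: vmaxD.
Qed.

Lemma vsim_vring a b : vsim a b -> (O a <-> O b).
Proof.
move=> ab; have [Oab _ Oba] := vsimP ab; have a0 := vsim_neq0 ab.
have [b0 _] := ab; split=> h.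
  by rewrite -[b](divfK a0); exact: vringM.
by rewrite -[a](divfK b0); exact: vringM.
Qed.

Definition unit_ratio (a b : F) : Prop := [/\ a != 0, b != 0, O (a / b) & O (b / a)].

Lemma unit_ratio_sym a b : unit_ratio a b -> unit_ratio b a.
Proof. by case. Qed.
Lemma unit_ratio_refl a : a != 0 -> unit_ratio a a.
Proof. by move=> a0; split; rewrite ?divff //; exact: vring1. Qed.
Lemma unit_ratioM a b c d : unit_ratio a b -> unit_ratio c d -> unit_ratio (a * c) (b * d).
Proof.
by move=> [? ? ? ?] [? ? ? ?]; split; rewrite ?mulf_neq0 // -mulf_div; exact: vringM.
Qed.
Lemma unit_ratioV a b : unit_ratio a b -> unit_ratio a^-1 b^-1.
Proof. by move=> [? ? ? ?]; split; rewrite ?invr_eq0 // invrK mulrC. Qed.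
Lemma unit_ratioX a b n : unit_ratio a b -> unit_ratio (a ^+ n) (b ^+ n).
Proof.
move=> ab; elim: n => [|n IH]; last by rewrite !exprS; exact: unit_ratioM.
exact/unit_ratio_refl/oner_neq0.
Qed.
Lemma unit_ratio_vring a b : unit_ratio a b -> O a -> O b.
Proof. by move=> [a0 b0 _ ba] va; rewrite -[b](divfK a0); exact: vringM. Qed.
Lemma unit_ratio_vmax a b : unit_ratio a b -> m a -> m b.
Proof. by move=> [a0 b0 _ ba] va; rewrite -[b](divfK a0); exact: vmaxM. Qed.
Lemma vsim_unit a b : vsim a b -> unit_ratio a b.
Proof. by move=> ab; have [? ? ?] := vsimP ab; split=> //; [exact: vsim_neq0 ab|case: ab]. Qed.
Lemma unit_ratio_trans a b c : unit_ratio a b -> unit_ratio b c -> unit_ratio a c.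
Proof.
move=> ab bc; have [_ b0 _ _] := ab.
have := unit_ratioM (unit_ratioM ab bc) (unit_ratioV (unit_ratio_refl b0)).
by rewrite mulfK // mulrAC divff // mul1r.
Qed.

Variable Phi : set (F * F).
Hypothesis gP : graph iota Phi.
(* [M] plays the role of the monomials times constants. *)
Variable M : set (F * F).
Hypothesis MV : forall a a' b b', M (a, a') -> M (b, b') -> M (a / b, a' / b').
Hypothesis Mu : forall a a', M (a, a') -> unit_ratio a a'.
Hypothesis PM : forall a a', Phi (a, a') -> a != 0 ->
  exists b b', [/\ M (b, b'), vsim a b & vsim a' b'].
Variables t t' : F.
Hypothesis tu : unit_ratio t t'.
Hypothesis tM : forall a a' n, M (a, a') -> ~ (O (a * t ^+ n.+1) /\ O (a * t ^+ n.+1)^-1).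

(** By [tM] no two terms have the same value, so a single term dominates p(t). The primed terms have
    the same values, so the term with the same index dominates q(t'): one j serves both. *)
Lemma gauss_poly p q : gpoly Phi p q -> p != 0 ->
  exists b b' j, [/\ M (b, b'), vsim p.[t] (b * t ^+ j) & vsim q.[t'] (b' * t' ^+ j)].
Proof.
move: {2}(size p) (leqnn (size p)) => n.
elim: n p q => [|n IH] p q.
  by rewrite leqn0 size_poly_eq0 => /eqP -> _; rewrite eqxx.
move=> pn pq p0; have [t0 t0' _ _] := tu.
have pE (r : {poly F}) : r = drop_poly 1 r * 'X + (r`_0)%:P.
  apply/polyP => j; rewrite coefD coefMX coefC coef_drop_poly.
  by case: j => [|j] /=; rewrite ?add0r ?addr0 // addn1.
have pq1 : gpoly Phi (drop_poly 1 p) (drop_poly 1 q).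
  by move=> i; rewrite !coef_drop_poly; exact: pq.
have peval (r : {poly F}) x : r.[x] = (drop_poly 1 r).[x] * x + r`_0.
  by rewrite {1}(pE r) hornerD hornerM hornerX hornerC.
have [d0|d0] := eqVneq (drop_poly 1 p) 0.
  have d0' : drop_poly 1 q = 0 by apply/eqP; rewrite -(gpoly_eq0 gP pq1) d0.
  have p00 : p`_0 != 0.
    by apply: contraNneq p0 => p00; rewrite (pE p) d0 p00 mul0r add0r.
  have [b [b' [Mb ab ab']]] := PM (pq 0%N) p00.
  exists b, b', 0%N; rewrite (peval p) (peval q) d0 d0' !horner0 !mul0r !add0r !mulr1.
  by split.
have [|b [b' [j [Mb ab ab']]]] := IH _ _ _ pq1 d0.
  by rewrite size_drop_poly leq_subLR.
have {}ab : vsim ((drop_poly 1 p).[t] * t) (b * t ^+ j.+1).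
  by rewrite exprSr mulrA; apply: vsimM => //; exact: vsim_refl.
have {}ab' : vsim ((drop_poly 1 q).[t'] * t') (b' * t' ^+ j.+1).
  by rewrite exprSr mulrA; apply: vsimM => //; exact: vsim_refl.
have [p00|p00] := eqVneq p`_0 0.
  exists b, b', j.+1; rewrite (peval p) (peval q) p00.
  have -> : q`_0 = 0 by apply/eqP; rewrite -(rg_eq0 gP.1 (pq 0%N)) p00.
  by rewrite !addr0.
have [c [c' [Mc pc pc']]] := PM (pq 0%N) p00.
have [b0 b0' _ _] := Mu Mb; have [c0 c0' _ _] := Mu Mc.
set a := b * t ^+ j.+1 in ab *; set a' := b' * t' ^+ j.+1 in ab' *.
have ua : unit_ratio a a' by apply: unit_ratioM; [exact: Mu|exact: unit_ratioX].
(* The higher part contributes a, the constant coefficient contributes c; a / c contains a positive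
   power of t, so their values differ. *)
have ac := @tM _ _ j (MV Mb Mc); rewrite mulrAC -/a invf_div in ac.
have sum x y z w : vsim x y -> vsim w z -> m (z / y) -> vsim (x + w) y.
  move=> xy wz mzy; apply: vsimD => //; have [z0 _] := wz.
  have -> : w / y = w / z * (z / y) by rewrite mulrA divfK.
  by apply: vmaxM => //; have [] := vsimP wz.
have uca : unit_ratio (c / a) (c' / a').
  by apply: unit_ratioM; [exact: Mu|exact: unit_ratioV].
have [vca|/nvring[_]] := pselect (O (c / a)).
  have mca : m (c / a) by right => vac; apply: ac; rewrite invf_div in vac.
  exists b, b', j.+1; split=> //; rewrite peval.
    exact: (sum _ _ c).
  exact: (sum _ _ c' _ ab' pc' (unit_ratio_vmax uca mca)).
rewrite invf_div => mac; exists c, c', 0%N; rewrite !mulr1; split=> //; rewrite peval addrC.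
  exact: (sum _ _ a).
apply: (sum _ _ a') => //; apply: unit_ratio_vmax mac.
by have := unit_ratioV uca; rewrite !invf_div.
Qed.

Lemma gauss_compat : compat Phi t t'.
Proof.
move=> p q pq; have [p0|p0] := eqVneq p 0.
  by have := gpoly_eq0 gP pq; rewrite p0 eqxx => /esym/eqP ->; rewrite !horner0.
have [b [b' [j [_ s1 s2]]]] := gauss_poly pq p0.
by have [n1 n2] := (vsim_neq0 s1, vsim_neq0 s2); split=> /eqP; rewrite ?(negPf n1) ?(negPf n2).
Qed.

Lemma gauss_adjoin a a' : adjoin Phi t t' (a, a') -> a != 0 ->
  exists b b' i j, [/\ M (b, b'), vsim a (b * (t ^+ i / t ^+ j))
    & vsim a' (b' * (t' ^+ i / t' ^+ j))].
Proof.
move=> [x [x' [y [y' [[p [q [/= pq -> ->]]] [r [s [/= rs -> ->]]] ry /= -> ->]]]]] a0.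
have p0 : p != 0 by apply: contraNneq a0 => ->; rewrite horner0 mul0r.
have r0 : r != 0 by apply: contraNneq ry => ->; rewrite horner0.
have [b [b' [i [Mb pb qb]]]] := gauss_poly pq p0.
have [c [c' [j [Mc rc sc]]]] := gauss_poly rs r0.
exists (b / c), (b' / c'), i, j; split; first exact: MV.
  by rewrite mulf_div; apply: vsimM => //; exact: vsimV.
by rewrite mulf_div; apply: vsimM => //; exact: vsimV.
Qed.

End Similar.

Section Gauss.
Variables (k : fieldType) (F : closedFieldType) (iota : {rmorphism k -> F}).
Variable v : valuation_ring iota.
Local Notation acl := (acl iota).
Local Notation O := (vring v).
Local Notation m := (vmax v).
Local Notation sim := (@vsim _ _ _ v).
Local Notation ur := (@unit_ratio _ _ _ v).
Variables (r : nat) (t : 'I_r -> F).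

Definition monom (t : 'I_r -> F) (e : 'I_r -> int) : F := \prod_i t i ^ e i.

Hypothesis t0 : forall i, t i != 0.
Hypothesis t_val : forall e, O (monom t e) -> O (monom t e)^-1 -> forall i, e i = 0.

Lemma monomD (u : 'I_r -> F) e1 e2 : (forall i, u i != 0) ->
  monom u (fun i => e1 i + e2 i) = monom u e1 * monom u e2.
Proof. by move=> u0; rewrite -big_split /=; apply: eq_bigr => i _; rewrite expfzDr. Qed.

Lemma monomN (u : 'I_r -> F) e : monom u (fun i => - e i) = (monom u e)^-1.
Proof. by rewrite /monom -prodfV; apply: eq_bigr => i _; rewrite invr_expz. Qed.

Lemma monom0 (u : 'I_r -> F) : monom u (fun=> 0) = 1.
Proof. by rewrite /monom big1. Qed.

Lemma monom_delta (u : 'I_r -> F) i (n : nat) :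
  monom u (fun j => if j == i then n%:Z else 0) = u i ^+ n.
Proof.
by rewrite /monom (bigD1 i) //= eqxx big1 ?mulr1 // => j /negPf ->.
Qed.

Lemma unit_ratio_monom (u w : 'I_r -> F) e : (forall i, ur (u i) (w i)) ->
  ur (monom u e) (monom w e).
Proof.
move=> uw; apply: (@big_ind2 _ _ ur).
- exact/unit_ratio_refl/oner_neq0.
- by move=> *; exact: unit_ratioM.
- move=> i _; case: (e i) => n; first exact: unit_ratioX.
  rewrite NegzE -!invr_expz; apply: unit_ratioV; exact: unit_ratioX.
Qed.

Lemma monom_shift (u : 'I_r -> F) e (l : 'I_r) (i j : nat) : (forall i, u i != 0) ->
  monom u (fun x => e x + (if x == l then i%:Z else 0) + - (if x == l then j%:Z else 0))
  = monom u e * (u l ^+ i / u l ^+ j).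
Proof.
move=> u0; rewrite (monomD _ (fun x => - (if x == l then j%:Z else 0))) // monomD //.
by rewrite monomN !monom_delta mulrA.
Qed.

Section Iterate.
Variable Phi : set (F * F).
Hypotheses (gP : graph iota Phi) (dO : dom Phi `<=` O) (cO : cod Phi `<=` O).
Variable t' : 'I_r -> F.
Hypothesis tt' : forall i, ur (t i) (t' i).

(** The new element t_n meets only monomials in the earlier t_i, so by [t_val] a positive power of
    it times such a monomial is never a unit; this is the hypothesis [tM] of the one-variable step.
    Nonzero constants are units, as they form a field inside the valuation ring. *)
Lemma gauss_iter n : (n <= r)%N -> exists Psi,
  [/\ graph iota Psi, Phi `<=` Psi, forall i : 'I_r, (i < n)%N -> Psi (t i, t' i)
    & forall a a', Psi (a, a') -> a != 0 -> exists d d' e,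
      [/\ Phi (d, d'), d != 0, forall i : 'I_r, (n <= i)%N -> e i = 0,
        sim a (d * monom t e) & sim a' (d' * monom t' e)]].
Proof.
have t0' i : t' i != 0 by have [] := tt' i.
have P0 d d' : Phi (d, d') -> d != 0 -> d' != 0 by move=> /(rg_eq0 gP.1) ->.
elim: n => [_|n IH nr].
  exists Phi; split=> // a a' aa' a0.
  by exists a, a', (fun=> 0); rewrite !monom0 !mulr1; split=> //; apply: vsim_refl => //; exact: P0 aa' a0.
have [Psi [gPsi PPsi tPsi mPsi]] := IH (ltnW nr).
pose i0 := Ordinal nr.
pose M := [set z : F * F | exists d d' e, [/\ Phi (d, d'), d != 0,
  forall i : 'I_r, (n <= i)%N -> e i = 0, z.1 = d * monom t e & z.2 = d' * monom t' e]].
have Vd d d' : Phi (d, d') -> d != 0 -> [/\ O d, O d^-1, O d' & O d'^-1].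
  move=> dd d0; have dV := gV gP dd.
  by split; [apply: dO; exists d'|apply: dO; exists d'^-1|apply: cO; exists d|apply: cO; exists d^-1].
have MV a a' b b' : M (a, a') -> M (b, b') -> M (a / b, a' / b').
  move=> [d [d' [e [/= Pd d0 e0 -> ->]]]] [c [c' [f [/= Pc c0 f0 -> ->]]]].
  exists (d / c), (d' / c'), (fun i => e i - f i); split.
  - exact: (g_div gP Pd Pc).
  - by rewrite mulf_neq0 ?invr_eq0.
  - by move=> i ni; rewrite e0 // f0 // subr0.
  - by rewrite /= (monomD _ (fun i => - f i)) // monomN mulf_div.
  - by rewrite /= (monomD _ (fun i => - f i)) // monomN mulf_div.
have Mu a a' : M (a, a') -> ur a a'.
  move=> [d [d' [e [/= Pd d0 e0 -> ->]]]]; apply: unit_ratioM; last exact: unit_ratio_monom.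
  by have [? ? ? ?] := Vd _ _ Pd d0; split=> //; [exact: P0 Pd d0|exact: vringM|exact: vringM].
have PM a a' : Psi (a, a') -> a != 0 ->
    exists b b', [/\ M (b, b'), sim a b & sim a' b'].
  move=> aa a0; have [d [d' [e [Pd d0 e0 s1 s2]]]] := mPsi _ _ aa a0.
  by exists (d * monom t e), (d' * monom t' e); split=> //; exists d, d', e.
have tM a a' j : M (a, a') -> ~ (O (a * t i0 ^+ j.+1) /\ O (a * t i0 ^+ j.+1)^-1).
  move=> [d [d' [e [/= Pd d0 e0 -> _]]]] [u1 u2].
  have [vd vdV _ _] := Vd _ _ Pd d0.
  have := @t_val (fun i => e i + (if i == i0 then j.+1%:Z else 0)) _ _ i0.
  rewrite eqxx e0 // add0r monomD // monom_delta.
  rewrite -mulrA in u1 u2; set X := monom t e * _ in u1 u2 * => h.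
  have : j.+1%:Z = 0; last by [].
  apply: h; first by rewrite -[X](mulKf d0); exact: vringM.
  by rewrite -[X^-1](mulVKf d0) -invfM; exact: vringM.
have cP := gauss_compat gPsi MV Mu PM (tt' i0) tM.
exists (adjoin Psi (t i0) (t' i0)); split.
- exact: (adjoin_graph gPsi cP).
- by move=> z /PPsi; exact: (sub_adjoin gPsi cP).
- move=> i; rewrite ltnS leq_eqVlt => /predU1P[e|/tPsi]; last exact: (sub_adjoin gPsi cP).
  have -> : i = i0 by exact: val_inj.
  exact: (adjoin_gen gPsi cP).
- move=> a a' aa a0.
  have [_ [_ [i [j [[d [d' [e [/= Pd d0 e0 -> ->]]]] s1 s2]]]]] :=
    gauss_adjoin gPsi MV Mu PM (tt' i0) tM aa a0.
  exists d, d', (fun l => e l + (if l == i0 then i%:Z else 0) + - (if l == i0 then j%:Z else 0)).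
  split=> //.
  + move=> l nl; rewrite e0 1?ltnW // add0r; case: eqP => [le|]; last by rewrite subr0.
    by move: nl; rewrite le /= ltnn.
  + by rewrite monom_shift // mulrA.
  + by rewrite monom_shift // mulrA.
Qed.
End Iterate.

Definition tset (n : nat) : set F := [set t i | i in [set i : 'I_r | (i < n)%N]].

Lemma tset_range : tset r = range t.
Proof. by apply/seteqP; split=> [_ [i _ <-]|_ [i _ <-]]; exists i => //=. Qed.

Section Constants.
Variable D : set F.
Hypotheses (sD : subfield D) (kD : range iota `<=` D) (DO : D `<=` O).

Lemma gauss_gen n y : (n <= r)%N -> gen_subfield (D `|` tset n) y -> y != 0 ->
  exists d e, [/\ D d, d != 0, forall i : 'I_r, (n <= i)%N -> e i = 0
    & sim y (d * monom t e)].
Proof.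
move=> nr Dy y0; pose idD := gres (1%g : Gal iota) D.
have dD : dom idD = D by exact: dom_gres.
have cD : cod idD = D.
  by rewrite /idD cod_gres; apply/seteqP; split=> [_ [x Kx <-]//|x Kx]; exists x.
have [||||Psi [gPsi PPsi tPsi mPsi]] := @gauss_iter idD _ _ _ t _ n nr.
- exact: gres_graph.
- by rewrite dD.
- by rewrite cD.
- by move=> i; exact: unit_ratio_refl.
have [y' yy] : dom Psi y.
  move: Dy; apply: smallest_sub; first exact: (dom_subfield gPsi).
  move=> z [Dz|[i ni <-]]; last by exists (t i); exact: tPsi.
  by exists z; apply: PPsi; split.
have [d [d' [e [[/= Dd _] d0 e0 s1 _]]]] := mPsi _ _ yy y0.
by exists d, e.
Qed.

Lemma unit_const d : D d -> d != 0 -> O d /\ O d^-1.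
Proof. by move=> Dd d0; split; apply: DO => //; exact: (sfV sD). Qed.

(** In an algebraic relation two terms must share the least value. By [gauss_gen] the quotient of
    their coefficients is, up to a unit, a monomial in the earlier t_i; times a nonzero power of
    t_i0 it would be a unit, against [t_val]. *)
Lemma tset_indep (i0 : 'I_r) : ~ acl (D `|` tset i0) (t i0).
Proof.
move=> /(@acl_sub_alg _ _ _ _ (gen_subfield (D `|` tset i0)) (gen_subfieldP _)).
set E := gen_subfield _ => alg.
have sE : subfield E := gen_subfieldP _.
have : algebraic_over E (t i0).
  apply: alg; first by move=> x kx; apply: sub_gen_smallest; left; exact: kD.
  exact: sub_gen_smallest.
move=> /(algebraic_overP _ (sf0 sE))[p [p0 Ep pt]].
pose a i := p`_i * t i0 ^+ i.
pose q := \poly_(i < size p) a i.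
have qE i : q`_i = a i.
  rewrite coef_poly; case: ltnP => // /(nth_default 0) e; by rewrite /a e mul0r.
have q0 : q != 0.
  apply/eqP => q0; move/negP: p0; apply; apply/eqP/polyP => i.
  have := qE i; rewrite q0 !coef0 /a => /esym/eqP.
  by rewrite mulf_eq0 expf_eq0 (negPf (t0 _)) andbF orbF => /eqP.
have [i [ai0 iP]] := vring_normalize v q0.
have sum0 : \sum_(j < size p) q`_j = 0.
  by rewrite -[RHS]pt horner_coef; apply: eq_bigr => j _; rewrite qE.
have ip : (i < size p)%N.
  by rewrite ltnNge; apply: contra ai0 => le; rewrite nth_default // (leq_trans (size_poly _ _)).
have [j [jp ji nm]] : exists j, [/\ (j < size p)%N, j != i & ~ m (q`_j / q`_i)].
  apply: contrapT => no; apply: (@vmax1 _ _ _ v).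
  have -> : 1 = - \sum_(j < size p | j != Ordinal ip) q`_j / q`_i.
    apply/eqP; rewrite -addr_eq0 -(divff ai0) -mulr_suml -mulrDl.
    by move: sum0; rewrite (bigD1 (Ordinal ip)) //= => ->; rewrite mul0r.
  apply/vmaxN/vmax_sum => j ji; apply: contrapT => nm; apply: no; exists j; split=> //.
have [aj0 aV] := nvmax nm.
have {aj0} aj0 : q`_j != 0 by apply: contraNneq aj0 => ->; rewrite mul0r.
have pnz l : q`_l != 0 -> p`_l != 0.
  by rewrite qE /a; apply: contraNneq => ->; rewrite mul0r.
(* The roles of the two terms of least value are symmetric; the order makes N a positive
   exponent. *)
wlog ltji : i j ip jp ji ai0 aj0 iP nm aV {sum0} / (j < i)%N => [wl|].
  have : (j < i)%N || (i < j)%N by rewrite -neq_ltn.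
  case/orP => [ltji|ltij]; first exact: (wl i j).
  have e : q`_i / q`_j = (q`_j / q`_i)^-1 by rewrite invf_div.
  apply: (wl j i) => //; rewrite 1?eq_sym // ?e ?invrK //; try exact: iP.
  - move=> l; have -> : q`_l / q`_j = q`_l / q`_i * (q`_i / q`_j) by rewrite mulrA divfK.
    by apply: vringM; rewrite ?e.
  - by apply: vmaxNunit; rewrite ?invr_eq0 ?mulf_neq0 ?invr_eq0 // invrK; exact: iP.
pose N := (i - j)%N.
have [||d [e [Dd d0 e0 sy]]] := @gauss_gen i0 (p`_i / p`_j) (ltnW (ltn_ord i0)).
- by apply: (sf_div sE); exact: Ep.
- by rewrite mulf_neq0 ?invr_eq0 ?pnz.
have E0 : p`_i / p`_j * t i0 ^+ N = q`_i / q`_j.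
  have -> : t i0 ^+ N = t i0 ^+ i / t i0 ^+ j.
    by rewrite /N expfB // ltnW.
  by rewrite !qE /a mulf_div.
have [vd vdV] := unit_const Dd d0.
have [d10 _ u1 u2] := vsim_unit sy.
have u : ur (q`_i / q`_j) 1.
  split; rewrite ?oner_neq0 ?mulf_neq0 ?invr_eq0 // ?divr1 ?div1r ?invf_div //.
  by have := aV; rewrite invf_div.
have uX : ur (d * monom t e * t i0 ^+ N) 1.
  apply: unit_ratio_trans u; rewrite -E0; apply: unit_ratioM.
    exact/unit_ratio_sym/vsim_unit.
  by apply: unit_ratio_refl; rewrite expf_neq0.
have uX' : ur (monom t e * t i0 ^+ N) 1.
  have ud : ur d 1 by split; rewrite ?oner_neq0 ?divr1 ?div1r.
  have := unit_ratioM (unit_ratioV ud) uX.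
  by rewrite -[d * _ * _]mulrA mulKf // invr1 mulr1.
have := @t_val (fun l => e l + (if l == i0 then N%:Z else 0)) _ _ i0.
rewrite eqxx e0 // add0r monomD // monom_delta.
have [_ _ + +] := uX'; rewrite divr1 div1r => h1 h2 /(_ h1 h2) [] /eqP.
by rewrite /N subn_eq0 leqNgt ltji.
Qed.

Hypothesis aD : acl D `<=` D.

(** Reduce a normalized equation of c coefficientwise to a polynomial over D. Its value at c lies in
    the maximal ideal, and it splits over D, so c is congruent to one of its roots. *)
Lemma residue_approx c : acl (D `|` range t) c -> O c -> exists2 d, D d & m (c - d).
Proof.
rewrite -tset_range.
move=> /(@acl_sub_alg _ _ _ _ (gen_subfield (D `|` tset r)) (gen_subfieldP _)).
set E := gen_subfield _ => alg vc.
have sE : subfield E := gen_subfieldP _.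
have : algebraic_over E c.
  apply: alg; first by move=> x kx; apply: sub_gen_smallest; left; exact: kD.
  exact: sub_gen_smallest.
move=> /(algebraic_overP _ (sf0 sE))[p0 [p00 Ep0 p0c]].
have [i0 [pi0 i0P]] := vring_normalize v p00.
pose p := (p0`_i0)^-1 *: p0.
have Ep i : E p`_i by rewrite coefZ; apply: (sfM sE) => //; exact: (sfV sE).
have Op i : O p`_i by rewrite coefZ mulrC.
have pc : p.[c] = 0 by rewrite hornerZ p0c mulr0.
have approx y : E y -> O y -> exists d, D d /\ m (y - d).
  move=> Ey vy; have [->|y0] := eqVneq y 0.
    by exists 0; split; [exact: (sf0 sD)|rewrite subr0; exact: vmax0].
  have [d [e [Dd d0 _ sy]]] := gauss_gen (leqnn r) Ey y0.
  have [vd vdV] := unit_const Dd d0.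
  have [_ _ u1 u2] := vsim_unit sy.
  have vde : O (d * monom t e) by apply/(vsim_vring sy).
  (* A unit monomial has all exponents zero, so y is congruent to d; otherwise y itself lies in the
     maximal ideal and 0 approximates it. *)
  have [[e0 eO]|ne] := pselect (monom t e != 0 /\ O (monom t e)^-1).
    have vme : O (monom t e) by rewrite -[monom t e](mulKf d0); exact: vringM.
    have ez := t_val vme eO.
    have e1 : monom t e = 1 by rewrite -(monom0 t); apply: eq_bigr => i _; rewrite ez.
    exists d; split=> //; have [_ +] := sy; rewrite e1 mulr1 => /(vmaxM vd).
    by rewrite mulrBr mulr1 mulrCA divff // mulr1.
  exists 0; split; first exact: (sf0 sD).
  rewrite subr0; apply: (unit_ratio_vmax (unit_ratio_sym (vsim_unit sy))).
  apply: vmaxM => //; apply: contrapT => /nvmax nm; exact: ne.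
have /choice[f fP] : forall i, exists d, D d /\ m (p`_i - d).
  by move=> i; exact: approx.
pose q := \poly_(i < size p) f i.
have qP i : D q`_i /\ m (p`_i - q`_i).
  rewrite coef_poly; case: ltnP => [_|/(nth_default 0) ->]; first exact: fP.
  by split; [exact: (sf0 sD)|rewrite subr0; exact: vmax0].
(* The coefficient of index i0 is congruent to 1. *)
have q0 : q != 0.
  apply/eqP => q0; apply: (@vmax1 _ _ _ v); have [_] := qP i0.
  by rewrite q0 coef0 subr0 coefZ mulVf.
have mq : m q.[c].
  rewrite -[q](subrK p) hornerD pc addr0; apply: vmax_horner => // i.
  by rewrite coefB -opprB; apply: vmaxN; have [] := qP i.
have [s sE'] := closed_field_poly_normal q.
have l0 : lead_coef q != 0 by rewrite lead_coef_eq0.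
have Dl : D (lead_coef q) by exact: (qP _).1.
have Ds d : d \in s -> D d.
  move=> ds; apply: aD; apply: (acl_root q0) => [i|].
    by apply: sub_acl; exact: (qP i).1.
  by rewrite sE' hornerZ (rootP _) ?mulr0 // root_prod_XsubC.
have [vl vlV] := unit_const Dl l0.
have : m (\prod_(y <- [seq c - d | d <- s]) y).
  move: mq; rewrite sE' hornerZ => /vmax_cancel h; rewrite big_map.
  have -> : \prod_(d <- s) (c - d) = (\prod_(d <- s) ('X - d%:P)).[c].
    by rewrite horner_prod; apply: eq_bigr => d _; rewrite hornerXsubC.
  by apply: h; exact: vmaxNunit.
case/vmax_prod => [_ /mapP[d ds ->]|_ /mapP[d ds ->] mcd].
  by apply: vringB => //; exact/DO/Ds.
by exists d => //; exact: Ds.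
Qed.

End Constants.

(** Both rho and multiplication of the t_i by units of C preserve the values of constants times
    monomials, hence by Gauss' lemma of all elements of C(t); conjugacy then extends the map to F,
    which is algebraic over C(t). *)
Lemma decomp_extend (C : set F) (rho : set (F * F)) (u : 'I_r -> F) :
  injective (fun n : nat => n%:R : k) -> C `<=` O ->
  (forall x, acl (C `|` range t) x) -> graph iota rho -> dom rho = C -> cod rho = C ->
  (forall i, C (u i) /\ u i != 0) ->
  exists g : Gal iota, [/\ stab_v v g, forall a b, rho (a, b) -> g a = b
    & forall i, g (t i) = u i * t i].
Proof.
move=> k_inj CO CT gr dr cr uP.
have sC : subfield C by rewrite -dr; exact: (dom_subfield gr).
have uO i : O (u i) /\ O (u i)^-1 by have [Cu u0] := uP i; exact: (unit_const sC CO Cu u0).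
pose t' i := u i * t i.
have tt' i : ur (t i) (t' i).
  have [[vu vuV] [_ u0]] := (uO i, uP i).
  by split; rewrite ?mulf_neq0 // /t' ?mulfK // invfM mulrCA divff // mulr1.
have [||R [gR rR tR mR]] := @gauss_iter rho gr _ _ t' tt' r (leqnn r).
- by rewrite dr.
- by rewrite cr.
have vR : valued v R.
  split=> // a a' aa; have [a0|a0] := eqVneq a 0.
    have -> : a' = 0 by apply/eqP; rewrite -(rg_eq0 gR.1 aa) a0.
    by rewrite a0.
  have [d [d' [e [rd d0 _ s1 s2]]]] := mR _ _ aa a0.
  have d0' : d' != 0 by rewrite -(rg_eq0 gr.1 rd).
  have Cd : C d by rewrite -dr; exists d'.
  have Cd' : C d' by rewrite -cr; exists d.
  have [[vd vdV] [vd' vdV']] := (unit_const sC CO Cd d0, unit_const sC CO Cd' d0').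
  have urm : ur (d * monom t e) (d' * monom t' e).
    apply: unit_ratioM; last exact: unit_ratio_monom.
    by split=> //; exact: vringM.
  rewrite (vsim_vring s1) (vsim_vring s2); split; apply: unit_ratio_vring => //.
  exact: unit_ratio_sym.
have [x|x|g gv gR'] := valued_extend k_inj vR.
- apply: acl_mono (CT x) => z [|[i _ <-]].
    by rewrite -dr => -[z' zz]; exists z'; exact: rR.
  by exists (t' i); exact: tR.
- apply: acl_le (CT x) => z [|[i _ <-]].
    by rewrite -cr => -[z' zz]; apply: sub_acl; exists z'; exact: rR.
  have sR := @acl_subfield _ _ iota (cod R).
  have [_ u0] := uP i; rewrite -[t i](mulKf u0); apply: (sfM sR).
    apply: (sfV sR); apply: sub_acl; have : C (u i) by have [] := uP i.
    by rewrite -cr => -[w wu]; exists w; exact: rR.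
  by apply: sub_acl; exists (t i); exact: tR.
exists g; split=> // [a b ab|i]; first by apply: gR'; exact: rR.
by apply: gR'; exact: tR.
Qed.

End Gauss.

(** * Linear disjointness and generation of stabilizers *)

Section Generation.
Variables (k : fieldType) (F : closedFieldType) (iota : {rmorphism k -> F}).
Implicit Types (A B C K : set F) (x y : F) (s z : seq F).
Local Notation acl := (acl iota).
Local Notation indep := (indep iota).
Local Notation G := (Gal iota).
Local Notation sfA A := (@acl_subfield _ _ iota A).

Lemma fresh_seq C D s n : C `<=` D ->
  (forall s, [set` s] `<=` D -> exists2 x, C x & ~ acl [set` s] x) -> [set` s] `<=` D ->
  exists z, [/\ size z = n, [set` z] `<=` C & indep [set` s] z].
Proof.
move=> CD room; elim: n s => [|n IH] s sD; first by exists [::].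
have [x Cx nx] := room s sD; have [|z [zn zC zi]] := IH (x :: s).
  by move=> y; rewrite /= inE => /predU1P[->|/sD //]; exact: CD.
exists (x :: z); split; first by rewrite /= zn.
  by move=> y; rewrite /= inE => /predU1P[->|/zC].
split=> //; apply: indep_sub zi => y /= [ys|->]; rewrite inE ?eqxx //.
by rewrite ys orbT.
Qed.

(** The two sequences are exchanged rather than one sent to the other, so that domain and codomain
    generate the same closure. *)
Lemma gal_swap A s1 s2 : size s1 = size s2 -> indep A (s1 ++ s2) ->
  exists2 g : G, gal_fix (acl A) g & map g s1 = s2.
Proof.
move=> es i12; have i21 := indep_catC i12.
have up s : indep A s -> indep (acl A) s by apply: indep_acl; exact: acl_acl.
have [||||||g gA e] := @gal_extend_id _ _ iota (acl A) (s1 ++ s2) (s2 ++ s1) (sfA A).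
- exact: acl_range.
- by rewrite !size_cat addnC.
- exact: up.
- exact: up.
- by move=> x xs; apply: sub_acl; right; move: xs; rewrite /= !mem_cat orbC.
- by move=> x xs; apply: sub_acl; right; move: xs; rewrite /= !mem_cat orbC.
move/eqP: e; rewrite map_cat eqseq_cat ?size_map // => /andP[/eqP e _].
by exists g.
Qed.

Lemma gal_fix_acl (g : G) A B x : (forall a, A a -> acl B (g a)) -> acl A x -> acl B (g x).
Proof.
move=> AB Ax; apply: acl_le (gal_alg g Ax) => _ [a Aa <-]; exact: AB.
Qed.

Lemma gal_indep (g : G) A B s : (forall a, acl A (g a) -> acl B a) -> indep B s -> indep A (map g s).
Proof.
elim: s A B => //= x s IH A B AB [Bx Bs]; split; first by move/AB.
apply: IH Bs => a; rewrite -{2}[a](galKV g) => Aa.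
apply: gal_fix_acl Aa => y [Ay|->]; last by rewrite galKV; apply: sub_acl; right.
apply: (@acl_mono _ _ _ B) => [t|]; first by left.
by apply: AB; rewrite galVK; exact: sub_acl.
Qed.

Section LinearDisjointness.
Hypothesis room : forall s, exists x, ~ acl [set` s] x.

Lemma fresh s n : exists z, size z = n /\ indep [set` s] z.
Proof.
have [||z [zn _ zi]] // := @fresh_seq setT setT s n (fun _ => id); last by exists z.
by move=> s' _; have [x nx] := room s'; exists x.
Qed.

Variables (sK sl : seq F).
Local Notation K := [set` sK].
Local Notation L := [set` sl].
Hypothesis KL : K `<=` acl L.

Definition lin_indep n (l : 'I_n -> F) : Prop :=
  forall a : 'I_n -> F, (forall i, acl K (a i)) -> \sum_i a i * l i = 0 ->
  forall i, a i = 0.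

(* An automorphism over L carrying z to an independent copy changes none of the
   coefficients of a shortest relation; so these are constants. *)
Lemma lin_disjoint n (l c : 'I_n -> F) z : (forall i, acl L (l i)) -> indep L z ->
  (forall i, acl (K `|` [set` z]) (c i)) -> lin_indep l ->
  \sum_i c i * l i = 0 -> forall i, c i = 0.
Proof.
elim: n l c z => [|n IH] l c z lL zi cz li e; first by case.
have li' : lin_indep (fun i => l (lift ord0 i)).
  move=> a aK ea i; pose a' j := if unlift ord0 j is Some i then a i else 0.
  have := li a' _ _ (lift ord0 i); rewrite /a' liftK; apply.
    by move=> j; case: unlift => [j'|]; [exact: aK|exact: (sf0 (sfA _))].
  by rewrite big_ord_recl unlift_none mul0r add0r -[RHS]ea; apply: eq_bigr => j _; rewrite liftK.
have [c0|c0] := eqVneq (c ord0) 0.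
  move=> i; case: (unliftP ord0 i) => [j ->|-> //].
  apply: (IH (fun i => l (lift ord0 i)) (fun i => c (lift ord0 i)) z) => //.
  by move: e; rewrite big_ord_recl c0 mul0r add0r.
exfalso; have sz := sfA (K `|` [set` z]).
pose d i := c i / c ord0.
have dz i : acl (K `|` [set` z]) (d i) by apply: (sf_div sz).
have ed : \sum_i d i * l i = 0.
  have -> : \sum_i d i * l i = (c ord0)^-1 * \sum_i c i * l i.
    by rewrite mulr_sumr; apply: eq_bigr => i _; rewrite /d mulrAC mulrC.
  by rewrite e mulr0.
have d0 : d ord0 = 1 by rewrite /d divff.
have [z' [zz' zi']] := fresh (sl ++ z) (size z).
have zi2 : indep L (z ++ z').
  apply/indep_cat; split=> //; apply: indep_sub zi' => y.
  by case=> /= ys; rewrite mem_cat ys ?orbT.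
have [h hL hz] := gal_swap (esym zz') zi2.
have hz' x : x \in z -> h x \in z' by move=> xz; rewrite -hz map_f.
have hd i : acl (K `|` [set` z']) (h (d i)).
  apply: gal_fix_acl (dz i) => y [Ky|yz]; last by apply: sub_acl; right; exact: hz'.
  by apply: sub_acl; left; rewrite /= hL //; exact: KL.
have eh : \sum_i h (d i) * l i = 0.
  have := congr1 h ed; rewrite rmorph0 rmorph_sum => e1; rewrite -[RHS]e1; apply: eq_bigr => i _.
  by rewrite [RHS]rmorphM; congr (_ * _); rewrite /= hL.
have same i : h (d i) = d i.
  case: (unliftP ord0 i) => [j ->|->]; last by rewrite d0 rmorph1.
  apply/eqP; rewrite -subr_eq0; apply/eqP.
  apply: (IH (fun i => l (lift ord0 i))
    (fun j => h (d (lift ord0 j)) - d (lift ord0 j)) (z ++ z')) => // [i'|].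
    apply: (sfB (sfA _)).
      apply: acl_mono (hd _) => y [Ky|yz]; first by left.
      by right; rewrite /= mem_cat yz orbT.
    apply: acl_mono (dz _) => y [Ky|yz]; first by left.
    by right; rewrite /= mem_cat yz.
  have : \sum_i (h (d i) - d i) * l i = 0.
    by under eq_bigr => i' _ do rewrite mulrBl; rewrite sumrB eh ed subrr.
  by rewrite big_ord_recl d0 rmorph1 subrr mul0r add0r.
(* Being fixed by h, [d i] lies in the closures of (K, z) and of (K, z'), which meet in [acl K]
   because z' is independent over K and z. *)
have dK i : acl K (d i).
  apply: (@indep_meet _ _ iota K (K `|` [set` z]) z').
  - by left.
  - apply: indep_acl zi'; apply: acl_le => y [/KL|yz].
      by apply: acl_mono => t ts; rewrite /= mem_cat ts.
    by apply: sub_acl; rewrite /= mem_cat yz orbT.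
  - exact: dz.
  - by rewrite -same; exact: hd.
by have /eqP := li d dK ed ord0; rewrite d0 oner_eq0.
Qed.

(** If the l_i are independent over [acl K], the c_i vanish. Otherwise some l_j is a combination of
    the others over [acl K]; g respects that combination, so l_j can be eliminated from both
    sums. *)
Lemma lin_disjoint_gal n (l c : 'I_n -> F) z (g : G) : (forall i, acl L (l i)) ->
  indep L z -> (forall i, acl (K `|` [set` z]) (c i)) -> gal_fix (acl K) g ->
  \sum_i c i * l i = 0 -> \sum_i c i * g (l i) = 0.
Proof.
move=> + zi + gK; elim: n l c => [|n IH] l c lL cz e; first by rewrite big_ord0.
have [li|nli] := pselect (lin_indep l).
  by rewrite big1 // => i _; rewrite (lin_disjoint lL zi cz li e) mul0r.
have [a [aK ea [j aj]]] : exists a : 'I_n.+1 -> F,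
    [/\ forall i, acl K (a i), \sum_i a i * l i = 0 & exists j, a j != 0].
  apply: contrapT => no; apply: nli => a aK ea i; apply: contrapT => ai.
  by apply: no; exists a; split=> //; exists i; apply/eqP.
pose b i := a (lift j i) / a j.
have bK i : acl K (b i) by apply: (sf_div (sfA K)).
have lj : l j = - \sum_i b i * l (lift j i).
  apply: (mulfI aj); apply/eqP; rewrite mulrN -addr_eq0 mulr_sumr; apply/eqP.
  rewrite -[RHS]ea (bigD1_ord j) //=; congr (_ + _); apply: eq_bigr => i _.
  by rewrite mulrA /b [a j * _]mulrC divfK.
have glj : g (l j) = - \sum_i b i * g (l (lift j i)).
  rewrite lj rmorphN rmorph_sum; congr (- _); apply: eq_bigr => i _.
  by rewrite rmorphM; congr (_ * _); rewrite /= gK.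
have red (m : 'I_n.+1 -> F) : m j = - \sum_i b i * m (lift j i) ->
    \sum_i c i * m i = \sum_i (c (lift j i) - c j * b i) * m (lift j i).
  move=> mj; rewrite (bigD1_ord j) //= mj mulrN mulr_sumr -sumrN -big_split /=.
  by apply: eq_bigr => i _; rewrite mulrBl addrC mulrA.
rewrite red //; apply: (IH (fun i => l (lift j i))) => [i|i|] //.
  apply: (sfB (sfA _)) => //; apply: (sfM (sfA _)) => //.
  by apply: acl_mono (bK i); left.
by rewrite -red.
Qed.

(* R is the ring generated by the graphs of the identity of acl (K, z) and of g on
   acl L; linear disjointness makes it the graph of a well-defined injection. *)
Lemma amalgam z (g : G) : indep L z -> gal_fix (acl K) g -> gal_fix L g ->
  exists2 a : G, gal_fix (acl (K `|` [set` z])) a & forall x, acl L x -> a x = g x.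
Proof.
move=> zi gK gL.
pose M := acl (K `|` [set` z]).
pose ev (h : F -> F) (s : seq (F * F)) : F := \sum_(p <- s) p.1 * h p.2.
pose ok (s : seq (F * F)) := forall p, p \in s -> M p.1 /\ acl L p.2.
have sM : subfield M := sfA _; have sL : subfield (acl L) := sfA L.
have gLL (h : G) x : gal_fix L h -> acl L x -> acl L (h x).
  by move=> hL; apply: gal_fix_acl => a La; rewrite hL //; exact: sub_acl.
have evg (h : G) (s : seq (F * F)) : gal_fix (acl K) h ->
    ok s -> ev id s = 0 -> ev h s = 0.
  move=> hK oks; rewrite /ev !(big_nth (0, 0)) !big_mkord => e.
  apply: (@lin_disjoint_gal _ (fun i : 'I_(size s) => (nth (0, 0) s i).2)
    (fun i : 'I_(size s) => (nth (0, 0) s i).1) z h) => // i.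
    by have [] := oks _ (mem_nth (0, 0) (ltn_ord i)).
  by have [] := oks _ (mem_nth (0, 0) (ltn_ord i)).
pose R := [set w : F * F | exists s : seq (F * F), [/\ ok s, w.1 = ev id s & w.2 = ev g s]].
have okM c : M c -> R (c, c).
  move=> Mc; exists [:: (c, 1)]; split; rewrite /ev ?big_seq1 /= ?rmorph1 ?mulr1 //.
  by move=> p; rewrite inE => /eqP -> /=; split=> //; exact: (sf1 sL).
have okL x : acl L x -> R (x, g x).
  move=> Lx; exists [:: (1, x)]; split; rewrite /ev ?big_seq1 /= ?mul1r //.
  by move=> p; rewrite inE => /eqP -> /=; split=> //; exact: (sf1 sM).
have okcat (s1 s2 : seq (F * F)) : ok s1 -> ok s2 -> ok (s1 ++ s2).
  by move=> o1 o2 p; rewrite mem_cat => /orP[/o1|/o2].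
have gVK : gal_fix (acl K) (g^-1)%g by move=> x Kx; rewrite -{1}(gK x Kx) galKV.
have gVL : gal_fix L (g^-1)%g by move=> x Kx; rewrite -{1}(gL x Kx) galKV.
have rR : ring_graph iota R.
  split.
  - by move=> c; apply: okM; exact: acl_const.
  - move=> _ _ _ _ [s1 [/= o1 -> ->]] [s2 [/= o2 -> ->]].
    exists (s1 ++ [seq (- p.1, p.2) | p <- s2]); split=> /=.
    + apply: okcat => // _ /mapP[p /o2[? ?] ->]; split=> //=; exact: (sfN sM).
    + rewrite /ev big_cat big_map /= -sumrN; congr (_ + _).
      by apply: eq_bigr => p _; rewrite mulNr.
    + rewrite /ev big_cat big_map /= -sumrN; congr (_ + _).
      by apply: eq_bigr => p _; rewrite mulNr.
  - move=> _ _ _ _ [s1 [/= o1 -> ->]] [s2 [/= o2 -> ->]].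
    exists [seq (p.1 * q.1, p.2 * q.2) | p <- s1, q <- s2]; split=> /=.
    + move=> _ /allpairsP[[p q] /= [/o1[? ?] /o2[? ?] ->]].
      by split=> /=; [exact: (sfM sM)|exact: (sfM sL)].
    + rewrite /ev big_allpairs_dep mulr_suml; apply: eq_bigr => p _.
      by rewrite mulr_sumr; apply: eq_bigr => q _; rewrite mulrACA.
    + rewrite /ev big_allpairs_dep mulr_suml; apply: eq_bigr => p _.
      by rewrite mulr_sumr; apply: eq_bigr => q _; rewrite /= rmorphM mulrACA.
  - move=> _ _ [s [/= os -> ->]]; split; first exact: evg.
    move=> e; have := evg (g^-1)%g [seq (p.1, g p.2) | p <- s] gVK.
    rewrite /ev !big_map /= => h; have : \sum_(p <- s) p.1 * gal_fun (g^-1)%g (g p.2) = 0.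
      by apply: h => // _ /mapP[p /os[? ?] ->] /=; split=> //; exact: gLL.
    by move=> e2; rewrite -[RHS]e2; apply: eq_bigr => p _; rewrite galKV.
pose Phi := gfrac R.
have gPhi : graph iota Phi := frac_graph rR.
have sub : R `<=` Phi := sub_frac rR.
have inM x : M x -> acl (M `|` acl L) x by move=> Mx; apply: sub_acl; left.
have inL x : acl L x -> acl (M `|` acl L) x by move=> Mx; apply: sub_acl; right.
have ML (h : F -> F) (s : seq (F * F)) : (forall x, acl L x -> acl L (h x)) -> ok s ->
    acl (M `|` acl L) (ev h s).
  move=> hL os; rewrite /ev big_seq; apply: (sf_sum (sfA _)) => p /os[Mp Lp].
  by apply: (sfM (sfA _)); [exact: inM|exact/inL/hL].
have dP : M `|` acl L `<=` dom Phi.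
  by move=> x [Mx|Lx]; [exists x; exact/sub/okM|exists (g x); exact/sub/okL].
have cP : M `|` acl L `<=` cod Phi.
  move=> x [Mx|Lx]; first by exists x; exact/sub/okM.
  exists (gal_fun (g^-1)%g x); apply: sub; rewrite -{2}[x](galVK g); apply: okL.
  exact: gLL.
have bP : balanced iota setT Phi.
  split=> //.
  - move=> a [b [x1 [x2 [y1 [y2 [[s [/= os -> _]] [s' [/= os' -> _]] _ /= -> _]]]]]].
    by apply: (acl_mono cP); apply: (sf_div (sfA _)); exact: ML.
  - move=> a [b [x1 [x2 [y1 [y2 [[s [/= os _ ->]] [s' [/= os' _ ->]] _ /= _ ->]]]]]].
    apply: (acl_mono dP); apply: (sf_div (sfA _)); apply: ML => // x; exact: gLL.
have [|R' [gR' sR' dR' cR']] := balanced_total _ bP; first by [].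
have [a aP] := gal_of_graph gR' dR' cR'.
exists a; first by move=> x Mx; apply/aP/sR'/sub/okM.
by move=> x Lx; apply/aP/sR'/sub/okL.
Qed.

End LinearDisjointness.
End Generation.

(** * Subgroups generated by stabilizers, and finite supports *)

Section Subgroups.
Variables (k : fieldType) (F : closedFieldType) (iota : {rmorphism k -> F}).
Implicit Types (A B C K : set F) (x y : F) (s z : seq F).
Local Notation acl := (acl iota).
Local Notation indep := (indep iota).
Local Notation G := (Gal iota).
Local Notation sfA A := (@acl_subfield _ _ iota A).
Hypothesis room : forall s, exists x, ~ acl [set` s] x.

Lemma gal_fixV A (g : G) : gal_fix A g -> gal_fix A (g^-1)%g.
Proof. by move=> gA x Ax; rewrite -{1}(gA x Ax) galKV. Qed.
Lemma gal_fixM A (g h : G) : gal_fix A g -> gal_fix A h -> gal_fix A (g * h)%g.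
Proof. by move=> gA hA x Ax; rewrite galM hA // gA. Qed.
Lemma gal_fix_sub A B (g : G) : A `<=` B -> gal_fix B g -> gal_fix A g.
Proof. by move=> AB gB x /AB; exact: gB. Qed.

Definition mulseq (x z : seq F) : seq F := [seq p.1 * p.2 | p <- zip x z].

Lemma size_mulseq (x z : seq F) : size x = size z -> size (mulseq x z) = size z.
Proof. by move=> e; rewrite size_map size_zip e minnn. Qed.

Lemma mulseqC (x z : seq F) : mulseq x z = mulseq z x.
Proof. by elim: x z => [|a x IH] [|b z] //=; rewrite /mulseq /= mulrC; congr cons; exact: IH. Qed.

Lemma indep_mulseq A (x z : seq F) : size x = size z ->
  (forall y, y \in x -> acl A y /\ y != 0) -> indep A z ->
  [/\ indep A (mulseq x z), [set` z] `<=` acl (A `|` [set` mulseq x z])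
    & [set` mulseq x z] `<=` acl (A `|` [set` z])].
Proof.
elim: x z A => [|a x IH] [|b z] A //= [e] xA [Ab Az].
have [Aa a0] := xA a (mem_head _ _).
have [|i1 i2 i3] := IH z (A `|` [set b]) e _ Az.
  move=> y yx; have [|Ay y0] := xA y; first by rewrite inE yx orbT.
  by split=> //; apply: acl_mono Ay; left.
have Aab : acl (A `|` [set b]) `<=` acl (A `|` [set a * b]).
  have S := sfA (A `|` [set a * b]).
  apply: acl_le => y [Ay|->]; first by apply: sub_acl; left.
  suff : acl (A `|` [set a * b]) (a^-1 * (a * b)) by rewrite mulKf.
  apply: (sfM S); last by apply: sub_acl; right.
  by apply: (sfV S); apply: acl_mono Aa; left.
have Aba : acl (A `|` [set a * b]) `<=` acl (A `|` [set b]).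
  have S := sfA (A `|` [set b]).
  apply: acl_le => y [Ay|->]; first by apply: sub_acl; left.
  apply: (sfM S); last by apply: sub_acl; right.
  by apply: acl_mono Aa; left.
split; rewrite /mulseq /= ?setU_cons.
- split; last exact: indep_acl i1.
  move=> Aab'; apply: Ab; rewrite -[b](mulKf a0).
  by apply: (sfM (sfA A)) => //; exact: (sfV (sfA A)).
- move=> y; rewrite /= inE => /predU1P[->|/i2].
    by apply: acl_mono (Aab b _) => [t|]; [left|apply: sub_acl; right].
  apply: acl_le => t [tb|tm]; last by apply: sub_acl; right.
  by apply: acl_mono (Aab t _) => [t'|]; [left|exact: sub_acl].
- move=> y; rewrite /= inE => /predU1P[->|/i3].
    by apply: acl_mono (Aba (a * b) _) => [t|]; [left|apply: sub_acl; right].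
  exact: acl_mono.
Qed.

Lemma indep_neq0 A s x : indep A s -> x \in s -> x != 0.
Proof.
move=> si xs; apply/eqP => x0; apply: (indep_notin si _ xs (B := A)); first exact: sub_acl.
by rewrite x0; exact: (sf0 (sfA A)).
Qed.

Lemma indep_mul_cat A (x z : seq F) : size x = size z -> indep A (z ++ x) -> indep A (z ++ mulseq x z).
Proof.
move=> e /indep_cat[zi xi]; apply/indep_cat; split=> //; rewrite mulseqC.
have zA y : y \in z -> acl (A `|` [set` z]) y /\ y != 0; last first.
  by have [] := indep_mulseq (esym e) zA xi.
move=> yz; split; last exact: indep_neq0 zi yz.
by apply: sub_acl; right.
Qed.

Variable H : set G.
Hypotheses (HM : forall g h : G, H g -> H h -> H (g * h)%g)
  (HV : forall g : G, H g -> H (g^-1)%g).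

Lemma conj_fix (h : G) A B : H h -> (forall x, A x -> B (h x)) ->
  (gal_fix A : set G) `<=` H -> (gal_fix B : set G) `<=` H.
Proof.
move=> Hh hAB AH a aB.
have -> : a = (h * (h^-1 * a * h) * h^-1)%g by apply: gal_ext => x; rewrite !galM !galVK.
apply: HM; last exact: HV; apply: HM => //; apply: AH => x Ax.
by rewrite !galM aB ?galKV //; exact: hAB.
Qed.

Lemma image_cat (h : G) A s s' : gal_fix A h -> map h s = s' ->
  forall x, acl (A `|` [set` s]) x -> acl (A `|` [set` s']) (h x).
Proof.
move=> hA <- x; apply: gal_fix_acl => a [Aa|/= ys]; apply: sub_acl.
  by left; rewrite hA.
by right; exact: map_f.
Qed.

(* Given g over K, move z1 to a copy z2 independent of everything: H then contains
   the automorphisms over acl (K, z2), and after composing g with two of them it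
   fixes z, so that it agrees on acl (K, z) with an automorphism over acl (K, z2). *)
Lemma fix_generated (sK z z1 : seq F) : let K := [set` sK] in
  indep K (z ++ z1) -> (gal_fix (acl (K `|` [set` z])) : set G) `<=` H ->
  (gal_fix (acl (K `|` [set` z1])) : set G) `<=` H -> (gal_fix (acl K) : set G) `<=` H.
Proof.
move=> K zz1 Hz Hz1 g gK; have /indep_cat[zi z1i] := zz1.
pose y := map g z.
have [z2 [z2n z2i]] := fresh room (sK ++ z ++ z1 ++ y) (size z1).
have insub A s s' : A `<=` [set` s] -> {subset s <= s'} -> A `<=` [set` s'].
  by move=> As ss x /As /=; exact: ss.
have z2iz : indep (K `|` [set` z]) z2.
  by apply: indep_sub z2i => x [] /= xs; rewrite !mem_cat xs ?orbT.
have z2iy : indep (K `|` [set` y]) z2.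
  by apply: indep_sub z2i => x [] /= xs; rewrite !mem_cat xs ?orbT.
have yi : indep K y.
  apply: gal_indep zi => a /(gal_fix_acl (g := (g^-1)%g) (B := K)); rewrite galKV; apply.
  by move=> b Kb; rewrite (gal_fixV gK) //; exact: sub_acl.
have Hz2 : (gal_fix (acl (K `|` [set` z2])) : set G) `<=` H.
  have [|h hK hz] := @gal_swap _ _ iota (K `|` [set` z]) z1 z2 (esym z2n).
    apply/indep_cat; split=> //.
    by apply: indep_sub z2i => x [[|]|] /= xs; rewrite !mem_cat xs ?orbT.
  apply: (conj_fix (h := h)) Hz1; first exact: Hz.
  apply: image_cat hz => x Kx; apply: hK; apply: sub_acl; by left.
have zi2 : indep (K `|` [set` z2]) z.
  by have /indep_catC/indep_cat[] : indep K (z ++ z2) by apply/indep_cat.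
have yi2 : indep (K `|` [set` z2]) y.
  by have /indep_catC/indep_cat[] : indep K (y ++ z2) by apply/indep_cat.
have [z3 [z3n z3i]] := fresh room (sK ++ z ++ y ++ z2) (size z).
(* The sequences z and g z need not be independent of each other, so neither is moved to the other
   directly: both are exchanged over z2 with a third copy z3. *)
have [|th thK thz] := @gal_swap _ _ iota (K `|` [set` z2]) z z3 (esym z3n).
  apply/indep_cat; split=> //.
  by apply: indep_sub z3i => x [[|]|] /= xs; rewrite !mem_cat xs ?orbT.
have [||b bK bz] := @gal_swap _ _ iota (K `|` [set` z2]) y z3.
- by rewrite size_map.
- apply/indep_cat; split=> //.
  by apply: indep_sub z3i => x [[|]|] /= xs; rewrite !mem_cat xs ?orbT.
have KK2 : acl K `<=` acl (K `|` [set` z2]) by apply: acl_mono; left.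
pose e := (th^-1 * (b * g))%g.
have eK : gal_fix (acl K) e.
  apply: gal_fixM; first exact: gal_fixV (gal_fix_sub KK2 thK).
  exact: gal_fixM (gal_fix_sub KK2 bK) gK.
have ez : gal_fix [set` z] e.
  move=> x /= xz; have iz : (index x z < size z)%N by rewrite index_mem.
  have e1 : b (g x) = th x.
    rewrite -[x in LHS](nth_index 0 xz) -[x in RHS](nth_index 0 xz).
    rewrite -(nth_map 0 0 g) // -(nth_map 0 0 b) ?size_map // -(nth_map 0 0 th) //.
    by rewrite -/y bz thz.
  by rewrite /e !galM e1 galKV.
have [||||a aM aL] := @amalgam _ _ iota room sK (sK ++ z) _ z2 e.
- by move=> x xK; apply: sub_acl; rewrite /= mem_cat xK.
- by apply: indep_sub z2iz => x /=; rewrite mem_cat => /orP[]; [left|right].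
- exact: eK.
- by move=> x /=; rewrite mem_cat => /orP[xK|/ez //]; apply: eK; exact: sub_acl.
have He : H e.
  have -> : e = (a * (a^-1 * e))%g by apply: gal_ext => x; rewrite !galM galVK.
  apply: HM; first exact: Hz2.
  apply: Hz => x zx; rewrite galM -aL ?galKV //.
  by apply: acl_mono zx => t [] /= ts; rewrite mem_cat ts ?orbT.
have -> : g = (b^-1 * (th * e))%g.
  by apply: gal_ext => x; rewrite /e !galM galVK galKV.
by apply: HM; [apply: HV; exact: Hz2|apply: HM => //; exact: Hz2].
Qed.

Lemma support_split K (S : seq F) : exists sK z : seq F, [/\ [set` sK] `<=` K, indep K z &
  [set` S] `<=` acl ([set` sK] `|` [set` z])].
Proof.
elim: S => [|x S [sK [z [sKK zi Sz]]]]; first by exists [::], [::].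
have [xz|nxz] := pselect (acl (K `|` [set` z]) x); last first.
  exists sK, (rcons z x); split=> //.
    by rewrite -cats1; apply/indep_cat.
  move=> y; rewrite /= inE => /predU1P[->|/Sz].
    by apply: sub_acl; right; rewrite /= mem_rcons mem_head.
  apply: acl_mono => t [tK|tz]; first by left.
  by right; rewrite /= mem_rcons inE tz orbT.
have [s [sKz xs]] := acl_finite xz.
exists (sK ++ [seq y <- s | `[< K y >]]), z; split=> //.
  move=> y /=; rewrite mem_cat => /orP[/sKK //|].
  by rewrite mem_filter => /andP[/asboolP].
move=> y; rewrite /= inE => /predU1P[->|/Sz].
  apply: acl_mono xs => t /= ts; have [Kt|tz] := sKz _ ts; last by right.
  by left; rewrite /= mem_cat mem_filter ts asboolT ?orbT.
by apply: acl_mono => t [tK|tz]; [left; rewrite /= mem_cat tK|right].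
Qed.

(* The support acl (sK, z), with z independent over K, is moved by an automorphism
   over K to acl (sK, c z) with c fresh elements of K. *)
Lemma finite_support K (S : seq F) : acl K `<=` K -> (gal_fix K : set G) `<=` H ->
  (gal_fix [set` S] : set G) `<=` H ->
  exists B : seq F, [set` B] `<=` K /\ (gal_fix (acl [set` B]) : set G) `<=` H.
Proof.
move=> KK HK HS; have [[s [sK Ks]]|inf] := pselect (exists s : seq F, [set` s] `<=` K /\ K `<=` acl [set` s]).
  by exists s; split=> // g gs; apply: HK; exact: gal_fix_sub gs.
have roomK s : [set` s] `<=` K -> exists2 x, K x & ~ acl [set` s] x.
  move=> sK; apply: contrapT => no; apply: inf; exists s; split=> // x Kx.
  by apply: contrapT => nx; apply: no; exists x.
have [sK [z [sKK zi Sz]]] := support_split K S.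
have [c [cz cK ci]] := fresh_seq (size z) (fun _ => id) roomK sKK.
have K1 : subfield K.
  have -> : K = acl K by apply/seteqP; split=> //; exact: sub_acl.
  exact: acl_subfield.
have kK : range iota `<=` K by move=> x kx; apply: KK; exact: acl_range.
have cc y : y \in c -> acl K y /\ y != 0.
  by move=> yc; split; [apply: sub_acl; exact: cK|exact: indep_neq0 ci yc].
have [mi zm mz] := indep_mulseq cz cc zi.
have [|h hK hz] := gal_extend_id K1 kK _ zi mi zm mz; first by rewrite size_mulseq.
exists sK; split=> //; apply: (@fix_generated sK z (mulseq c z)).
- apply: indep_mul_cat => //; apply/indep_catC/indep_cat; split=> //.
  by apply: indep_sub zi => x [/sKK|/cK].
- by apply: subset_trans HS => g gz x xS; apply: gz; exact: Sz.
- apply: (@conj_fix h (acl ([set` sK] `|` [set` z]))); first exact: HK.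
    by apply: image_cat hz => x xK; apply: hK; exact: sKK.
  by apply: subset_trans HS => g gz x xS; apply: gz; exact: Sz.
Qed.

End Subgroups.

(** * Coefficient fields *)

Section CoefficientFields.
Variables (k : fieldType) (F : closedFieldType) (iota : {rmorphism k -> F}).
Variable v : valuation_ring iota.
Implicit Types (A B C D : set F) (x y : F) (s z : seq F).
Local Notation acl := (acl iota).
Local Notation indep := (indep iota).
Local Notation G := (Gal iota).
Local Notation O := (vring v).
Local Notation m := (vmax v).
Local Notation sfA A := (@acl_subfield _ _ iota A).
Variables (r : nat) (t : 'I_r -> F).
Hypothesis t0 : forall i, t i != 0.
Hypothesis t_val : forall e, O (monom t e) -> O (monom t e)^-1 -> forall i, e i = 0.
Hypothesis room : forall s, exists x, ~ acl [set` s] x.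

(** If x were not integral, dividing its equation by the top power of x would express the leading
    coefficient, a unit because its inverse is also in E, through multiples of 1/x, which lies in
    the maximal ideal. *)
Lemma algebraic_vring (E : set F) x : subfield E -> E `<=` O -> algebraic_over E x -> O x.
Proof.
move=> sE EO /(algebraic_overP _ (sf0 sE))[p [p0 Ep px]]; apply: contrapT => /nvring[x0 mx].
have l0 : lead_coef p != 0 by rewrite lead_coef_eq0.
apply: (vmaxNunit l0 (v := v)); first exact/EO/(sfV sE)/Ep.
have sp : size p = (size p).-1.+1 by rewrite prednK ?size_poly_gt0.
set n := (size p).-1 in sp.
have -> : lead_coef p = - \sum_(j < n) p`_j * x^-1 ^+ (n - j).
  apply: (mulIf (expf_neq0 n x0)); rewrite mulNr mulr_suml.
  have e : lead_coef p * x ^+ n + \sum_(j < n) p`_j * x ^+ j = 0.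
    by rewrite -[RHS]px horner_coef sp big_ord_recr /= addrC.
  move/eqP: e; rewrite addr_eq0 => /eqP ->; congr (- _).
  apply: eq_bigr => j _; rewrite -mulrA; congr (_ * _).
  have -> : x ^+ n = x ^+ (n - j) * x ^+ j by rewrite -exprD subnK // ltnW.
  by rewrite mulrA exprVn mulVf ?mul1r // expf_neq0.
apply/vmaxN/vmax_sum => j _; apply: vmaxM; first exact/EO/Ep.
rewrite -(prednK (_ : 0 < n - j)%N) ?subn_gt0 // exprS.
by apply: vmaxMr => //; apply: vringX; exact: vmax_ring.
Qed.

Lemma subfield_unit D d : subfield D -> D `<=` O -> D d -> m d -> d = 0.
Proof.
by move=> sD DO Dd [//|nO]; exfalso; apply: nO; apply: DO; exact: (sfV sD).
Qed.

(* As D is algebraically closed, the last hypothesis says that b is residually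
   transcendental over D. *)
Lemma residual_adjoin D b : acl D `<=` D -> D `<=` O -> O b ->
  (forall d, D d -> ~ m (b - d)) -> acl (D `|` [set b]) `<=` O.
Proof.
move=> DD DO vb nb.
have nD : ~ acl D b by move=> /DD/nb; rewrite subrr; apply; exact: vmax0.
have unit (p : {poly F}) : (forall i, acl D p`_i) -> p != 0 -> ~ m p.[b].
  move=> Dp p0; have [s sE] := closed_field_poly_normal p.
  have l0 : lead_coef p != 0 by rewrite lead_coef_eq0.
  have Ds d : d \in s -> D d.
    move=> ds; apply: DD; apply: (acl_root p0 Dp).
    by rewrite sE hornerZ (rootP _) ?mulr0 // root_prod_XsubC.
  rewrite sE hornerZ => /vmax_cancel h.
  have : m (\prod_(y <- [seq b - d | d <- s]) y).
    rewrite big_map; have -> : \prod_(d <- s) (b - d) = (\prod_(d <- s) ('X - d%:P)).[b].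
      by rewrite horner_prod; apply: eq_bigr => d _; rewrite hornerXsubC.
    apply: h; apply: vmaxNunit => //; apply: DO; apply: DD.
    by apply: (sfV (sfA D)); exact: Dp.
  case/vmax_prod => [_ /mapP[d ds ->]|_ /mapP[d /Ds/nb nbd ->] //].
  by apply: vringB => //; exact/DO/Ds.
have sE := gen_subfieldP (range iota `|` (D `|` [set b])).
move=> x /(algebraic_vring sE); apply => y /(acl_frac nD)[[p q] /= [Dp Dq q0 ->]].
have [_ qV] := nvmax (unit q Dq q0); apply: vringM => //.
by apply: vring_horner => // i; apply: DO; exact: DD.
Qed.

Lemma chain_pick_seq (D : set (set F)) s : D !=set0 -> total_on D subset ->
  [set` s] `<=` \bigcup_(X in D) X -> exists2 X, D X & [set` s] `<=` X.
Proof.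
move=> [X0 DX0] totD; elim: s => [|x s IH] sD; first by exists X0.
have [|X DX sX] := IH; first by move=> y ys; apply: sD; rewrite /= inE ys orbT.
have [|Y DY Yx] := sD x; first by rewrite /= inE eqxx.
have [XY|YX] := totD _ _ DX DY.
  exists Y => // y; rewrite /= inE => /predU1P[-> //|ys]; exact: (XY y (sX y ys)).
exists X => // y; rewrite /= inE => /predU1P[->|ys]; [exact: (YX x Yx)|exact: (sX y ys)].
Qed.

(** Take D maximal among closed sets between A and C that miss c. For x in C outside D, maximality
    puts c into [acl (D, x)], and exchange puts x into [acl (D, c)]. *)
Lemma hyperplane A C c : acl C `<=` C -> A `<=` C -> C c -> ~ acl A c ->
  exists D, [/\ A `<=` D, D `<=` C, acl D `<=` D, ~ D c & C `<=` acl (D `|` [set c])].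
Proof.
move=> CC AC Cc nAc.
have AC' : acl A `<=` C by move=> x Ax; apply: CC; exact: acl_mono Ax.
pose P X := [/\ X `<=` C, acl X `<=` X & ~ X c].
have PA : P (acl A) by split=> //; exact: acl_acl.
have [E Eb E0 totE|D [AD [DC DD nDc] maxD]] := Zorn_above PA.
  split.
  - by move=> x [X /Eb[XC _ _] Xx]; exact: XC.
  - move=> x /acl_finite[s [sE sx]]; have [X EX sX] := chain_pick_seq E0 totE sE.
    by exists X => //; have [_ XX _] := Eb _ EX; apply: XX; exact: acl_mono sx.
  - by move=> [X /Eb[_ _ nX] Xc]; exact: nX.
exists D; split=> // [x Ax|x Cx]; first by apply: AD; exact: sub_acl.
have [Dx|nDx] := pselect (D x); first by apply: sub_acl; left.
have [Dxc|nDxc] := pselect (acl (D `|` [set x]) c).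
  by apply: acl_exchange Dxc _ => /DD.
exfalso; apply: nDx; apply: (maxD (acl (D `|` [set x]))).
- split=> //; last exact: acl_acl.
  by move=> y yD; apply: CC; apply: acl_mono yD => w [/DC|->].
- by move=> y Dy; apply: sub_acl; left.
- by apply: sub_acl; right.
Qed.

(* C maps onto the residue field isomorphically, since every element of O is
   congruent to one of C by [residue_approx]. *)
Definition coef_field C : Prop :=
  [/\ acl C `<=` C, C `<=` O & forall x, acl (C `|` range t) x].

Lemma acl_closed_subfield C : acl C `<=` C -> subfield C.
Proof.
by move=> CC; have -> : C = acl C; [apply/seteqP; split=> //; exact: sub_acl|exact: acl_subfield].
Qed.

Lemma acl_closed_range C : acl C `<=` C -> range iota `<=` C.
Proof. by move=> CC x kx; apply: CC; exact: acl_range. Qed.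

Lemma residue_approx_acl D c : acl D `<=` D -> D `<=` O -> acl (D `|` range t) c ->
  O c -> exists2 d, D d & m (c - d).
Proof.
move=> DD DO; apply: (residue_approx t0 t_val) => //.
  exact: acl_closed_subfield.
exact: acl_closed_range.
Qed.

Definition tseq : seq F := [seq t i | i <- enum 'I_r].

Lemma tseqE : [set` tseq] = range t.
Proof.
apply/seteqP; split=> [_ /= /mapP[i _ ->]|_ [i _ <-]] /=; first by exists i.
by rewrite map_f ?mem_enum.
Qed.

Lemma coef_room C s : coef_field C -> exists2 x, C x & ~ acl [set` s] x.
Proof.
move=> [CC CO CT]; have [x nx] := room (s ++ tseq).
apply: contrapT => no; apply: nx; apply: acl_le (CT x) => y [Cy|ty].
  apply: contrapT => ny; apply: no; exists y => // ys; apply: ny.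
  by apply: acl_mono ys => w ws; rewrite /= mem_cat ws.
apply: sub_acl; move: ty; rewrite -tseqE /= => ty; by rewrite mem_cat ty orbT.
Qed.

Lemma coef_fresh C s n : coef_field C ->
  exists z, [/\ size z = n, [set` z] `<=` C & indep [set` s] z].
Proof.
move=> hC; have [||z zP] // := @fresh_seq _ _ iota C setT s n (fun _ _ => I); last by exists z.
by move=> s' _; exact: coef_room.
Qed.

(* If c in C is congruent to b, then c is replaced by b in C, that is, C = acl (D, c)
   becomes acl (D, b). *)
Lemma coef_exchange C A b : coef_field C -> A `<=` C -> acl (A `|` [set b]) `<=` O ->
  exists C', [/\ coef_field C', A `<=` C' & C' b].
Proof.
move=> [CC CO CT] AC AbO; have sC := acl_closed_subfield CC.
have [Ab|nAb] := pselect (acl A b).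
  by exists C; split=> //; apply: CC; exact: acl_mono Ab.
have vb : O b by apply: AbO; apply: sub_acl; right.
have [c Cc mbc] := residue_approx_acl CC CO (CT b) vb.
have nAc : ~ acl A c.
  move=> Ac; apply: nAb; have S := sfA (A `|` [set b]).
  have : b - c = 0.
    apply: (subfield_unit S) => //; apply: (sfB S); first by apply: sub_acl; right.
    by apply: acl_mono Ac; left.
  by move/eqP; rewrite subr_eq0 => /eqP ->.
have [D [AD DC DD nDc CD]] := hyperplane CC AC Cc nAc.
have DO : D `<=` O by move=> x /DC/CO.
have nb d : D d -> ~ m (b - d).
  move=> Dd mbd; apply: nDc.
  have : c - d = 0.
    apply: (subfield_unit sC) => //; first by apply: (sfB sC) => //; exact: DC.
    by rewrite -[c - d](subrKA b) -opprB; apply: vmaxD => //; exact: vmaxN.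
  by move/eqP; rewrite subr_eq0 => /eqP ->.
(* Any integral element of [acl (D, t)] is congruent to one of D, which b is not. Hence exchange may
   be used over D and the t_i together, and it recovers c from b. *)
have nDb : ~ acl (D `|` range t) b.
  by move=> Db; have [d Dd] := residue_approx_acl DD DO Db vb; exact: nb.
exists (acl (D `|` [set b])); split; last 1 first.
- by apply: sub_acl; right.
- split; first exact: acl_acl.
  + exact: residual_adjoin.
  have cD : acl (D `|` range t `|` [set b]) c.
    apply: acl_exchange nDb; apply: acl_le (CT b) => x [/CD|tx].
      by apply: acl_mono => y [Dy|->]; [left; left|right].
    by apply: sub_acl; left; right.
  move=> x; apply: acl_le (CT x) => y [/CD|ty]; last by apply: sub_acl; right.
  apply: acl_le => w [Dw|->].
    by apply: sub_acl; left; apply: sub_acl; left.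
  apply: acl_mono cD => w' [[Dw|tw]|->]; [left|by right|left].
    by apply: sub_acl; left.
  by apply: sub_acl; right.
- by move=> x Ax; apply: sub_acl; left; exact: AD.
Qed.

Hypothesis coef_ex : exists C, coef_field C.

(** The elements of B are brought in one at a time; the auxiliary set A keeps those already placed
    from being lost in later exchanges. *)
Lemma coef_field_containing (B : seq F) : acl [set` B] `<=` O ->
  exists C, coef_field C /\ [set` B] `<=` C.
Proof.
have [C0 hC0] := coef_ex.
suff gen A C : coef_field C -> A `<=` C -> acl (A `|` [set` B]) `<=` O ->
    exists C', [/\ coef_field C', A `<=` C' & [set` B] `<=` C'].
  move=> BO; have [||C [? _ ?]] := gen set0 C0 hC0; last by exists C.
    by move=> x [].
  by move=> x xB; apply: BO; apply: acl_mono xB => y [[]|].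
elim: B A C => [|b B IH] A C hC AC BO; first by exists C; split=> // x.
have [|C1 [h1 A1 b1]] := coef_exchange hC AC (b := b).
  move=> x xA; apply: BO; apply: acl_mono xA => y [Ay|->]; first by left.
  by right; rewrite /= mem_head.
have [||C2 [h2 A2 B2]] := IH (A `|` [set b]) C1 h1.
- by move=> x [/A1|->].
- by rewrite -setU_cons.
exists C2; split=> //; first by move=> x Ax; apply: A2; left.
by move=> x; rewrite /= inE => /predU1P[->|/B2 //]; apply: A2; right.
Qed.

Lemma indep_extract A s : exists z, [/\ [set` z] `<=` [set` s], indep A z &
  [set` s] `<=` acl (A `|` [set` z])].
Proof.
elim: s A => [|x s IH] A; first by exists [::].
have [Ax|nAx] := pselect (acl A x).
  have [z [zs zi sz]] := IH A; exists z; split=> //.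
    by move=> y /zs /= ys; rewrite inE ys orbT.
  move=> y; rewrite /= inE => /predU1P[->|/sz //].
  by apply: acl_mono Ax; left.
have [z [zs zi sz]] := IH (A `|` [set x]); exists (x :: z); split=> //.
  by move=> y; rewrite /= !inE => /predU1P[->|/zs /= ->]; rewrite ?eqxx ?orbT.
move=> y; rewrite setU_cons /= inE => /predU1P[->|/sz //].
by apply: sub_acl; left; right.
Qed.

Lemma indepP A s : (forall i, (i < size s)%N -> ~ acl (A `|` [set` take i s]) (nth 0 s i)) ->
  indep A s.
Proof.
elim: s A => //= x s IH A h; split; first by have := h 0%N isT; rewrite /= setU_nil.
by apply: IH => i is1; have := h i.+1 is1; rewrite /= setU_cons.
Qed.

Lemma tseq_indep D : subfield D -> range iota `<=` D -> D `<=` O -> indep D tseq.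
Proof.
move=> sD kD DO; apply: indepP => i; rewrite size_map size_enum_ord => ir.
pose i0 := Ordinal ir.
have -> : nth 0 tseq i = t i0.
  by rewrite (nth_map i0) ?size_enum_ord //; congr t; apply: val_inj; rewrite /= nth_enum_ord.
move=> h; apply: (tset_indep t0 t_val sD kD DO (i0 := i0)); apply: acl_mono h.
move=> x [Dx|]; first by left.
rewrite /= -map_take => /mapP[j ji ->]; right; exists j => //=.
have := ji; rewrite -index_mem => ltji.
have jt : (index j (take i (enum 'I_r)) < i)%N.
  by rewrite (leq_trans ltji) // size_take_min geq_minl.
have e := nth_index j ji; rewrite nth_take // in e.
by rewrite -[in X in (X < _)%N]e nth_enum_ord // (ltn_trans jt).
Qed.

End CoefficientFields.

(** * Elements of G_v over a finite set, and transport by G_v *)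

Section Decomposition.
Variables (k : fieldType) (F : closedFieldType) (iota : {rmorphism k -> F}).
Variable v : valuation_ring iota.
Implicit Types (C D : set F) (x y : F) (A B S s z : seq F).
Local Notation acl := (acl iota).
Local Notation indep := (indep iota).
Local Notation G := (Gal iota).
Local Notation O := (vring v).
Local Notation m := (vmax v).
Local Notation sfA A := (@acl_subfield _ _ iota A).
Variables (r : nat) (t : 'I_r -> F).
Hypothesis t0 : forall i, t i != 0.
Hypothesis t_val : forall e, O (monom t e) -> O (monom t e)^-1 -> forall i, e i = 0.
Hypothesis k_inj : injective (fun n : nat => n%:R : k).
Hypothesis room : forall s, exists x, ~ acl [set` s] x.
Hypothesis coef_ex : exists C, coef_field v t C.
Local Notation tseq := (tseq t).

Lemma stab_vV (g : G) : stab_v v g -> stab_v v (g^-1)%g.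
Proof.
by have /group_closedV h := stab_v_group v; have := h g; rewrite !inE.
Qed.

Lemma stab_vM (g h : G) : stab_v v g -> stab_v v h -> stab_v v (g * h)%g.
Proof.
move=> gv /stab_vV hv; have [_ d] := stab_v_group v.
by have := d g (h^-1)%g; rewrite !inE invgK; exact.
Qed.

Lemma zip_map (s1 s2 : seq F) (f : F -> F) : size s1 = size s2 ->
  (forall p, p \in zip s1 s2 -> f p.1 = p.2) -> map f s1 = s2.
Proof.
elim: s1 s2 => [|x s1 IH] [|y s2] //= [e] fP; congr cons.
  by apply: (fP (x, y)); rewrite inE eqxx.
by apply: IH => // p ps; apply: fP; rewrite inE ps orbT.
Qed.

(* All coordinates z of a support of a vector, parameters included, are
   multiplied by fresh units from a coefficient field. *)
Lemma decomp_support (H : set G) B S :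
  (forall g h : G, H g -> H h -> H (g * h)%g) -> (forall g : G, H g -> H (g^-1)%g) ->
  acl [set` B] `<=` O -> (gal_fix [set` S] : set G) `<=` H ->
  (forall g : G, stab_v v g -> gal_fix (acl [set` B]) g -> H g) ->
  (gal_fix (acl [set` B]) : set G) `<=` H.
Proof.
move=> HM HV BO HS Hv.
have [C [hC BC]] := coef_field_containing t0 t_val coef_ex BO.
have [CC CO CT] := hC.
have sC := acl_closed_subfield CC; have kC := acl_closed_range CC.
have [s' [s'C Ss']] := acl_finite_seq (fun x (_ : [set` S] x) => CT x).
pose A := [seq y <- s' | `[< C y >]].
have [z0 [z0A z0i Az0]] := indep_extract iota [set` B] A.
have z0C : [set` z0] `<=` C by move=> y /z0A /=; rewrite mem_filter => /andP[/asboolP].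
have Sz : [set` S] `<=` acl ([set` B] `|` [set` z0 ++ tseq]).
  rewrite setU_cat; move=> y /Ss'; apply: acl_le => x /= xs; have [Cx|tx] := s'C _ xs.
    apply: acl_mono (Az0 x _) => [w|]; first by left.
    by rewrite /= mem_filter xs asboolT.
  by apply: sub_acl; right; rewrite tseqE.
have ti : indep ([set` B] `|` [set` z0]) tseq.
  apply: indep_sub (tseq_indep t0 t_val sC kC CO).
  by move=> y [/BC|/z0C].
pose z := z0 ++ tseq.
have zi : indep [set` B] z by apply/indep_cat.
have [x [xz xC xi]] := coef_fresh room (B ++ z) (size z) hC.
have zxi : indep [set` B] (z ++ x).
  apply/indep_cat; split=> //; apply: indep_sub xi => y.
  by case=> /= ys; rewrite mem_cat ys ?orbT.
pose x0 := take (size z0) x; pose xt := drop (size z0) x.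
have x0xt : x = x0 ++ xt by rewrite cat_take_drop.
have x0s : size x0 = size z0.
  by rewrite size_take xz size_cat; case: ltnP => // le; apply/eqP; rewrite eqn_leq le leq_addr.
have xts : size xt = r by rewrite size_drop xz size_cat size_map size_enum_ord addKn.
have x0i : indep ([set` B] `|` [set` x0]) z0.
  have : indep [set` B] (z0 ++ x0).
    move: zxi; rewrite x0xt /z -catA => /indep_cat[i1 /indep_cat[_ i2]].
    apply/indep_cat; split=> //; move: i2 => /indep_cat[i2 _].
    by apply: indep_sub i2 => y yz; left.
  by move/indep_catC/indep_cat => [].
have x0C : [set` x0] `<=` C by move=> y y0; apply: xC; rewrite x0xt /= mem_cat y0.
pose K0 := acl ([set` B] `|` [set` x0]).
have K0C : K0 `<=` C by move=> y yK; apply: CC; apply: acl_mono yK => w [/BC|/x0C].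
have z0K : indep K0 z0 by apply: indep_acl x0i; exact: acl_acl.
have [|m1 m2 m3] := indep_mulseq x0s _ z0K.
  move=> y y0; split; first by apply: sub_acl; apply: sub_acl; right.
  by apply: (indep_neq0 xi); rewrite x0xt mem_cat y0.
have cod1 : cod (gres (1%g : G) K0) = K0.
  by rewrite cod_gres; apply/seteqP; split=> [_ [w Kw <-]//|w Kw]; exists w.
have dom1 : dom (gres (1%g : G) K0) = K0 := dom_gres _ _.
have gK0 : graph iota (gres (1%g : G) K0) by apply: gres_graph; [exact: acl_subfield|exact: acl_range].
(* The identity of K0 with z0 sent to x0 z0 is balanced, since x0 lies in K0 and consists of nonzero
   elements; this gives the action on C. The remaining factors [xt], exactly r of them, multiply the
   t_i. *)
have [|||||||rho [grho rho1 rhoz dr cr]] := graph_extend (s1 := z0) (s2 := mulseq x0 z0) CC gK0;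
  rewrite ?dom1 ?cod1 ?size_mulseq //.
- by move=> y [/K0C|/z0C].
- move=> y [/K0C //|/m3 ym]; apply: CC; apply: acl_mono ym => w [/K0C|/z0C] //.
- by move=> y [Ky|/m2 //]; apply: sub_acl; left.
- by move=> y [Ky|/m3 //]; apply: sub_acl; left.
pose u (i : 'I_r) := nth 0 xt i.
have uC i : C (u i) /\ u i != 0.
  have ux : u i \in x by rewrite x0xt mem_cat mem_nth ?orbT ?xts.
  by split; [exact: xC|exact: (indep_neq0 xi)].
have [h [hv hrho ht]] := decomp_extend t0 t_val k_inj CO CT grho dr cr uC.
have hB : gal_fix (acl [set` B]) h.
  move=> y yB; apply: hrho; apply: rho1; split=> //=.
  by apply: acl_mono yB; left.
have hz : map h z = mulseq x z.
  rewrite x0xt /z /mulseq zip_cat // map_cat [RHS]map_cat; congr (_ ++ _).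
    apply: zip_map => [|p pz]; first by rewrite size_mulseq.
    by apply: hrho; have := rhoz p pz; case: p {pz}.
  have ts : size tseq = r by rewrite size_map size_enum_ord.
  have zs : size [seq p.1 * p.2 | p <- zip xt tseq] = r by rewrite size_map size_zip xts ts minnn.
  apply: (@eq_from_nth _ 0); rewrite size_map ts ?zs // => i ir; pose i0 := Ordinal ir.
  rewrite (nth_map 0) ?ts // (nth_map (0, 0)) ?size_zip ?xts ?ts ?minnn //.
  rewrite nth_zip ?xts ?ts //=.
  have -> : nth 0 tseq i = t i0.
    by rewrite (nth_map i0) ?size_enum_ord //; congr t; apply: val_inj; rewrite /= nth_enum_ord.
  by rewrite ht.
have Hz : (gal_fix (acl ([set` B] `|` [set` z])) : set G) `<=` H.
  by apply: subset_trans HS => g gz y yS; apply: gz; exact: Sz.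
apply: (@fix_generated _ _ _ room H HM HV B z (mulseq x z)) => //.
  exact: indep_mul_cat.
apply: (@conj_fix _ _ _ H HM HV h (acl ([set` B] `|` [set` z]))) => //; first exact: Hv.
by apply: image_cat hz => y yB; apply: hB; exact: sub_acl.
Qed.

Lemma transport_indep B B' (th : G) : indep set0 (B ++ B') -> map th B = B' ->
  acl [set` B ++ B'] `<=` O ->
  exists2 g : G, stab_v v g & forall x, acl [set` B] x -> g x = th x.
Proof.
move=> BBi thB BBO; have [C [hC BC]] := coef_field_containing t0 t_val coef_ex BBO.
have [CC CO CT] := hC.
have set0U s : set0 `|` [set` s] = [set` s] by rewrite set0U.
have [Bi B'i] := (indep_cat _ _ _ _).1 BBi; have [_ Bi'] := (indep_cat _ _ _ _).1 (indep_catC BBi).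
rewrite !set0U in B'i Bi'.
have thB' : th @` [set` B] = [set` B'].
  by rewrite -thB; apply/seteqP; split=> [_ [x xB <-]|_ /= /mapP[x xB ->]]; [exact: map_f|exists x].
pose Phi := gres th (acl [set` B]).
have dP : dom Phi = acl [set` B] := dom_gres _ _.
have cP : cod Phi = acl [set` B'] by rewrite cod_gres gal_acl thB'.
have gP : graph iota Phi by apply: gres_graph; [exact: acl_subfield|exact: acl_range].
have BsubC : acl [set` B] `<=` C.
  by move=> y yB; apply: CC; apply: acl_mono yB => w wB; apply: BC; rewrite /= mem_cat wB.
have B'subC : acl [set` B'] `<=` C.
  by move=> y yB; apply: CC; apply: acl_mono yB => w wB; apply: BC; rewrite /= mem_cat wB orbT.
have [|||||||rho [grho rho1 rhoz dr cr]] := graph_extend (s1 := B') (s2 := B) CC gP; rewrite ?dP ?cP //.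
- by rewrite -thB size_map.
- by apply: indep_acl B'i; exact: acl_acl.
- by apply: indep_acl Bi'; exact: acl_acl.
- by move=> y [/BsubC|yB] //; apply: B'subC; exact: sub_acl.
- by move=> y [/B'subC|yB] //; apply: BsubC; exact: sub_acl.
- move=> y [yB|yB]; last by apply: sub_acl; left; exact: sub_acl.
  by apply: acl_mono yB; right.
- move=> y [yB|yB]; last by apply: sub_acl; left; exact: sub_acl.
  by apply: acl_mono yB; right.
have [|g [gv grho' _]] := decomp_extend t0 t_val k_inj CO CT grho dr cr (u := fun=> 1).
  by move=> i; split; [exact: (sf1 (acl_closed_subfield CC))|exact: oner_neq0].
by exists g => // x xB; apply: grho'; apply: rho1; split.
Qed.

(** Suppose an entry x of z were congruent to some d in [acl B]. Then d, being integral and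
    algebraic over A and the t_i, is congruent to some d' in [acl A]; x - d' lies in C and in the
    maximal ideal, so it is zero, against the freshness of x. Thus x is residually transcendental
    and [residual_adjoin] applies. *)
Lemma residual_fresh C A B z : coef_field v t C -> [set` A] `<=` C ->
  [set` B] `<=` acl ([set` A] `|` range t) -> acl [set` B] `<=` O ->
  [set` z] `<=` C -> indep ([set` A] `|` range t) z -> acl ([set` B] `|` [set` z]) `<=` O.
Proof.
move=> [CC CO CT]; have sC := acl_closed_subfield CC.
elim: z A B => [|x z IH] A B AC BA BO zC /=; first by rewrite setU_nil.
move=> [xi zi]; have Cx : C x by apply: zC; rewrite /= mem_head.
have consE s : [set` x :: s] = [set` s] `|` [set x].
  apply/seteqP; split=> y; rewrite /= inE; first by case/predU1P=> [->|ys]; [right|left].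
  by case=> [ys|->]; rewrite ?eqxx // (ys : y \in s) orbT.
have xBO : acl [set` x :: B] `<=` O.
  have DO : acl [set` B] `<=` O by [].
  have nx d : acl [set` B] d -> ~ m (x - d).
    move=> Bd mxd; have AC' : acl [set` A] `<=` C by move=> y Ay; apply: CC; exact: acl_mono Ay.
    have dAt : acl (acl [set` A] `|` range t) d.
      apply: acl_le Bd => y /BA; apply: acl_mono => w [wA|wt]; last by right.
      by left; exact: sub_acl.
    have [|d' Ad' mdd'] := residue_approx_acl t0 t_val (@acl_acl _ _ _ _) _ dAt (DO _ Bd).
      by move=> y /AC'/CO.
    have : x - d' = 0.
      apply: (subfield_unit (v := v) sC) => //; first by apply: (sfB sC) => //; exact: AC'.
      by rewrite -[x - d'](subrKA d); exact: vmaxD.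
    move/eqP; rewrite subr_eq0 => /eqP xd; apply: xi; rewrite xd.
    by apply: acl_mono Ad'; left.
  have vx : O x by exact: CO.
  have := residual_adjoin (@acl_acl _ _ _ _) DO vx nx; apply: subset_trans.
  apply: acl_mono => y; rewrite consE => -[yB|->]; last by right.
  by left; exact: sub_acl.
rewrite setU_cons -consE; apply: (IH (x :: A)) => //.
- by move=> y; rewrite /= inE => /predU1P[->|/AC].
- move=> y; rewrite /= inE => /predU1P[->|/BA].
    by apply: sub_acl; left; rewrite /= mem_head.
  by apply: acl_mono => w [wA|]; [left; rewrite /= inE (wA : w \in A) orbT|right].
- by move=> y yz; apply: zC; rewrite /= inE (yz : y \in z) orbT.
- by apply: indep_sub zi => y; rewrite consE => -[[yA|->]|yt]; [left; left|right|left; right].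
Qed.

(** B and s B need not lie in a common coefficient field. Each does with the fresh copy z, so B is
    carried to z by g1, s B to z by g2, and g2^-1 g1 agrees with s. *)
Lemma transport B (s : G) : acl [set` B] `<=` O -> acl [set` map s B] `<=` O ->
  exists2 g : G, stab_v v g & forall x, acl [set` B] x -> g x = s x.
Proof.
have [C hC] := coef_ex; have [CC CO CT] := hC.
have mapE (g : G) B1 : g @` [set` B1] = [set` map g B1].
  by apply/seteqP; split=> [_ [x xB <-]|_ /= /mapP[x xB ->]]; [exact: map_f|exists x].
wlog Bi : B / indep set0 B => [wl BO sBO|BO sBO].
  have [B0 [B0B B0i BB0]] := indep_extract iota set0 B; rewrite set0U in BB0.
  have B0O : acl [set` B0] `<=` acl [set` B] by exact: acl_mono.
  have [||g gv gB] := wl B0 B0i; first exact: subset_trans BO.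
    by apply: subset_trans sBO; rewrite -!mapE; apply: acl_mono => _ [x /B0B xB <-]; exists x.
  by exists g => // x xB; apply: gB; exact: acl_le xB.
pose B1 := map s B.
have B1i : indep set0 B1.
  apply: gal_indep Bi => a /(gal_fix_acl (g := (s^-1)%g) (B := set0)); rewrite galKV; apply.
  by move=> b [].
have [s' [s'C BBs']] := acl_finite_seq (fun x (_ : [set` B ++ B1] x) => CT x).
pose A := [seq y <- s' | `[< C y >]].
have AC : [set` A] `<=` C by move=> y /=; rewrite mem_filter => /andP[/asboolP].
have BBA : [set` B ++ B1] `<=` acl ([set` A] `|` range t).
  move=> y /BBs'; apply: acl_mono => x /= xs; have [Cx|] := s'C _ xs; last by right.
  by left; rewrite /= mem_filter xs asboolT.
have BA : [set` B] `<=` acl ([set` A] `|` range t).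
  by move=> y yB; apply: BBA; rewrite /= mem_cat (yB : y \in B).
have B1A : [set` B1] `<=` acl ([set` A] `|` range t).
  by move=> y yB; apply: BBA; rewrite /= mem_cat (yB : y \in B1) orbT.
have [z [zs zC zi]] := coef_fresh room (A ++ tseq) (size B) hC.
rewrite -[[set` A ++ tseq]]set0U setU_cat set0U tseqE in zi.
have join B2 : indep set0 B2 -> [set` B2] `<=` acl ([set` A] `|` range t) ->
    acl [set` B2] `<=` O -> indep set0 (B2 ++ z) /\ acl [set` B2 ++ z] `<=` O.
  move=> B2i B2A B2O; split.
    apply/indep_cat; split=> //; rewrite set0U; apply: indep_acl zi; exact: acl_le.
  by rewrite -[[set` B2 ++ z]]set0U setU_cat set0U; exact: residual_fresh B2A B2O zC zi.
have [Bzi BzO] := join B Bi BA BO.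
have [B1zi B1zO] := join B1 B1i B1A sBO.
have [th _ thB] := gal_swap (esym zs) Bzi.
have [g1 g1v g1B] := transport_indep Bzi thB BzO.
have thB1 : map (gal_fun (th * s^-1)%g) B1 = z.
  rewrite -thB /B1 -map_comp; apply: eq_map => x /=.
  by rewrite galM galKV.
have [g2 g2v g2B] := transport_indep B1zi thB1 B1zO.
exists (g2^-1 * g1)%g.
  exact: stab_vM (stab_vV g2v) g1v.
move=> x xB; rewrite galM g1B //.
have <- : g2 (s x) = th x.
  by rewrite g2B ?galM ?galKV //; rewrite -mapE -gal_acl; exists x.
by rewrite galKV.
Qed.

End Decomposition.

(** * Algebraic independence *)

Section Multivariate.
Variable R : comNzRingType.

(** [muni] isolates the last variable. Together with [muni_max] and [mmap_mwiden] this turns a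
    univariate equation with coefficients in k[l] into one polynomial in one more variable, the form
    that [alg_independent] understands. *)
Lemma muni_mwiden n (q : mpoly n R) : muni (mwiden q) = q%:P.
Proof.
have wsum I (r : seq I) (E : I -> mpoly n R) :
    mwiden (\sum_(i <- r) E i) = \sum_(i <- r) mwiden (E i) by exact: raddf_sum.
have usum I (r : seq I) (E : I -> mpoly n.+1 R) :
    muni (\sum_(i <- r) E i) = \sum_(i <- r) muni (E i) by exact: raddf_sum.
have csum I (r : seq I) (E : I -> mpoly n R) :
    (\sum_(i <- r) E i)%:P = \sum_(i <- r) (E i)%:P by exact: raddf_sum.
rewrite [in LHS](mpolyE q) [in RHS](mpolyE q) wsum usum csum; apply: eq_bigr => m _.
rewrite mwidenZ mwidenX muniZ -mul_polyC -mul_mpolyC rmorphM /=; congr (_ * _).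
rewrite muniE msuppX big_seq1 mcoeffX eqxx scale1r mnmwiden_ordmax expr0.
rewrite -mul_polyC mulr1; congr (mpolyX R _)%:P.
by apply/mnmP => i; rewrite mnmE mnmwiden_widen.
Qed.

Lemma muni_max n : muni (mpolyX R (mnm1 (@ord_max n))) = 'X.
Proof.
rewrite muniE msuppX big_seq1 mcoeffX eqxx scale1r mnm1E eqxx expr1.
rewrite -mul_polyC (_ : mpolyX R _ = 1) ?mul1r // -[RHS]mpolyX0; congr mpolyX.
apply/mnmP => i; rewrite mnmE mnm1E mnm0E.
by rewrite -val_eqE /= gtn_eqF.
Qed.

Lemma mmap_mwiden (S : comNzRingType) (f : {rmorphism R -> S}) n (x : 'I_n.+1 -> S) (q : mpoly n R) :
  mmap f x (mwiden q) = mmap f (fun i => x (widen_ord (leqnSn n) i)) q.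
Proof.
have wsum I (r : seq I) (E : I -> mpoly n R) :
    mwiden (\sum_(i <- r) E i) = \sum_(i <- r) mwiden (E i) by exact: raddf_sum.
have msum n' (y : 'I_n' -> S) I (r : seq I) (E : I -> mpoly n' R) :
    mmap f y (\sum_(i <- r) E i) = \sum_(i <- r) mmap f y (E i) by exact: raddf_sum.
rewrite [in LHS](mpolyE q) [in RHS](mpolyE q) wsum !msum; apply: eq_bigr => m _.
rewrite mwidenZ mwidenX !mmapZ !mmapX; congr (_ * _).
rewrite /mmap1 big_ord_recr /= mnmwiden_ordmax expr0 mulr1.
by apply: eq_bigr => i _; rewrite mnmwiden_widen.
Qed.

End Multivariate.

Section PolynomialValues.
Variables (k L : fieldType) (j : {rmorphism k -> L}).
Implicit Types (l : seq L).

Definition tup l (i : 'I_(size l)) : L := nth 0 l i.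
Definition values l : set L := range (mmap j (@tup l)).

(** The ring k[l] is presented by the graph of its identity map, so that its fraction field comes
    from [gfrac]. *)
Lemma values_graph l : ring_graph j [set z : L * L | values l z.1 /\ z.1 = z.2].
Proof.
split.
- by move=> c; split=> //=; exists (mpolyC _ c) => //; rewrite mmapC.
- move=> a b _ _ [/= [p _ <-] <-] [/= [q _ <-] <-]; split=> //=.
  by exists (p - q) => //; rewrite mmapB.
- move=> a b _ _ [/= [p _ <-] <-] [/= [q _ <-] <-]; split=> //=.
  by exists (p * q) => //; rewrite rmorphM.
- by move=> a _ [/= _ <-].
Qed.

Lemma values_gen l y : gen_subfield (range j `|` [set` l]) y ->
  exists a b, [/\ values l a, values l b, b != 0 & y = a / b].
Proof.
move=> ly; have gP := frac_graph (values_graph l).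
have [y' [a [a' [b [b' [[Va _] [Vb _] b0 ya _]]]]]] :
    dom (gfrac [set z : L * L | values l z.1 /\ z.1 = z.2]) y.
  move: ly; apply: smallest_sub; first exact: (dom_subfield gP).
  move=> z [jz|zl]; first exact: (dom_const gP).
  exists z; apply: (sub_frac (values_graph l)); split=> //=.
  have iz : (index z l < size l)%N by rewrite index_mem.
  exists (mpolyX k (mnm1 (Ordinal iz))) => //.
  by rewrite mmapX mmap1U /tup nth_index.
by exists a, b.
Qed.

(** Clearing denominators in an equation of b over k(l) gives a polynomial [P] vanishing at the
    distinct elements l, b. So [P] is zero, hence so are its coefficients [c i] in the last
    variable, and the equation was zero. *)
Lemma alg_independent_transc (B : set L) l b : alg_independent j B ->
  [set` l] `<=` B -> B b -> b \notin l -> uniq l ->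
  ~ algebraic_over (gen_subfield (range j `|` [set` l])) b.
Proof.
move=> indB lB Bb bl ul.
have sE := gen_subfieldP (range j `|` [set` l]).
move=> /(algebraic_overP _ (sf0 sE))[p [p0 Ep pb]].
have /choice[ab abP] : forall i, exists ab : mpoly (size l) k * mpoly (size l) k,
    mmap j (@tup l) ab.2 != 0 /\ p`_i = mmap j (@tup l) ab.1 / mmap j (@tup l) ab.2.
  move=> i; have [_ [_ [[q _ <-] [q' _ <-] q0 e]]] := values_gen (Ep i).
  by exists (q, q').
pose n := size p.
pose c i := (ab i).1 * \prod_(i' < n | i' != i :> nat) (ab i').2.
pose d := \prod_(i < n) (ab i).2.
pose ev := mmap j (@tup l).
have cE i : (i < n)%N -> ev (c i) = ev d * p`_i.
  move=> ni; have [b0 ->] := abP i.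
  rewrite /d (bigD1 (Ordinal ni)) //= /c /ev !rmorphM /=.
  rewrite [RHS]mulrC -[RHS]mulrA [X in _ = _ * X]mulrA mulVf // mul1r.
  by congr (_ * mmap _ _ _); apply: eq_bigl => i'; rewrite -val_eqE.
have d0 : ev d != 0.
  by rewrite /ev /d rmorph_prod; apply/prodf_neq0 => i _; have [] := abP i.
pose P := \sum_(i < n) mwiden (c i) * mpolyX k (mnm1 ord_max) ^+ i.
pose x (i : 'I_(size l).+1) := nth 0 (rcons l b) i.
have ur : uniq (rcons l b) by rewrite rcons_uniq bl.
have x_inj : injective x.
  move=> i i' /eqP; rewrite /x nth_uniq ?size_rcons // => /eqP; exact: val_inj.
have xB i : B (x i).
  have := ltn_ord i; rewrite ltnS leq_eqVlt /x nth_rcons => /orP[/eqP e|il].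
    by rewrite e ltnn eqxx.
  by rewrite il; apply: lB; exact: mem_nth.
have Px : mmap j x P = 0.
  rewrite rmorph_sum /=.
  transitivity (ev d * p.[b]); last by rewrite pb mulr0.
  rewrite horner_coef mulr_sumr; apply: eq_bigr => i _.
  rewrite rmorphM rmorphXn /= mmap_mwiden mmapX mmap1U mulrA -cE //; congr (_ * _).
    congr mmap; apply: funext => i'; by rewrite /x /tup nth_rcons /= ltn_ord.
  by rewrite /x nth_rcons /= ltnn eqxx.
have P0 := indB _ _ x_inj xB _ Px.
have muniP : muni P = \poly_(i < n) c i.
  rewrite rmorph_sum poly_def /=; apply: eq_bigr => i _.
  by rewrite rmorphM rmorphXn /= muni_mwiden muni_max mul_polyC.
have c0 i : (i < n)%N -> c i = 0.
  by move=> ni; have := congr1 (fun q : {poly _} => q`_i) muniP; rewrite P0 rmorph0 coef0 coef_poly ni.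
move/negP: p0; apply; apply/eqP/polyP => i; rewrite coef0.
have [ni|/(nth_default 0)//] := ltnP i n.
have := cE i ni; rewrite c0 // /ev rmorph0 => /esym/eqP; rewrite mulf_eq0 (negPf d0).
by move/eqP.
Qed.

End PolynomialValues.

Section Transcendence.
Variables (k F : closedFieldType) (iota : {rmorphism k -> F}).
Local Notation acl := (acl iota).

Lemma natr_inj : [pchar F] =i pred0 -> injective (fun n : nat => n%:R : k).
Proof.
move=> F0 m n; wlog le : m n / (m <= n)%N => [wl e|e].
  by have [/wl|/ltnW/wl] := leqP m n; [exact|move=> h; apply/esym/h/esym].
have : (n - m)%:R = 0 :> F by rewrite -(rmorph_nat iota) natrB // -e subrr rmorph0.
move/eqP; rewrite (pcharf0P _).1 //= subn_eq0 => nm.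
by apply/eqP; rewrite eqn_leq le nm.
Qed.

(** If finitely many elements generated F, finitely many elements of the base B would do; as B is
    infinite, another element of B would be algebraic over these. *)
Lemma trdeg_room : countably_infinite_trdeg iota ->
  forall s : seq F, exists x, ~ acl [set` s] x.
Proof.
move=> [B [[Bi BT] Binf]] s; apply: contrapT => no.
have all x : acl [set` s] x by apply: contrapT => nx; apply: no; exists x.
have [l [lB sl]] := acl_finite_seq (fun x (_ : [set` s] x) => BT x).
have [b Bb bl] : exists2 b, B b & b \notin l.
  apply: contrapT => nb; apply: infinite_nat.
  have BF : finite_set B.
    apply: (@sub_finite_set _ _ [set` l]); last exact: finite_seq.
    by move=> b Bb; apply: contrapT => /negP bl; apply: nb; exists b.
  by have /eq_finite_set <- := Binf.
apply: (alg_independent_transc Bi (l := undup l)) Bb _ _ _.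
- by move=> x; rewrite /= mem_undup => /lB.
- by rewrite mem_undup.
- exact: undup_uniq.
have := acl_le sl (all b); apply: acl_mono => x; by rewrite /= mem_undup.
Qed.

Variable v : valuation_ring iota.
Local Notation O := (vring v).

Lemma residue_sum (I : Type) (r : seq I) (f : I -> vtype v) :
  residue (\sum_(i <- r) f i) = \sum_(i <- r) residue (f i).
Proof. exact: rmorph_sum. Qed.
Lemma residueM (a b : vtype v) : residue (a * b) = residue a * residue b.
Proof. exact: rmorphM. Qed.
Lemma residueX (a : vtype v) n : residue (a ^+ n) = residue a ^+ n.
Proof. exact: rmorphXn. Qed.
Lemma residue_prod (I : Type) (r : seq I) (f : I -> vtype v) :
  residue (\prod_(i <- r) f i) = \prod_(i <- r) residue (f i).
Proof. exact: rmorph_prod. Qed.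

Lemma vtype_val_sum (I : Type) (r : seq I) (f : I -> vtype v) :
  val (\sum_(i <- r) f i) = \sum_(i <- r) val (f i).
Proof. exact: rmorph_sum. Qed.
Lemma vtype_valM (a b : vtype v) : val (a * b) = val a * val b.
Proof. exact: rmorphM. Qed.
Lemma vtype_valX (a : vtype v) n : val (a ^+ n) = val a ^+ n.
Proof. exact: rmorphXn. Qed.
Lemma vtype_val_prod (I : Type) (r : seq I) (f : I -> vtype v) :
  val (\prod_(i <- r) f i) = \prod_(i <- r) val (f i).
Proof. exact: rmorph_prod. Qed.

(** The residue of a polynomial in lifts is the polynomial in their residues, nonzero by
    independence; so nonzero values of polynomials are units and fractions stay integral.
    Injectivity on T makes distinct lifts have distinct residues, as [alg_independent] requires. *)
Lemma acl_lift_vring (T : set (vtype v)) : {in T &, injective (@residue _ _ _ v)} ->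
  alg_independent (@residue_const _ _ _ v) (@residue _ _ _ v @` T) ->
  acl [set val y | y in T] `<=` O.
Proof.
move=> Tinj Tind x /acl_finite[s [sT sx]].
have lT : [set` undup s] `<=` [set val y | y in T].
  by move=> y; rewrite /= mem_undup => /sT.
have {}sx : acl [set` undup s] x by apply: acl_mono sx => y; rewrite /= mem_undup.
set l := undup s in lT sx; have ul : uniq l := undup_uniq s.
have vl y : values iota l y -> O y /\ (y != 0 -> O y^-1).
  move=> [p _ <-]; have /choice[tau tauP] : forall i : 'I_(size l), exists y, T y /\ val y = tup i.
    by move=> i; have [w Tw e] := lT _ (mem_nth 0 (ltn_ord i)); exists w.
  pose Y : vtype v := \sum_(m <- msupp p) (Sub (iota (mcoeff m p)) (const_vpred v _) *
    \prod_(i < size l) tau i ^+ m i).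
  have YE : val Y = mmap iota (@tup _ l) p.
    rewrite /Y vtype_val_sum; apply: eq_bigr => m _; rewrite vtype_valM; congr (_ * _).
    by rewrite vtype_val_prod; apply: eq_bigr => i _; rewrite vtype_valX (tauP i).2.
  have resY : residue Y = mmap (@residue_const _ _ _ v) (fun i => residue (tau i)) p.
    rewrite /Y residue_sum; apply: eq_bigr => m _; rewrite residueM; congr (_ * _).
    by rewrite residue_prod; apply: eq_bigr => i _; rewrite residueX.
  rewrite -YE; split; first by have := valP Y; rewrite inE.
  move=> Y0; have p0 : p <> 0.
    by move=> p0; move: Y0; rewrite YE p0 rmorph0 eqxx.
  have resY0 : residue Y != 0.
    apply/eqP => e; apply: p0; apply: (Tind _ (fun i => residue (tau i))).
    - move=> i i' /(Tinj _ _ (mem_set (tauP i).1) (mem_set (tauP i').1)) e'.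
      have := congr1 val e'; rewrite (tauP i).2 (tauP i').2 => /eqP.
      by rewrite nth_uniq // => /eqP; exact: val_inj.
    - by move=> i; exists (tau i) => //; have [] := tauP i.
    - by rewrite -resY.
  move: resY0; rewrite residue_eq0 => /max_idealP nY.
  by apply: contrapT => nO; apply: nY.
apply: algebraic_vring sx; first exact: gen_subfieldP.
move=> y /values_gen[a [b [/vl[va _] /vl[_ vb] b0 ->]]].
by apply: vringM => //; exact: vb.
Qed.

(** The value of a monomial is the integral combination of the basis with the same exponents, and a
    unit has value zero. *)
Lemma monom_units (r : nat) (t : 'I_r -> mulgrp F) :
  Qbasis (fun i => value v (t i)) -> forall e,
  O (monom (fun i => val (t i)) e) -> O (monom (fun i => val (t i)) e)^-1 ->
  forall i, e i = 0.
Proof.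
move=> [free _] e vm vmV.
pose g : mulgrp F := \sum_i t i *~ e i.
have valMz (x : mulgrp F) (n : int) : val (x *~ n) = val x ^ n.
  case: n => n; first by rewrite -pmulrn mulgrp_valMn.
  rewrite NegzE mulrNz -invr_expz -[LHS]/((val (x *~ n.+1))^-1).
  by rewrite -pmulrn mulgrp_valMn.
have valg : val g = monom (fun i => val (t i)) e.
  rewrite /g /monom; elim/big_rec2: _ => // i y1 y2 _ IH.
  by rewrite -valMz -IH.
have g0 : value v g = 0.
  by apply/eqP; rewrite value_eq0; apply/vunitsP; rewrite valg.
move=> i; have h := free (fun i => (e i)%:~R) _ i.
have : (e i)%:~R = 0 :> rat; last by move/eqP; rewrite intr_eq0 => /eqP.
apply: h; rewrite -[RHS]g0 /value raddf_sum; apply: eq_bigr => i' _.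
by rewrite raddfMz /= scaler_int.
Qed.

End Transcendence.

(** * Smooth representations *)

Lemma inj_surj_bij (T U : Type) (f : T -> U) : injective f ->
  (forall y, exists x, f x = y) -> bijective f.
Proof.
move=> f_inj /choice[g gP]; exists g => // x; apply: f_inj; exact: gP.
Qed.

Section Representations.
Variables (k F : closedFieldType) (iota : {rmorphism k -> F}).
Variable v : valuation_ring iota.
Local Notation acl := (acl iota).
Local Notation indep := (indep iota).
Local Notation G := (Gal iota).
Local Notation Gv := (decomp_group v).
Local Notation O := (vring v).
Variables (r : nat) (t : 'I_r -> F).
Hypothesis t0 : forall i, t i != 0.
Hypothesis t_val : forall e, O (monom t e) -> O (monom t e)^-1 -> forall i, e i = 0.
Hypothesis k_inj : injective (fun n : nat => n%:R : k).
Hypothesis room : forall s : seq F, exists x, ~ acl [set` s] x.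
Hypothesis coef_ex : exists C, coef_field v t C.

Lemma gal_into_vring (S : seq F) : exists s : G, acl [set` map s S] `<=` O.
Proof.
have [C hC] := coef_ex; have [CC CO CT] := hC.
have sC := acl_closed_subfield CC; have kC := acl_closed_range CC.
have [s' [s'C Ss']] := acl_finite_seq (fun x (_ : [set` S] x) => CT x).
pose A := [seq y <- s' | `[< C y >]].
have AC : [set` A] `<=` C by move=> y /=; rewrite mem_filter => /andP[/asboolP].
have [x [xs xC xi]] := coef_fresh room (A ++ tseq t) r hC.
have ti : indep [set` A] (tseq t) by apply: indep_sub (tseq_indep t0 t_val sC kC CO).
have [||s sA sx] := @gal_swap _ _ iota [set` A] (tseq t) x.
- by rewrite size_map size_enum_ord.
- apply/indep_cat; split=> //; apply: indep_sub xi => y.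
  by case=> /= ys; rewrite mem_cat ys ?orbT.
exists s => y yS; apply: CO; apply: CC; apply: acl_le yS => _ /= /mapP[z zS ->].
have zAt : acl ([set` A] `|` [set` tseq t]) z.
  apply: acl_mono (Ss' z zS) => w /= ws; have [Cw|tw] := s'C _ ws.
    by left; rewrite /= mem_filter ws asboolT.
  by right; move: tw; rewrite -tseqE.
apply: acl_mono (image_cat _ sx zAt).
  by move=> w [/AC|/xC].
by move=> a Aa; apply: sA; exact: sub_acl.
Qed.

Section Supports.
Variable W : smooth_rep G.
Implicit Types (w : W) (B S : seq F).

Definition stab_rep w : set G := [set g | rep_act g w = w].

Lemma stab_repM w g h : stab_rep w g -> stab_rep w h -> stab_rep w (g * h)%g.
Proof. by move=> gw hw; rewrite /stab_rep /= rep_actM hw. Qed.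
Lemma rep_actK (g : G) w : rep_act (g^-1)%g (rep_act g w) = w.
Proof. by rewrite -rep_actM mulVg rep_act1. Qed.
Lemma rep_actKV (g : G) w : rep_act g (rep_act (g^-1)%g w) = w.
Proof. by rewrite -rep_actM mulgV rep_act1. Qed.
Lemma stab_repV w g : stab_rep w g -> stab_rep w (g^-1)%g.
Proof. by move=> gw; rewrite /stab_rep /= -{1}gw rep_actK. Qed.

(** Stated with [acl S] since [decomp_support] and [transport] speak about stabilizers and agreement
    over algebraic closures. *)
Definition supports S w : Prop := (gal_fix (acl [set` S]) : set G) `<=` stab_rep w.
Definition good B w : Prop := acl [set` B] `<=` O /\ supports B w.

Lemma smooth_fix w : exists S, (gal_fix [set` S] : set G) `<=` stab_rep w.
Proof.
have /gal_openE/(_ 1%g)[|S [/finite_seqP[s ->] sP]] := rep_smooth w; first exact: rep_act1.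
by exists s => g gs; have := sP g gs; rewrite mul1g.
Qed.

Lemma smooth_support w : exists S, supports S w.
Proof.
have [S Sw] := smooth_fix w; exists S => g gS; apply: Sw.
exact: gal_fix_sub (@sub_acl _ _ iota _) gS.
Qed.

Lemma supports_subset S S' w : {subset S <= S'} -> supports S w -> supports S' w.
Proof.
move=> SS' Sw g gS; apply: Sw; apply: gal_fix_sub gS; apply: acl_mono => x.
exact: SS'.
Qed.

Lemma supports_lin S a w1 w2 : supports S w1 -> supports S w2 -> supports S (a *: w1 + w2).
Proof.
by move=> S1 S2 g gS; rewrite /stab_rep /= rep_linear (S1 g gS) (S2 g gS).
Qed.

Lemma supports_act (g : G) S w : supports S w -> supports (map g S) (rep_act g w).
Proof.
move=> Sw h hS; rewrite /stab_rep /=.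
suff e : rep_act (g^-1 * h * g)%g w = w by rewrite -{2}e -!rep_actM !mulgA mulgV mul1g.
apply: Sw => x xS; rewrite !galM hS ?galKV //.
by apply: gal_fix_acl xS => y yS; apply: sub_acl; exact: map_f.
Qed.

(** Passing from K to [acl K] stays inside the valuation ring by [algebraic_vring], and
    [finite_support] needs a closed set. *)
Lemma invariants_good (K : set F) w : subfield K -> range iota `<=` K -> K `<=` O ->
  invariants (gal_fix K) w -> exists B, good B w.
Proof.
move=> sK kK KO Kw; have KO' : acl K `<=` O.
  by move=> x /(acl_sub_alg sK kK (fun _ => id)); exact: algebraic_vring.
have [S Sw] := smooth_fix w.
have [|B [BK Bw]] := finite_support room (@stab_repM w) (@stab_repV w) (@acl_acl _ _ iota K) _ Sw.
  by move=> g gK; apply: Kw; exact: gal_fix_sub (@sub_acl _ _ iota _) gK.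
by exists B; split=> // x xB; apply: KO'; exact: acl_le xB.
Qed.

Lemma good_Wv B w : good B w -> Wv_set v w.
Proof.
move=> [BO Bw]; exists 1%N, (fun=> w); split; last by rewrite big_ord1.
move=> _; exists (acl [set` B]); split=> //; first exact: acl_subfield.
exact: acl_range.
Qed.

Lemma Wv_sum w : Wv_set v w -> exists (n : nat) (u : 'I_n -> W),
  (forall i, exists B, good B (u i)) /\ w = \sum_(i < n) u i.
Proof.
move=> [n [u [uP ->]]]; exists n, u; split=> // i.
by have [K [sK kK KO Ku]] := uP i; exact: invariants_good Ku.
Qed.

Lemma Wv_lin a w1 w2 : Wv_set v w1 -> Wv_set v w2 -> Wv_set v (a *: w1 + w2).
Proof.
by have [_ h] := Wv_submod v W; have := h a w1 w2; rewrite !inE.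
Qed.

End Supports.

(** * Extending a morphism from W_v to W *)

Section Extend.
Variables W W' : smooth_rep G.
Variable f : Defs.Hom (Wv v W) (res_rep v W').

(** f as a function on all of W, with the irrelevant value f 0 outside W_v; this avoids carrying
    membership proofs through the computations. *)
Definition on_Wv (w : W) : W' := f (insubd (0 : Wv_space v W) w).

Lemma on_WvE (w : W) (x : Wv v W) : Wv_incl x = w -> on_Wv w = f x.
Proof.
move=> <-; rewrite /on_Wv; congr (f _); apply: val_inj; rewrite val_insubd.
by rewrite (valP (x : Wv_space v W)).
Qed.

Lemma Wv_lift (w : W) : Wv_set v w -> exists x : Wv v W, Wv_incl x = w.
Proof. by move=> hw; exists (Sub w (mem_set hw) : Wv_space v W). Qed.

Lemma on_Wv_lin a (w1 w2 : W) : Wv_set v w1 -> Wv_set v w2 ->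
  on_Wv (a *: w1 + w2) = a *: on_Wv w1 + on_Wv w2.
Proof.
move=> /Wv_lift[x1 e1] /Wv_lift[x2 e2]; rewrite (on_WvE e1) (on_WvE e2).
rewrite (@on_WvE _ (a *: x1 + x2)) ?hom_linear //.
by rewrite -e1 -e2.
Qed.

Lemma on_Wv_act (g : G) (w : W) : stab_v v g -> Wv_set v w ->
  on_Wv (rep_act g w) = rep_act g (on_Wv w).
Proof.
move=> gv /Wv_lift[x e]; rewrite (on_WvE e).
pose g' : Gv := Sub g (mem_set gv).
by rewrite (@on_WvE _ (rep_act g' x)) ?hom_equiv // -e.
Qed.

(** By equivariance the image is fixed by the elements of G_v over [acl B], and [decomp_support]
    upgrades this to all of G. *)
Lemma on_Wv_good B (w : W) : good B w -> good B (on_Wv w).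
Proof.
move=> gBw; have [BO Bw] := gBw; split=> //.
have [S Sw] := smooth_fix (on_Wv w).
apply: (decomp_support t0 t_val k_inj room coef_ex (@stab_repM _ _) (@stab_repV _ _) BO Sw).
move=> g gv gB; rewrite /stab_rep /= -on_Wv_act //; last exact: good_Wv gBw.
by rewrite Bw.
Qed.

(** [transport] replaces s by some g in G_v that agrees with it on [acl B]. As B supports both the
    vector and its image, s and g act alike on both. *)
Lemma on_Wv_transport B (w : W) (s : G) : good B w -> acl [set` map s B] `<=` O ->
  on_Wv (rep_act s w) = rep_act s (on_Wv w).
Proof.
move=> gBw sBO; have [BO Bw] := gBw; have [_ Bfw] := on_Wv_good gBw.
have [g gv gs] := transport t0 t_val k_inj room coef_ex BO sBO.
have fixB : gal_fix (acl [set` B]) (g^-1 * s)%g.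
  by move=> x xB; rewrite galM -gs // galKV.
have same (U : smooth_rep G) (u : U) : stab_rep u (g^-1 * s)%g -> rep_act s u = rep_act g u.
  by rewrite /stab_rep /= rep_actM => e; rewrite -[LHS](rep_actKV g) e.
rewrite (same _ w) ?(same _ (on_Wv w)); first by apply: on_Wv_act => //; exact: good_Wv gBw.
  exact: Bfw.
exact: Bw.
Qed.

(** Apply [on_Wv_transport] to the vector s w and the automorphism s' s^-1, which carries its
    support s S to s' S. *)
Lemma transport_indep_choice (w : W) S S' (s s' : G) : supports S w ->
  acl [set` map s S] `<=` O -> {subset S <= S'} -> acl [set` map s' S'] `<=` O ->
  rep_act (s^-1)%g (on_Wv (rep_act s w)) = rep_act (s'^-1)%g (on_Wv (rep_act s' w)).
Proof.
move=> Sw sO SS' s'O.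
have gsw : good (map s S) (rep_act s w) by split=> //; exact: supports_act.
have := @on_Wv_transport _ _ (s' * s^-1)%g gsw.
rewrite -rep_actM mulgVK => ->; first by rewrite rep_actM rep_actK.
move=> x xs; apply: s'O; apply: acl_mono xs => y /=; rewrite -map_comp => /mapP[z zS ->] /=.
by rewrite galM galKV map_f // SS'.
Qed.

(** Two choices of support and automorphism are each compared with an automorphism moving the union
    of the supports into the ring. *)
Lemma extension_ex (w : W) : exists w' : W', forall S (s : G), supports S w ->
  acl [set` map s S] `<=` O -> w' = rep_act (s^-1)%g (on_Wv (rep_act s w)).
Proof.
have [S0 S0w] := smooth_support w; have [s0 s0O] := gal_into_vring S0.
exists (rep_act (s0^-1)%g (on_Wv (rep_act s0 w))) => S s Sw sO.
have [s1 s1O] := gal_into_vring (S0 ++ S).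
rewrite (transport_indep_choice S0w s0O _ s1O) ?(transport_indep_choice Sw sO _ s1O) //.
  by move=> x xS; rewrite mem_cat xS orbT.
by move=> x xS; rewrite mem_cat xS.
Qed.

(** Linearity is read off from one s that moves a common support, equivariance by replacing s with s
    g. Agreement with f holds for good vectors, where s = 1 is allowed, and these span W_v. *)
Lemma restrict_surj : exists g : Defs.Hom W W', Defs.restrict v g = f.
Proof.
have [h hP] := choice extension_ex.
have h_good B w : good B w -> h w = on_Wv w.
  move=> [BO Bw]; rewrite (hP w B 1%g Bw) ?rep_act1 ?invg1 ?rep_act1 //.
  by rewrite (_ : map _ B = B) // -[RHS]map_id; exact: eq_map.
have h_lin : linear h.
  move=> a w1 w2; have [S1 S1w] := smooth_support w1; have [S2 S2w] := smooth_support w2.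
  have Sw1 : supports (S1 ++ S2) w1.
    by apply: supports_subset S1w => x xS; rewrite mem_cat xS.
  have Sw2 : supports (S1 ++ S2) w2.
    by apply: supports_subset S2w => x xS; rewrite mem_cat xS orbT.
  have [s sO] := gal_into_vring (S1 ++ S2).
  rewrite (hP _ _ s Sw1) // (hP _ _ s Sw2) // (hP _ _ s (supports_lin a Sw1 Sw2)) //.
  rewrite rep_linear on_Wv_lin ?rep_linear //.
    by apply: (@good_Wv _ (map s (S1 ++ S2))); split=> //; exact: supports_act.
  by apply: (@good_Wv _ (map s (S1 ++ S2))); split=> //; exact: supports_act.
have h_act (g : G) w : h (rep_act g w) = rep_act g (h w).
  have [S Sw] := smooth_support w; have [s sO] := gal_into_vring (map g S).
  rewrite (hP _ _ s (@supports_act _ g _ _ Sw)) // (hP _ _ (s * g)%g Sw).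
    by rewrite -!rep_actM invgM mulgA mulgV mul1g.
  by move: sO; rewrite -map_comp.
exists (hom_of h_lin h_act); apply: hom_ext => x /=.
rewrite -(on_WvE (erefl (Wv_incl x))).
have [n [u [uP e]]] := Wv_sum (Wv_inclP x).
rewrite -[LHS]/(h (Wv_incl x)) e.
suff [] : h (\sum_(i < n) u i) = on_Wv (\sum_(i < n) u i) /\ Wv_set v (\sum_(i < n) u i) by [].
have W0 : Wv_set v (0 : W).
  by have [h0 _] := Wv_submod v W; move: h0; rewrite inE.
have f0 : on_Wv 0 = 0 by have := on_Wv_lin (-1) W0 W0; rewrite scaler0 addr0 scaleN1r addNr.
have h0 : h 0 = 0 by have := h_lin (-1) 0 0; rewrite scaler0 addr0 scaleN1r addNr.
elim/big_ind: _ => [|w1 w2 [e1 v1] [e2 v2]|i _]; first by rewrite f0 h0.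
  rewrite -[w1]scale1r; split; last exact: Wv_lin.
  by rewrite h_lin on_Wv_lin // e1 e2.
have [B gB] := uP i; split; last exact: good_Wv gB.
exact: h_good gB.
Qed.

Lemma hom_incl_surj : exists g : Defs.Hom (Wv v W) (Wv v W'), hom_incl g = f.
Proof.
have fWv (x : Wv v W) : Wv_set v (f x).
  have [n [u [uP e]]] := Wv_sum (Wv_inclP x).
  rewrite -(on_WvE (erefl (Wv_incl x))) e.
  suff [] : Wv_set v (on_Wv (\sum_(i < n) u i)) /\ Wv_set v (\sum_(i < n) u i) by [].
  have W0 (U : smooth_rep G) : Wv_set v (0 : U).
    by have [h0 _] := Wv_submod v U; move: h0; rewrite inE.
  have f0 : on_Wv 0 = 0.
    by have := on_Wv_lin (-1) (W0 W) (W0 W); rewrite scaler0 addr0 scaleN1r addNr.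
  elim/big_ind: _ => [|w1 w2 [e1 v1] [e2 v2]|i _]; first by rewrite f0.
    rewrite -[w1]scale1r on_Wv_lin //; split; exact: Wv_lin.
  by have [B gB] := uP i; split; [exact: good_Wv (on_Wv_good gB)|exact: good_Wv gB].
pose g (x : Wv v W) : Wv v W' := (Sub (f x) (mem_set (fWv x)) : Wv_space v W').
have g_lin : linear g by move=> a x y; apply: val_inj; exact: (hom_linear f).
have g_act (s : Gv) x : g (rep_act s x) = rep_act s (g x).
  by apply: val_inj; exact: (hom_equiv f).
by exists (hom_of g_lin g_act); apply: hom_ext.
Qed.

End Extend.

Lemma restrict_inj (W W' : smooth_rep G) : injective (@Defs.restrict k F iota v W W').
Proof.
move=> f g e; apply: hom_ext => w; have [S Sw] := smooth_support w.
have [s sO] := gal_into_vring S.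
have [x xw] : exists x : Wv v W, Wv_incl x = rep_act s w.
  by apply/Wv_lift/(@good_Wv _ (map s S)); split=> //; exact: supports_act.
have e' : f (Wv_incl x) = g (Wv_incl x) := congr1 (fun h => hom_fun h x) e.
rewrite xw !hom_equiv in e'.
by rewrite -[LHS](rep_actK s) e' rep_actK.
Qed.

Lemma restrict_iso (W W' : smooth_rep G) : Q_isomorphism (@Defs.restrict k F iota v W W').
Proof.
split; first by move=> a f g; apply: hom_ext.
by apply: inj_surj_bij; [exact: restrict_inj|exact: restrict_surj].
Qed.

Lemma hom_incl_inj (W W' : smooth_rep G) : injective (@hom_incl k F iota v W W').
Proof.
move=> f g e; apply: hom_ext => x; apply: val_inj.
exact: (congr1 (fun h => hom_fun h x) e).
Qed.

Lemma hom_incl_iso (W W' : smooth_rep G) : Q_isomorphism (@hom_incl k F iota v W W').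
Proof.
split; first by move=> a f g; apply: hom_ext.
by apply: inj_surj_bij; [exact: hom_incl_inj|exact: hom_incl_surj].
Qed.

(** Restriction is [Wv_map] followed by [hom_incl]; as restriction and [hom_incl] are bijective, so
    is [Wv_map]. *)
Lemma Wv_functor_ff : fully_faithful (Wv_functor v).
Proof.
move=> W W'; have [_ rB] := restrict_iso W W'; have [_ iB] := hom_incl_iso W W'.
have comp f : hom_incl (Wv_map v f) = Defs.restrict v f by apply: hom_ext.
apply: inj_surj_bij => [f g e|f].
  by apply: (bij_inj rB); rewrite -!comp; congr hom_incl.
have [h _ hK] := rB; exists (h (hom_incl f)); apply: (bij_inj iB).
by rewrite [LHS]comp hK.
Qed.

End Representations.

(* [functions] has its own [restrict]. *)
Import Defs.

Theorem lemma4p3 (k F : closedFieldType) (iota : {rmorphism k -> F})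
    (char0 : [pchar F]%R =i pred0)
    (trdeg : countably_infinite_trdeg iota)
    (r : nat) (v : valuation_ring iota) (discr : discrete_of_rank v r) :
  (forall W W' : smooth_rep (Gal iota),
     Q_isomorphism (@Defs.restrict k F iota v W W') /\
     Q_isomorphism (@hom_incl k F iota v W W')) /\
  fully_faithful (Wv_functor v).
Proof.
have [_ _ [T [t [Tinj [Tind _] tbasis gen]]]] := discr.
pose tv i := val (t i).
have t0 i : tv i != 0 by exact: mulgrp_neq0.
have t_val := monom_units tbasis.
have room := trdeg_room trdeg.
have k_inj := natr_inj iota char0.
(* The first coefficient field is the closure of the lifted transcendence base of the residue field;
   the generation clause of discreteness says that together with the t_i it generates F up to
   algebraic closure. *)
have coef_ex : exists C, coef_field v tv C.
  exists (acl iota [set val y | y in T]); split.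
  - exact: acl_acl.
  - exact: acl_lift_vring.
  - move=> x; have : acl iota ([set val y | y in T] `|` range tv) x.
      by rewrite /acl setUA; exact: gen.
    by apply: acl_mono => y [Ty|]; [left; exact: sub_acl|right].
split=> [W W'|]; last exact: (Wv_functor_ff t0 t_val k_inj room coef_ex).
by split; [exact: (restrict_iso t0 t_val k_inj room coef_ex)|exact: (hom_incl_iso t0 t_val k_inj room coef_ex)].
Qed.
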